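(* Let $\alpha=\frac12$. For $\nu>0$ small enough, if $G$ is chosen according to $\mathrm{Poi}_{1/2,\nu}(n)$, then with constant probability $L_2(G)=\Theta(\log n)$. That is, there is $\nu_0>0$ such that for every constant $0<\nu\le\nu_0$ there are constants $p>0$, $0<c_1\le c_2$ and $n_0$ such that for all $n\ge n_0$, $\Pr\big(c_1\log n\le L_2(G)\le c_2\log n\big)\ge p$.
   Context: The model $\mathrm{Poi}_{\alpha,\nu}(n)$ (Poissonized random hyperbolic graph): let $R:=2\log(n/\nu)$ ($\log$ is the natural logarithm). Let $V$ be the point set of a Poisson point process on the disk of radius $R$ centered at the origin $O$ of the hyperbolic plane (polar coordinates $(r,\theta)$, $0\le r<R$, $0\le\theta<2\pi$), with intensity function $g(r,\theta)=\nu e^{R/2}f(r,\theta)=n f(r,\theta)$ with respect to $dr\,d\theta$, where $f(r,\theta)=\frac{1}{2\pi}f(r)$ and $f(r)=\frac{\alpha\sinh(\alpha r)}{\cosh(\alpha R)-1}$ for $0\le r<R$ (and $0$ otherwise). The vertices of $G$ are the points of $V$; two distinct vertices $u=(r_u,\theta_u)$ and $u'=(r_{u'},\theta_{u'})$ are adjacent iff their hyperbolic distance $\mathrm{d_h}$ is at most $R$, where $\cosh \mathrm{d_h}=\cosh r_u\cosh r_{u'}-\sinh r_u\sinh r_{u'}\cos(\theta_u-\theta_{u'})$. The size of a component is its number of vertices, and $L_2(G)$ is the size of the second largest connected component of $G$ (taken to be $0$ if there are fewer than two components). *)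

(* Defs.v *)
(* MathComp-Analysis; real numbers are an arbitrary [R : realType]. *)
From HB Require Import structures.
From mathcomp Require Import all_boot all_order all_algebra.
From mathcomp Require Import finmap.
From mathcomp Require Import ring.
From mathcomp Require Import all_classical all_reals all_analysis.

Set Implicit Arguments.
Unset Strict Implicit.
Unset Printing Implicit Defensive.

Import Order.TTheory GRing.Theory Num.Theory.
Import numFieldNormedType.Exports.

Local Open Scope classical_set_scope.
Local Open Scope ring_scope.

Section Graph.

Definition components (T : finType) (e : rel T) : {set {set T}} :=
  equivalence_partition (connect e) [set: T]%SET.

(* Second entry of the list of component sizes in nonincreasing order; [nth]
   returns 0 when there are fewer than two components.  With ties, the second
   largest component may have the same size as the largest one. *)
Definition L2 (T : finType) (e : rel T) : nat :=
  nth 0%N (sort geq [seq #|C| | C : {set T} in components e]) 1.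

End Graph.

Section HyperbolicPlane.
Context {R : realType}.
Implicit Types (x : R) (u v : R * R).

Definition cosh x : R := (expR x + expR (- x)) / 2.
Definition sinh x : R := (expR x - expR (- x)) / 2.
Definition arcosh x : R := ln (x + Num.sqrt (x ^+ 2 - 1)).

(* Points are given by polar coordinates [(r, theta)] around the origin. *)
Definition cosh_dist u v : R :=
  cosh u.1 * cosh v.1 - sinh u.1 * sinh v.1 * cos (u.2 - v.2).

Definition hyp_dist u v : R := arcosh (cosh_dist u v).

Lemma arcosh_ge0 x : 1 <= x -> 0 <= arcosh x.
Proof. by move=> x1; rewrite ln_ge0// (le_trans x1)// lerDl sqrtr_ge0. Qed.

Lemma arcoshK x : 1 <= x -> cosh (arcosh x) = x.
Proof.
move=> x1; rewrite /cosh /arcosh; set s := Num.sqrt _.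
have s0 : 0 <= s by exact: sqrtr_ge0.
have y0 : 0 < x + s by rewrite ltr_wpDr// (lt_le_trans _ x1).
have s2 : s ^+ 2 = x ^+ 2 - 1 by rewrite sqr_sqrtr// subr_ge0 exprn_ege1.
rewrite expRN lnK ?posrE//.
have -> : (x + s)^-1 = x - s.
  apply: (mulfI (lt0r_neq0 y0)); rewrite mulfV ?lt0r_neq0//.
  by rewrite mulrC -subr_sqr s2 opprB addrCA subrr addr0.
by rewrite addrACA subrr addr0 -mulr2n -[x *+ 2]mulr_natr mulfK.
Qed.

Lemma cosh_dist_ge1 u v : 0 <= u.1 -> 0 <= v.1 -> 1 <= cosh_dist u v.
Proof.
move=> u0 v0.
have sinh0 x : 0 <= x -> 0 <= sinh x.
  by move=> x0; rewrite divr_ge0// subr_ge0 ler_expR ge0_cp.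
have cosh1 x : 1 <= cosh x.
  rewrite ler_pdivlMr// mul1r -subr_ge0 expRN.
  have e0 := expR_gt0 x.
  have -> : expR x + (expR x)^-1 - 2 = (expR x - 1) ^+ 2 / expR x.
    by field; rewrite gt_eqF.
  by rewrite divr_ge0 ?sqr_ge0// ltW.
apply: (le_trans (cosh1 (u.1 - v.1))).
have -> : cosh (u.1 - v.1) = cosh u.1 * cosh v.1 - sinh u.1 * sinh v.1.
  rewrite /cosh /sinh opprB !expRD !expRN.
  by field; rewrite !gt_eqF// expR_gt0.
rewrite /cosh_dist lerD2l lerN2; apply: ler_piMr; last exact: cos_le1.
by apply: mulr_ge0; exact: sinh0.
Qed.

Lemma hyp_dist_ge0 u v : 0 <= u.1 -> 0 <= v.1 -> 0 <= hyp_dist u v.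
Proof. by move=> u0 v0; apply: arcosh_ge0; exact: cosh_dist_ge1. Qed.

Lemma cosh_hyp_dist u v : 0 <= u.1 -> 0 <= v.1 ->
  cosh (hyp_dist u v) =
  cosh u.1 * cosh v.1 - sinh u.1 * sinh v.1 * cos (u.2 - v.2).
Proof. by move=> u0 v0; apply: arcoshK; exact: cosh_dist_ge1. Qed.

End HyperbolicPlane.

Section PointProcess.
Local Open Scope ereal_scope.
Context d (T : measurableType d) (R : realType) (P : probability T R).

(* Events about nat-valued variables are arbitrary sets of values, the
   sigma-algebra on [nat] being discrete. *)
Definition mutually_independent (k : nat) (X : 'I_k -> T -> nat) : Prop :=
  forall S : 'I_k -> set nat,
    P (\bigcap_(i in [set: 'I_k]) (X i @^-1` S i)) =
    \prod_(i < k) P (X i @^-1` S i).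

Definition npoints (V : T -> {fset (R * R)}) (A : set (R * R)) (w : T) : nat :=
  #|` [fset x in V w | x \in A]%fset|.

Definition intensity_measure (g : R * R -> R) (A : set (R * R)) : R :=
  Rintegral (lebesgue_measure \x lebesgue_measure) A g.

(* A Poisson point process on [D], with intensity function [g] (of finite total
   mass) with respect to the Lebesgue measure of the two coordinates.
   The second argument of [poisson_prob] is a dummy, and [poisson_prob] of rate
   0 is the Dirac mass at 0. *)
Definition poisson_process (D : set (R * R)) (g : R * R -> R)
    (V : T -> {fset (R * R)}) : Prop :=
  [/\ forall w x, x \in V w -> D x,
      forall A, measurable A -> A `<=` D -> measurable_fun setT (npoints V A),
      forall A, measurable A -> A `<=` D -> forall S : set nat,
        P (npoints V A @^-1` S) = poisson_prob (intensity_measure g A) 0%N S &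
      forall (k : nat) (A : 'I_k -> set (R * R)),
        (forall i, measurable (A i)) -> (forall i, A i `<=` D) ->
        trivIset setT A -> mutually_independent (fun i => npoints V (A i))].

End PointProcess.

Section RandomHyperbolicGraph.
Context {R : realType}.
Implicit Types (alpha nu : R) (n : nat).

Definition radius nu n : R := 2 * ln (n%:R / nu).

Definition disk nu n : set (R * R) :=
  [set p | 0 <= p.1 < radius nu n /\ 0 <= p.2 < 2 * pi].

Definition radial_density alpha nu n (r : R) : R :=
  if 0 <= r < radius nu n
  then alpha * sinh (alpha * r) / (cosh (alpha * radius nu n) - 1) else 0.

(* The factor [nu * expR (radius nu n / 2)] is equal to [n] for [n > 0] and
   [nu > 0].  The angular range is enforced by [disk]. *)
Definition intensity alpha nu n (p : R * R) : R :=
  nu * expR (radius nu n / 2) * ((2 * pi)^-1 * radial_density alpha nu n p.1).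

Definition Poi d (T : measurableType d) (P : probability T R) alpha nu n
    (V : T -> {fset (R * R)}) : Prop :=
  poisson_process P (disk nu n) (intensity alpha nu n) V.

Definition hyp_adj nu n (V : {fset (R * R)}) : rel V :=
  fun u v => (u != v) && (hyp_dist (val u) (val v) <= radius nu n).

End RandomHyperbolicGraph.

Arguments hyp_adj {R} nu n V : rename.

(* Main.v *)
(** Write [x = e^(r/2)] for a point at radius [r], and [N = e^(R/2) = n / nu]. The
    points with [x1 <= x < x2] over an angular interval of length [s] have mean number
    of order [nu s (x2 - x1)], and points [x], [y] at angular distance [t] are adjacent
    iff, up to constants, [t x y <= N].

    Lower bound. With positive probability no point has [x < 48]. Following a 4-adic
    tree of angular arcs, an arc at scale [X] survives if its box [X <= x < 4 X] is
    empty and one of two well separated subarcs survives at scale [4 X]. For small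
    [nu] the box is empty with probability at least 3/4, so the survival
    probability is multiplied by at least 5/4 at each of the order of [ln n] scales
    until it reaches 1/3, even when the survival of a leaf has probability as small
    as a small negative power of [n]. This leaves room to ask that a leaf contain a
    path of order [ln n] consecutive outermost points and nothing else. No point outside
    can reach that path, and two leaves in disjoint arcs give two components.

    Upper bound, with probability tending to 1. The points with [x <= sqrt N / 2] form
    a clique, and all points with [x <= N / tau] are adjacent to it. Every other component
    lives in the band [N / tau < x], which is a one-dimensional graph of bounded range
    and bounded density: every block of order [ln n] consecutive arcs contains an empty
    arc, and at most order [ln n] points. *)

(* For [alpha = 1/2] the intensity is nearly uniform in the coordinate [x], so the box of an arc of
   width [48 / X] at heights [[X, 4 X)] has area 144 at every scale: each scale costs the same
   factor, and a small [nu] keeps this loss below the gain from branching in two. A leaf at scale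
   [Y] costs about [exp (- D N / Y)] while [j] scales gain [(5/4)^j]; the depth is chosen so that
   [N / Y] is of order [j], which makes the leaf both affordable and of logarithmic size. The lower
   bound holds only with some probability [p], so the upper bound must fail with probability below
   [p], with a constant that does not depend on [p]. The process is given only through counts in
   regions: independence of compound events and measurability of [L2] have to be derived from these
   counts, the former through [determined], the latter by refining a grid. *)
Require Import Defs.
From mathcomp Require Import all_boot all_order all_algebra.
From mathcomp Require Import finmap.
From mathcomp Require Import ring lra zify.
From mathcomp Require Import all_classical all_reals all_analysis.
From mathcomp Require Import measurable_realfun.
Import Order.TTheory GRing.Theory Num.Theory.
Import numFieldNormedType.Exports.
Import Defs.
Local Open Scope classical_set_scope.
Local Open Scope ring_scope.

Set Implicit Arguments.
Unset Strict Implicit.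
Unset Printing Implicit Defensive.

(** * Component sizes *)

Section GraphFacts.
Variables (T : finType) (e : rel T).
Hypothesis esym : symmetric e.

Definition component (x : T) : {set T} := [set y | connect e x y]%SET.

Lemma components_imset : components e = [set component x | x : T]%SET.
Proof.
apply/setP => C; apply/imsetP/imsetP => -[x _ ->]; exists x => //;
  by apply/setP => y; rewrite !inE.
Qed.

Lemma component_eq x y : (component x == component y) = connect e x y.
Proof.
have sc := sym_connect_sym esym.
apply/eqP/idP => [cxy|exy].
  have : y \in component x by rewrite cxy inE connect0.
  by rewrite inE.
by apply/setP => z; rewrite !inE (same_connect sc exy).
Qed.

(** Counting entries avoids any choice among ties. A positive [s] rules out the default 0 of [nth]
    on lists with fewer than two entries. *)
Lemma nth1_sort_geq (l : seq nat) (s : nat) : (0 < s)%N ->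
  (s <= nth 0%N (sort geq l) 1)%N = (1 < count (leq s) l)%N.
Proof.
move=> s0; have /permP/(_ (leq s)) <- : perm_eq (sort geq l) l by rewrite perm_sort.
have : sorted geq (sort geq l) by apply: sort_sorted => x y; exact: leq_total.
case: (sort geq l) => [|a [|b t]]/=; [by rewrite leqn0 gtn_eqF|idtac|].
  by rewrite leqn0 gtn_eqF// addn0; case: (s <= a)%N.
move=> /andP[ab pt]; rewrite /geq/= in ab.
have [sb|bs] := leqP s b.
  by rewrite (leq_trans sb ab).
suff -> : count (leq s) t = 0%N by case: (s <= a)%N.
apply/eqP; rewrite -leqn0 leqNgt -has_count -all_predC.
apply/allP => x xt /=; rewrite -ltnNge; apply: leq_ltn_trans bs.
have := order_path_min _ pt => /(_ (rev_trans leq_trans))/allP/(_ _ xt).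
by [].
Qed.

Lemma L2_geP (s : nat) : (0 < s)%N ->
  reflect (exists x y, [/\ ~~ connect e x y, s <= #|component x| & s <= #|component y|])%N
          (s <= L2 e)%N.
Proof.
move=> s0; rewrite /L2 nth1_sort_geq// count_map -size_filter.
set F := [seq _ <- _ | _].
have uF : uniq F by rewrite filter_uniq// enum_uniq.
have memF C : (C \in F) = (C \in components e) && (s <= #|C|)%N.
  by rewrite mem_filter/= mem_enum andbC.
apply: (iffP idP) => [|[x [y [nxy sx sy]]]].
  case: F uF memF => [|C [|D F]]//= /andP[+ _] memF _.
  rewrite inE negb_or => /andP[CD _].
  have : C \in C :: D :: F by rewrite inE eqxx.
  have : D \in C :: D :: F by rewrite !inE eqxx orbT.
  rewrite !memF components_imset => /andP[/imsetP[y _ Dy] sD] /andP[/imsetP[x _ Cx] sC].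
  by exists x, y; rewrite -component_eq -Cx -Dy.
have : (size [:: component x; component y] <= size F)%N.
  apply: uniq_leq_size; first by rewrite /= inE component_eq nxy.
  by move=> C; rewrite !inE memF components_imset => /orP[]/eqP->; rewrite imset_f.
by [].
Qed.

(** Of two distinct components at most one contains [x], so the other already obeys the bound. In
    the application [x] is a hub of the giant component. *)
Lemma L2_le (x : T) (s : nat) :
  (forall y, ~~ connect e x y -> #|component y| <= s)%N -> (L2 e <= s)%N.
Proof.
move=> xs; rewrite leqNgt; apply/negP => /L2_geP -/(_ isT)[y [z [nyz sy sz]]].
have sc := sym_connect_sym esym.
have [xy|/xs] := boolP (connect e x y); last by rewrite leqNgt sy.
have /xs : ~~ connect e x z.
  apply: contra nyz => xz; apply: connect_trans xz; by rewrite sc.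
by rewrite leqNgt sz.
Qed.

Lemma connect_closed (A : pred T) : (forall x y, A x -> e x y -> A y) ->
  forall x y, A x -> connect e x y -> A y.
Proof.
move=> Ae x y Ax /connectP[p ep ->]; elim: p x Ax ep => //= z p IH x Ax /andP[exz].
by apply: IH; exact: Ae exz.
Qed.

End GraphFacts.

(** Serves to replace the points of a sample by the grid cells that contain them. *)
Lemma L2_iso (T T' : finType) (e : rel T) (e' : rel T') (f : T -> T') :
  symmetric e -> symmetric e' -> bijective f ->
  (forall x y, e' (f x) (f y) = e x y) -> L2 e = L2 e'.
Proof.
move=> se se' bf fe; have [g fK gK] := bf.
have cf x y : connect e' (f x) (f y) = connect e x y.
  apply/idP/idP => /connectP[p].
    elim: p x => [|z p IH] x/=; first by move=> _ /(bij_inj bf)->.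
    move=> /andP[exz ep] yl; apply: (@connect_trans _ _ (g z)).
      by apply: connect1; rewrite -fe gK.
    by apply: IH; rewrite gK.
  elim: p x => [|z p IH] x/=; first by move=> _ ->.
  move=> /andP[exz ep] yl; apply: (@connect_trans _ _ (f z)); last exact: IH.
  by apply: connect1; rewrite fe.
have cardf x : #|component e' (f x)| = #|component e x|.
  rewrite -(card_imset _ (bij_inj bf)); apply: eq_card => y; rewrite inE.
  apply/idP/imsetP => [|[z]]; last by rewrite inE -cf => ? ->.
  by rewrite -[y]gK cf => c; exists (g y); rewrite ?inE.
have key s : (s <= L2 e)%N = (s <= L2 e')%N.
  case: s => // s; apply/(L2_geP _ _)/(L2_geP _ _) => //.
    by move=> [x [y H]]; exists (f x), (f y); rewrite cf !cardf.
  by move=> [x [y H]]; exists (g x), (g y); rewrite -cf -!cardf !gK.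
by apply/eqP; rewrite eqn_leq key leqnn -key leqnn.
Qed.

(** * The intensity measure of a box *)

Section Mass.
Context {R : realType}.
Local Notation mu := (@lebesgue_measure R).

(** The integrand is extended by 0 to a product of a function of each coordinate, to which Tonelli
    applies on the whole plane. *)
Lemma integral_prod_fst (A B : set R) (h : R -> R) :
  measurable A -> measurable B -> measurable_fun setT h ->
  (forall x, A x -> 0 <= h x) ->
  (\int[(mu \x mu)%E]_(z in A `*` B) (h z.1)%:E =
   (\int[mu]_(x in A) (h x)%:E) * mu B)%E.
Proof.
move=> mA mB mh h0; set k := (h \_ A).
have k0 x : 0 <= k x by rewrite /k patchE; case: ifPn => // /set_mem; exact: h0.
have mk : measurable_fun setT k.
  by apply/(measurable_restrictT h mA); exact: measurable_funTS.
pose f : (R * R)%type -> \bar R := fun z => ((k z.1)%:E * (\1_B z.2)%:E)%E.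
have f0 z : (0 <= f z)%E by rewrite mule_ge0// lee_fin.
have mf : measurable_fun [set: (R * R)%type] f.
  apply: emeasurable_funM; apply/measurable_EFinP.
    by apply: measurableT_comp => //; exact: measurable_fst.
  by apply: measurableT_comp => //; exact: measurable_snd.
rewrite integral_mkcond.
transitivity (\int[(mu \x mu)%E]_z f z)%E.
  apply: eq_integral => -[x y] _; rewrite /f /k !patchE indicE/= in_setX/=.
  by case: (x \in A); case: (y \in B); rewrite /= ?(mule1,mule0,mul0e).
rewrite fubini_tonelli1//; transitivity (\int[mu]_x ((k x)%:E * mu B))%E.
  apply: eq_integral => x _; rewrite /fubini_F /f/= ge0_integralZl_EFin//.
  - by rewrite integral_indic// setIT.
  - exact/measurable_EFinP.
rewrite ge0_integralZr//.
- congr (_ * _)%E; rewrite [RHS]integral_mkcond; apply: eq_integral => x _.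
  by rewrite /k !patchE; case: ifP.
- exact/measurable_EFinP.
- by move=> x _; rewrite lee_fin.
Qed.

Lemma is_derive_cosh (x : R) : is_derive x 1 cosh (sinh x).
Proof.
rewrite /cosh /sinh; apply: is_derive_eq.
by rewrite /GRing.scale/=; ring.
Qed.

Lemma continuous_sinh : continuous (@sinh R).
Proof.
move=> x; apply: cvgM; last exact: cvg_cst.
apply: cvgB; first exact: continuous_expR.
apply: continuous_comp; [exact: opp_continuous|exact: continuous_expR].
Qed.

Lemma sinh_ge0 (x : R) : 0 <= x -> 0 <= sinh x.
Proof. by move=> x0; rewrite divr_ge0// subr_ge0 ler_expR ge0_cp. Qed.

Lemma integral_sinh_half (a b : R) : 0 <= a -> a <= b ->
  (\int[mu]_(x in `[a, b[) (sinh (2^-1 * x))%:E =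
   (2 * (cosh (2^-1 * b) - cosh (2^-1 * a)))%:E)%E.
Proof.
move=> a0; rewrite le_eqVlt => /predU1P[<-|ab].
  by rewrite set_itvco0 integral_set0 subrr mulr0.
have cs : continuous (fun x : R => sinh (2^-1 * x)).
  move=> x; apply: (@continuous_comp _ _ _ (fun x : R => 2^-1 * x) sinh).
    exact: mulrl_continuous.
  exact: continuous_sinh.
pose F (x : R) := 2 * cosh (2^-1 * x).
have dF (x : R) : is_derive x 1 F (sinh (2^-1 * x)).
  have ? := is_derive_cosh (2^-1 * x).
  have dm : is_derive x 1 (fun x : R => 2^-1 * x) 2^-1.
    by apply: is_derive_eq; rewrite /GRing.scale/= mulr1.
  have := @is_derive1_comp _ cosh (fun x : R => 2^-1 * x) x _ _ _ dm.
  move=> /(_ _ (is_derive_cosh _)) dc.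
  have -> : sinh (2^-1 * x) = 2 *: (sinh (2^-1 * x) / 2).
    by rewrite /GRing.scale/=; field.
  exact: (is_deriveZ 2 dc).
have cF : continuous F.
  by move=> x; apply/differentiable_continuous/derivable1_diffP; exact: ex_derive.
rewrite integral_itv_bndo_bndc; last first.
  apply/measurable_EFinP/measurable_funTS. exact: continuous_measurable_fun.
have -> : (2 * (cosh (2^-1 * b) - cosh (2^-1 * a)))%:E = ((F b)%:E - (F a)%:E)%E.
  by rewrite -EFinB mulrBr.
apply: (@continuous_FTC2 _ (fun x => sinh (2^-1 * x)) F) => //.
- exact: continuous_subspaceT.
- split=> [x _|//|//]; first exact: ex_derive.
    by apply: cvg_at_right_filter; exact: cF.
  by apply: cvg_at_left_filter; exact: cF.
- by move=> x _; rewrite derive1E; apply: derive_val.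
Qed.

Definition rect (a b t u : R) : set (R * R) := `[a, b[ `*` `[t, u[.

Lemma measurable_rect a b t u : measurable (rect a b t u).
Proof. exact: measurableX. Qed.

Lemma intensity_rect (nu : R) n (a b t u : R) :
  0 <= a -> a <= b -> b <= radius nu n -> t <= u ->
  intensity_measure (intensity 2^-1 nu n) (rect a b t u) =
  nu * expR (radius nu n / 2) / (cosh (2^-1 * radius nu n) - 1) *
  ((u - t) / (2 * pi)) * (cosh (2^-1 * b) - cosh (2^-1 * a)).
Proof.
move=> a0 ab bR tu; rewrite /intensity_measure /Rintegral.
set C := nu * expR (radius nu n / 2); set D := cosh _ - 1.
set K := C * ((2 * pi)^-1 * (2^-1 / D)).
have intE (z : R * R) : z \in rect a b t u ->
    (intensity 2^-1 nu n z)%:E = (K%:E * (sinh (2^-1 * z.1))%:E)%E.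
  move=> /set_mem[]/=; rewrite in_itv/= => /andP[az zb] _.
  rewrite /intensity /radial_density (le_trans a0 az) (lt_le_trans zb bR)/=.
  by rewrite /K -EFinM -/C -/D; congr EFin; ring.
transitivity (fine (\int[(mu \x mu)%E]_(z in rect a b t u)
    (K%:E * (sinh (2^-1 * z.1))%:E)))%E.
  by congr fine; apply: eq_integral => z; exact: intE.
have ms : measurable_fun setT (fun x : R => sinh (2^-1 * x)).
  apply: continuous_measurable_fun => x.
  apply: (@continuous_comp _ _ _ (fun x : R => 2^-1 * x) sinh).
    exact: mulrl_continuous.
  exact: continuous_sinh.
have s0 (x : R) : `[a, b[%classic x -> 0 <= sinh (2^-1 * x).
  by rewrite /= in_itv/= => /andP[ax _]; rewrite sinh_ge0// mulr_ge0// (le_trans a0).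
have mi : mu`[t, u[%classic = (u - t)%:E.
  rewrite lebesgue_measure_itv/= lte_fin -EFinB; case: ltP => // ut.
  by congr EFin; apply/esym/eqP; rewrite subr_eq0 eq_le tu ut.
have iE : (\int[(mu \x mu)%E]_(z in rect a b t u) (sinh (2^-1 * z.1))%:E =
    (2 * (cosh (2^-1 * b) - cosh (2^-1 * a)) * (u - t))%:E)%E.
  by rewrite (integral_prod_fst _ _ ms s0)// integral_sinh_half// mi -EFinM.
have mz : measurable_fun (rect a b t u) (EFin \o (fun z : R * R => sinh (2^-1 * z.1))).
  apply/measurable_EFinP; apply: measurable_funTS.
  by apply: (measurableT_comp ms); exact: measurable_fst.
rewrite integralZl//; last 2 first.
- exact: measurable_rect.
- apply/integrableP; split => //.
  under eq_integral.
    move=> z /set_mem[/= z1 _].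
    rewrite (@ger0_norm _ (sinh _)); last exact: s0.
    over.
  by rewrite /= iE ltry.
by rewrite iE -EFinM/= /K; move: (2 * pi)^-1 D^-1 => p q; field.
Qed.

(* In the coordinate [x = e^(r/2)] masses are proportional to the Euclidean area of
   boxes and the reach of a point is inversely proportional to [x]. *)
Definition box (x1 x2 t u : R) : set (R * R) := rect (2 * ln x1) (2 * ln x2) t u.

Lemma boxE (x1 x2 t u : R) (p : R * R) : 0 < x1 -> 0 < x2 ->
  box x1 x2 t u p <->
  [/\ x1 <= expR (p.1 / 2), expR (p.1 / 2) < x2, t <= p.2 & p.2 < u].
Proof.
move=> x10 x20; rewrite /box /rect/= !in_itv/=.
have e1 (x : R) : 0 < x -> (2 * ln x <= p.1) = (x <= expR (p.1 / 2)).
  by move=> x0; rewrite -[in RHS](lnK x0) ler_expR ler_pdivlMr// mulrC.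
have e2 (x : R) : 0 < x -> (p.1 < 2 * ln x) = (expR (p.1 / 2) < x).
  by move=> x0; rewrite -[in RHS](lnK x0) ltr_expR ltr_pdivrMr// mulrC.
rewrite e1// e2//; split; first by move=> [/andP[? ?] /andP[]].
by move=> [-> -> -> ->].
Qed.

Lemma box_coords (x1 x2 t u : R) (p : R * R) : 0 < x1 -> 0 < x2 -> box x1 x2 t u p ->
  [/\ x1 <= expR (p.1 / 2), expR (p.1 / 2) < x2, t <= p.2 & p.2 < u].
Proof. by move=> x10 x20 /boxE; apply. Qed.

Lemma cosh_half_ln (x : R) : 0 < x -> cosh (2^-1 * (2 * ln x)) = (x + x^-1) / 2.
Proof. by move=> x0; rewrite mulKf// /cosh expRN lnK. Qed.

(** With [x = e^(r/2)] one has [2 cosh (r/2) = x + 1/x], whose increments are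
    [(x2 - x1) (1 - 1/(x1 x2))]; the normalisation [cosh (R/2) - 1] is [(N - 1)^2 / (2 N)]. *)
Lemma intensity_box (nu : R) n (x1 x2 t u : R) (N := n%:R / nu) : 0 < nu ->
  1 <= x1 -> x1 <= x2 -> x2 <= N -> t <= u -> 4 <= N ->
  intensity_measure (intensity 2^-1 nu n) (box x1 x2 t u) =
  nu * (N ^+ 2 / (N - 1) ^+ 2) * ((u - t) / (2 * pi)) * ((x2 - x1) * (1 - (x1 * x2)^-1)).
Proof.
move=> nu0 x1_ge1 x12 x2N tu N4.
have x10 : 0 < x1 by lra.
have x20 : 0 < x2 by lra.
have N0 : 0 < N by lra.
rewrite /box intensity_rect//; last 3 first.
- by rewrite mulr_ge0// ln_ge0.
- by rewrite ler_pM2l// ler_ln.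
- by rewrite /radius ler_pM2l// ler_ln.
rewrite !cosh_half_ln// [radius nu n / 2]mulrC mulKf// -/N lnK//.
move: (2 * pi)^-1 => p; field.
rewrite !gt_eqF//; nra.
Qed.

Lemma intensity_box_le (nu : R) n (x1 x2 t u : R) (N := n%:R / nu) : 0 < nu ->
  1 <= x1 -> x1 <= x2 -> x2 <= N -> t <= u -> 4 <= N ->
  0 <= intensity_measure (intensity 2^-1 nu n) (box x1 x2 t u) <=
  nu * ((u - t) * (x2 - x1)).
Proof.
move=> nu0 x1_ge1 x12 x2N tu N4; rewrite intensity_box// -/N.
have p2 := pi_ge2 R.
have a0 : 0 <= N ^+ 2 / (N - 1) ^+ 2 <= 2.
  rewrite divr_ge0 ?sqr_ge0//= ler_pdivrMr; last by rewrite exprn_gt0//; lra.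
  nra.
have q0 : 0 <= (2 * (pi : R))^-1 <= 4^-1.
  rewrite invr_ge0; apply/andP; split; first by lra.
  by rewrite lef_pV2 ?posrE; lra.
have x11 : 0 <= (x1 * x2)^-1 <= 1.
  rewrite invr_ge0; apply/andP; split; first by nra.
  by rewrite invf_le1; nra.
move: (N ^+ 2 / (N - 1) ^+ 2) (2 * pi)^-1 (x1 * x2)^-1 a0 q0 x11 => A B C /andP[A0 A2] /andP[B0 B4] /andP[C0 C1].
have d0 : 0 <= (u - t) * (x2 - x1) by nra.
have -> : nu * A * ((u - t) * B) * ((x2 - x1) * (1 - C)) =
  nu * ((u - t) * (x2 - x1)) * (A * (B * (1 - C))) by ring.
have B1C : 0 <= B * (1 - C) <= 4^-1 by apply/andP; split; nra.
have AB : 0 <= A * (B * (1 - C)) <= 1 by apply/andP; split; nra.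
move: AB => /andP[AB0 AB1]; apply/andP; split.
  by rewrite mulr_ge0// mulr_ge0// ltW.
by rewrite ler_piMr// mulr_ge0// ltW.
Qed.

(** The 16 comes from [1/(2 pi) >= 1/8] and from [1 - 1/(x1 x2) >= 1/2]. *)
Lemma intensity_box_ge (nu : R) n (x1 x2 t u : R) (N := n%:R / nu) : 0 < nu ->
  1 <= x1 -> x1 <= x2 -> x2 <= N -> t <= u -> 4 <= N -> 2 <= x1 * x2 ->
  nu / 16 * ((u - t) * (x2 - x1)) <=
  intensity_measure (intensity 2^-1 nu n) (box x1 x2 t u).
Proof.
move=> nu0 x1_ge1 x12 x2N tu N4 x122; rewrite intensity_box// -/N.
have p2 := pi_gt0 R; have p4 := pihalf_lt2 R.
have a0 : 1 <= N ^+ 2 / (N - 1) ^+ 2.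
  rewrite ler_pdivlMr; last by rewrite exprn_gt0//; lra.
  nra.
have q0 : 8^-1 <= (2 * (pi : R))^-1.
  by rewrite lef_pV2 ?posrE; lra.
have x11 : (x1 * x2)^-1 <= 2^-1 by rewrite lef_pV2 ?posrE; nra.
move: (N ^+ 2 / (N - 1) ^+ 2) (2 * pi)^-1 (x1 * x2)^-1 a0 q0 x11 => A B C A2 B4 C1.
have d0 : 0 <= (u - t) * (x2 - x1) by nra.
have -> : nu * A * ((u - t) * B) * ((x2 - x1) * (1 - C)) =
  nu * ((u - t) * (x2 - x1)) * (A * (B * (1 - C))) by ring.
have B1C : 16^-1 <= B * (1 - C) by nra.
have AB : 16^-1 <= A * (B * (1 - C)) by nra.
rewrite mulrAC; apply: ler_wpM2l => //; by rewrite mulr_ge0// ltW.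
Qed.

End Mass.

(** * Adjacency in terms of angles *)

Section Geometry.
Context {R : realType}.
Implicit Types (t x y N : R) (u v : R * R).

Lemma sin_mvt t : 0 < t -> exists2 c, 0 < c < t & sin t = cos c * t :> R.
Proof.
move=> t0; have ds x : x \in `]0, t[%R -> is_derive x 1 (@sin R) (cos x).
  by move=> _; exact: is_derive_sin.
have cs : {within `[0, t], continuous (@sin R)}.
  exact/continuous_subspaceT/continuous_sin.
have [c] := MVT t0 ds cs.
by rewrite in_itv/= sin0 !subr0 => c0t st; exists c.
Qed.

Lemma sin_le t : 0 <= t -> sin t <= t.
Proof.
rewrite le_eqVlt => /predU1P[<-|t0]; first by rewrite sin0.
by have [c ct ->] := sin_mvt t0; rewrite ler_piMl ?cos_le1// ltW.
Qed.

Lemma sqr_sin_le t : sin t ^+ 2 <= t ^+ 2.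
Proof.
wlog t0 : t / 0 <= t => [h|].
  by case: (leP 0 t) => [/h//|t0]; rewrite -sqrrN -sinN -[leRHS]sqrrN h// oppr_ge0 ltW.
have [t1|t1] := lerP t 1.
  have := sin_le t0; have [->|tn0] := eqVneq t 0; first by rewrite sin0.
  have : 0 <= sin t by rewrite sin_ge0_pi// t0 (le_trans t1)// (le_trans _ (pi_ge2 R)) ?ler1n.
  by move=> *; rewrite ler_sqr ?nnegrE.
apply: (@le_trans _ _ 1); first by rewrite sin2cos2 gerBl sqr_ge0.
by rewrite exprn_ege1// ltW.
Qed.

Lemma one_sub_cos t : 1 - cos t = 2 * sin (t / 2) ^+ 2.
Proof.
have -> : cos t = cos ((t / 2) *+ 2) by congr cos; rewrite -mulr_natr mulfVK.
by rewrite cos_mulr2n cos2sin2 mulr2n; ring.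
Qed.

Lemma one_sub_cos_le t : 1 - cos t <= t ^+ 2 / 2.
Proof. by rewrite one_sub_cos; have := sqr_sin_le (t / 2); nra. Qed.

Lemma one_sub_cos_ge t : 0 <= t <= 1 -> t ^+ 2 / 8 <= 1 - cos t.
Proof.
move=> /andP[]; rewrite le_eqVlt => /predU1P[<-|t0] t1.
  by rewrite cos0 expr0n/= mul0r subrr.
have [|c /andP[c0 ct] e] := @sin_mvt (t / 2); first lra.
rewrite one_sub_cos e; have := one_sub_cos_le c => cc.
have cos2 : 2^-1 <= cos c by nra.
have -> : t ^+ 2 / 8 = 2 * (2^-1 * (t / 2)) ^+ 2 by field.
rewrite ler_pM2l// ler_sqr ?nnegrE; nra.
Qed.

(** Differences of angles in [[0, 2 pi)] range over [(-2 pi, 2 pi)]; the two bounds on the absolute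
    value express a distance of at least [d] on the circle. *)
Lemma cos_le_away (d t : R) : 0 <= d -> d <= `|t| -> `|t| <= 2 * pi - d ->
  cos t <= cos d.
Proof.
move=> d0 dt td; rewrite -(cos_norm t); move: `|t| dt td => {}t dt td.
have mono (s : R) : d <= s -> s <= pi -> cos s <= cos d.
  move=> ds sp; have dI : d \in `[0, (pi : R)]%R.
    by rewrite in_itv/= d0 (le_trans ds).
  have sI : s \in `[0, (pi : R)]%R by rewrite in_itv/= sp (le_trans d0).
  by rewrite leNgt (ltr_cos sI dI) -leNgt.
have [tp|pt] := lerP t pi; first exact: mono.
have -> : cos t = cos (2 * pi - t).
  by rewrite -[RHS]cosN opprB -[RHS]cosD2pi mulr_natl subrK.
by apply: mono; lra.
Qed.

(** Splits [cosh_dist] into the radial part [cosh (r_u - r_v)] and the angular part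
    [sinh r_u sinh r_v (1 - cos)], which are then estimated separately. *)
Lemma cosh_distE u v (x := expR (u.1 / 2)) (y := expR (v.1 / 2)) :
  cosh_dist u v = ((x / y) ^+ 2 + (y / x) ^+ 2) / 2 +
  (x ^+ 2 - x ^- 2) * (y ^+ 2 - y ^- 2) / 4 * (1 - cos (u.2 - v.2)).
Proof.
have e r : expR r = expR (r / 2) ^+ 2 :> R by rewrite -expRM_natr mulfVK.
rewrite /cosh_dist /cosh /sinh !expRN (e u.1) (e v.1) -/x -/y.
by move: (cos _) => c; field; rewrite !gt_eqF// expR_gt0.
Qed.

(** The difference of the two sums, multiplied by [a b], is [(b - a) (a b - 1)]. With [a = e^d] this
    is the monotonicity of [cosh] that removes [arcosh] from the adjacency condition. *)
Lemma ler_addV (a b : R) : 1 <= a -> 1 <= b -> (a + a^-1 <= b + b^-1) = (a <= b).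
Proof.
move=> a1 b1; have a0 : 0 < a by lra.
have b0 : 0 < b by lra.
have -> : (a + a^-1 <= b + b^-1) = ((b - a) * (a * b - 1) >= 0).
  have -> : (b - a) * (a * b - 1) = (b + b^-1 - (a + a^-1)) * (a * b).
    by field; rewrite !gt_eqF.
  by rewrite pmulr_lge0 ?mulr_gt0// subr_ge0.
have [->|] := eqVneq a b; first by rewrite subrr mul0r !lexx.
move=> ab; rewrite pmulr_lge0 ?subr_ge0//.
rewrite subr_gt0; have [a1'|a1'] := eqVneq a 1.
  rewrite a1' mul1r lt_def b1 andbT; by rewrite -a1' eq_sym.
have : 1 < a by rewrite lt_def a1'.
by move=> ?; nra.
Qed.

Lemma hyp_dist_le u v N : 0 <= u.1 -> 0 <= v.1 -> 1 <= N ->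
  (hyp_dist u v <= 2 * ln N) = (cosh_dist u v <= (N ^+ 2 + N ^- 2) / 2).
Proof.
move=> u0 v0 N1; have N0 : 0 < N by lra.
have d0 := hyp_dist_ge0 u0 v0.
have /esym := arcoshK (cosh_dist_ge1 u0 v0); rewrite -/(hyp_dist u v) => ->.
rewrite /cosh ler_pM2r ?invr_gt0// expRN.
have e2 : expR (2 * ln N) = N ^+ 2 by rewrite mulrC expRM_natr lnK.
rewrite ler_addV ?exprn_ege1// -?e2 ?ler_expR//.
by rewrite -expR0 ler_expR.
Qed.

(** [A] bounds the radial part, and [sinh r <= e^r / 2] bounds the angular one. *)
Lemma adj_suff u v N (A : R) (x := expR (u.1 / 2)) (y := expR (v.1 / 2)) :
  0 <= u.1 -> 0 <= v.1 -> 1 <= N -> x ^+ 2 <= A * y ^+ 2 -> y ^+ 2 <= A * x ^+ 2 ->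
  A + x ^+ 2 * y ^+ 2 / 4 * (1 - cos (u.2 - v.2)) <= N ^+ 2 / 2 ->
  hyp_dist u v <= 2 * ln N.
Proof.
move=> u0 v0 N1 xA yA h; rewrite hyp_dist_le// cosh_distE -/x -/y.
have x1 : 1 <= x by rewrite -expR0 ler_expR divr_ge0.
have y1 : 1 <= y by rewrite -expR0 ler_expR divr_ge0.
have c0 : 0 <= 1 - cos (u.2 - v.2) by rewrite subr_ge0 cos_le1.
have N2 : 0 <= N ^- 2 by rewrite invr_ge0 exprn_ge0//; lra.
have a1 : (x / y) ^+ 2 <= A by rewrite expr_div_n ler_pdivrMr// exprn_gt0//; lra.
have a2 : (y / x) ^+ 2 <= A by rewrite expr_div_n ler_pdivrMr// exprn_gt0//; lra.
have V (z : R) : 1 <= z -> 0 <= z ^- 2 <= 1.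
  by move=> z1; rewrite invr_ge0 exprn_ge0 ?invf_le1 ?exprn_gt0 ?exprn_ege1//; lra.
have /andP[X0 X1] := V _ x1; have /andP[Y0 Y1] := V _ y1.
have x21 : 1 <= x ^+ 2 by rewrite exprn_ege1.
have y21 : 1 <= y ^+ 2 by rewrite exprn_ege1.
have : (x ^+ 2 - x ^- 2) * (y ^+ 2 - y ^- 2) <= x ^+ 2 * y ^+ 2.
  by apply: ler_pM; lra.
move: (x ^- 2) (y ^- 2) (1 - cos _) c0 h X0 X1 Y0 Y1 => X Y c c0 h X0 X1 Y0 Y1 h2.
have : (x ^+ 2 - X) * (y ^+ 2 - Y) / 4 * c <= x ^+ 2 * y ^+ 2 / 4 * c.
  by rewrite ler_wpM2r// ler_wpM2r.
by move=> h3; lra.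
Qed.

(** Here [x^2 >= 2] gives [x^2 - x^-2 >= 3/4 x^2], and [1 - cos d >= d^2 / 8]. As the radial part is
    at least 1, this yields [x y d < 16/3 N], rounded up to [6 N]. *)
Lemma adj_nec u v N (d : R) (x := expR (u.1 / 2)) (y := expR (v.1 / 2)) :
  0 <= u.1 -> 0 <= v.1 -> 1 <= N -> 2 <= x ^+ 2 -> 2 <= y ^+ 2 ->
  0 <= d <= 1 -> d <= `|u.2 - v.2| -> `|u.2 - v.2| <= 2 * pi - d ->
  hyp_dist u v <= 2 * ln N -> x * y * d < 6 * N.
Proof.
move=> u0 v0 N1 x2 y2 /andP[d0 d1] du ud; rewrite hyp_dist_le// cosh_distE -/x -/y.
have x0 : 0 < x := expR_gt0 _.
have y0 : 0 < y := expR_gt0 _.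
have := cos_le_away d0 du ud; have := @one_sub_cos_ge d.
rewrite d0 d1 => /(_ isT); move: (cos (u.2 - v.2)) (cos d) => c c' cd cc.
have N2 : N ^- 2 <= 1 by rewrite invf_le1 ?exprn_gt0 ?exprn_ege1//; lra.
have V (z : R) : 2 <= z ^+ 2 -> z ^- 2 <= z ^+ 2 / 4.
  move=> z2; have : z ^- 2 <= 2^-1 by rewrite lef_pV2 ?posrE//; lra.
  by lra.
have X := V _ x2; have Y := V _ y2.
have h1 : 9 / 16 * (x ^+ 2 * y ^+ 2) <= (x ^+ 2 - x ^- 2) * (y ^+ 2 - y ^- 2).
  have -> : 9 / 16 * (x ^+ 2 * y ^+ 2) = (3 / 4 * x ^+ 2) * (3 / 4 * y ^+ 2) by field.
  by apply: ler_pM; lra.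
have q1 : 0 <= (x / y) ^+ 2 by rewrite sqr_ge0.
have q2 : 0 <= (y / x) ^+ 2 by rewrite sqr_ge0.
have q3 : 1 <= ((x / y) ^+ 2 + (y / x) ^+ 2) / 2.
  have -> : ((x / y) ^+ 2 + (y / x) ^+ 2) / 2 = (x / y - y / x) ^+ 2 / 2 + 1.
    by field; rewrite !gt_eqF.
  by rewrite lerDr divr_ge0// sqr_ge0.
move: ((x / y) ^+ 2 + _) q3 => Q q3 h.
have h2 : 9 / 16 * (x ^+ 2 * y ^+ 2) * (d ^+ 2 / 8) <=
    (x ^+ 2 - x ^- 2) * (y ^+ 2 - y ^- 2) * (1 - c).
  by apply: ler_pM => //; nra.
have : (x * y * d) ^+ 2 < (6 * N) ^+ 2.
  have -> : (x * y * d) ^+ 2 = x ^+ 2 * y ^+ 2 * d ^+ 2 by ring.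
  have -> : (6 * N) ^+ 2 = 36 * N ^+ 2 by ring.
  move: (x ^+ 2 * y ^+ 2) h2 => Z h2.
  have : 9 / 16 * Z * (d ^+ 2 / 8) = 9 / 128 * (Z * d ^+ 2) by field.
  move: (Z * d ^+ 2) => W hW; rewrite hW in h2.
  have : (x ^+ 2 - x ^- 2) * (y ^+ 2 - y ^- 2) / 4 * (1 - c) =
    (x ^+ 2 - x ^- 2) * (y ^+ 2 - y ^- 2) * (1 - c) / 4 by ring.
  have : 0 < N ^+ 2 by rewrite exprn_gt0; lra.
  move=> NN hh; rewrite hh in h; lra.
rewrite ltr_sqr ?nnegrE//; first by rewrite !mulr_ge0// ltW.
by lra.
Qed.

End Geometry.

(** * Probabilities as real numbers *)

Section RealProbability.
Context d (T : measurableType d) (R : realType) (P : probability T R).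
Implicit Types A B : set T.

Definition pr A : R := fine (P A).

Lemma prE A : measurable A -> P A = (pr A)%:E.
Proof. by move=> mA; rewrite /pr fineK// fin_num_measure. Qed.

Lemma pr_ge0 A : 0 <= pr A.
Proof. exact: fine_ge0. Qed.

Lemma prT : pr setT = 1.
Proof. by rewrite /pr probability_setT. Qed.

Lemma pr_le1 A : measurable A -> pr A <= 1.
Proof. by move=> mA; rewrite -lee_fin -prE// probability_le1. Qed.

Lemma pr_le A B : measurable A -> measurable B -> A `<=` B -> pr A <= pr B.
Proof. by move=> mA mB AB; rewrite -lee_fin -!prE// le_measure// inE. Qed.

Lemma prDI A B : measurable A -> measurable B -> pr B = pr (A `&` B) + pr (~` A `&` B).
Proof.
move=> mA mB; apply: EFin_inj; have mCA := measurableC mA.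
rewrite EFinD -!prE//; try exact: measurableI.
by rewrite (measureDI P mB mA) setDE addeC [A `&` B]setIC [~` A `&` B]setIC.
Qed.

Lemma prC A : measurable A -> pr (~` A) = 1 - pr A.
Proof. by move=> mA; rewrite -prT (prDI mA measurableT) !setIT addrC addKr. Qed.

Lemma prU_le A B : measurable A -> measurable B -> pr (A `|` B) <= pr A + pr B.
Proof.
move=> mA mB; rewrite -lee_fin EFinD -!prE//; last exact: measurableU.
exact: measureU2.
Qed.

Definition some (m : nat) (E : nat -> set T) : set T :=
  [set w | exists2 k, (k < m)%N & E k w].
Definition every (m : nat) (E : nat -> set T) : set T :=
  [set w | forall k, (k < m)%N -> E k w].

Lemma everyS m E : every m.+1 E = every m E `&` E m.
Proof.
apply/seteqP; split=> [w h|w [h1 h2] k]/=.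
  by split=> [k km|]; apply: h => //; exact: ltnW.
by rewrite ltnS leq_eqVlt => /predU1P[->//|]; exact: h1.
Qed.

Lemma every0 E : every 0 E = setT.
Proof. by apply/seteqP; split. Qed.

Lemma someS m E : some m.+1 E = some m E `|` E m.
Proof.
apply/seteqP; split=> [w [k km Ek]|w [[k km Ek]|Em]].
- move: km; rewrite ltnS leq_eqVlt => /predU1P[<-|km]; [by right|left].
  by exists k.
- by exists k => //; exact: ltnW.
- by exists m.
Qed.

Lemma some0 E : some 0 E = set0.
Proof. by apply/seteqP; split=> // w []. Qed.

Lemma measurable_every m E : (forall k, (k < m)%N -> measurable (E k)) ->
  measurable (every m E).
Proof.
elim: m => [|m IH] mE; first by rewrite every0.
rewrite everyS; apply: measurableI; last exact: mE.
by apply: IH => k km; apply: mE; exact: ltnW.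
Qed.

Lemma measurable_some m E : (forall k, (k < m)%N -> measurable (E k)) ->
  measurable (some m E).
Proof.
elim: m => [|m IH] mE; first by rewrite some0.
rewrite someS; apply: measurableU; last exact: mE.
by apply: IH => k km; apply: mE; exact: ltnW.
Qed.

Lemma pr_some_le m E (p : R) : (forall k, (k < m)%N -> measurable (E k)) ->
  (forall k, (k < m)%N -> pr (E k) <= p) -> pr (some m E) <= m%:R * p.
Proof.
elim: m => [|m IH] mE Ep; first by rewrite some0 /pr measure0 mul0r.
have ms : measurable (some m E).
  by apply: measurable_some => k km; apply: mE; exact: ltnW.
rewrite someS; apply: (le_trans (prU_le ms (mE m (ltnSn m)))).
rewrite -natr1 mulrDl mul1r; apply: lerD; last exact: Ep.
by apply: IH => k km; [apply: mE|apply: Ep]; exact: ltnW.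
Qed.

End RealProbability.

(** * Void probability and tail of the Poisson law *)

Section PoissonTail.
Context {R : realType}.

Lemma one_sub_expRN_ge0 (x : R) : 0 <= x -> 0 <= 1 - expR (- x).
Proof. by move=> x0; rewrite subr_ge0 expR_le1 oppr_le0. Qed.

Lemma poisson_prob0 (l : R) : 0 <= l -> poisson_prob l 0%N [set 0%N] = (expR (- l))%:E.
Proof.
rewrite le_eqVlt => /predU1P[<-|l0]; rewrite /poisson_prob.
  by rewrite ltxx diracE mem_set// oppr0 expR0.
rewrite l0 esum_set1/=; last by rewrite lee_fin poisson_pmf_ge0.
by rewrite /poisson_pmf l0 expr0 fact0 invr1 !mul1r.
Qed.

(** Exponential tilting: the weight of [k] at rate [l] is [e^l / 2^k] times its weight at rate
    [2 l], and the latter weights sum to at most 1. *)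
Lemma poisson_tail (l : R) (x : nat) : 0 <= l ->
  (poisson_prob l 0%N [set k | (x <= k)%N] <= (expR l / 2 ^+ x)%:E)%E.
Proof.
rewrite le_eqVlt => /predU1P[<-|l0]; rewrite /poisson_prob.
  rewrite ltxx expR0 mul1r diracE; case: x => [|x].
    by rewrite mem_set// expr0 invr1.
  by rewrite memNset// lee_fin invr_ge0 exprn_ge0.
rewrite l0; set U := [set k | _].
have l20 : 0 < 2 * l by rewrite mulr_gt0.
set c := expR l / 2 ^+ x.
have c0 : 0 <= c by rewrite divr_ge0 ?expR_ge0// exprn_ge0.
have le1 : (\esum_(k in U) (poisson_pmf l k)%:E <=
    \esum_(k in U) (c * poisson_pmf (2 * l) k)%:E)%E.
  apply: le_esum => k xk; rewrite lee_fin /poisson_pmf l0 l20 /c.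
  have -> : expR l / 2 ^+ x * ((2 * l) ^+ k / k`!%:R * expR (- (2 * l))) =
      (2 ^+ k / 2 ^+ x) * (l ^+ k / k`!%:R * expR (- l)).
    rewrite exprMn (_ : - (2 * l) = - l - l); last by ring.
    rewrite expRD [expR (-l)]expRN; field.
    by rewrite expR_eq0 expf_neq0//= pnatr_eq0 -lt0n fact_gt0.
  rewrite ler_peMl//; first by rewrite !mulr_ge0 ?exprn_ge0 ?expR_ge0 ?invr_ge0// ltW.
  by rewrite ler_pdivlMr ?exprn_gt0// mul1r ler_weXn2l// ler1n.
apply: (le_trans le1).
have -> : (\esum_(k in U) (c * poisson_pmf (2 * l) k)%:E =
   c%:E * \esum_(k in U) (poisson_pmf (2 * l) k)%:E)%E.
  have U' : U = [set` [pred k | (x <= k)%N]] by [].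
  rewrite U' -!nneseries_esum; last 2 first.
  - by move=> k _; rewrite lee_fin poisson_pmf_ge0.
  - by move=> k _; rewrite lee_fin mulr_ge0// poisson_pmf_ge0.
  rewrite -nneseriesZl//.
  by move=> k _; rewrite lee_fin poisson_pmf_ge0.
rewrite -[leRHS]mule1; apply: lee_wpmul2l; first by rewrite lee_fin.
have mU : measurable U by [].
have := @probability_le1 _ _ _ (poisson_prob (2 * l) 0%N) U mU.
by rewrite /= /poisson_prob l20.
Qed.

End PoissonTail.

(** * Independence over disjoint regions *)

Section Process.
Context d (T : measurableType d) (R : realType) (P : probability T R).
Variables (D : set (R * R)) (g : R * R -> R) (V : T -> {fset (R * R)}).
Hypothesis HV : poisson_process P D g V.
Local Notation pr := (pr P).
Implicit Types (A B : set (R * R)) (E H Q : set T) (S : set nat).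

Definition count_in B S : set T := npoints V B @^-1` S.

Lemma measurable_count_in B S : measurable B -> B `<=` D -> measurable (count_in B S).
Proof.
by move=> mB BD; rewrite -[count_in _ _]setTI; have [_ mV _ _] := HV; apply: mV.
Qed.

Definition counts k (B : 'I_k -> set (R * R)) (S : 'I_k -> set nat) : set T :=
  \bigcap_(i in [set: 'I_k]) count_in (B i) (S i).

(** These are the events for which [poisson_process] provides a product formula. *)
Definition cylinder A Q : Prop :=
  exists k (B : 'I_k -> set (R * R)) (S : 'I_k -> set nat),
    [/\ forall i, measurable (B i), forall i, B i `<=` A, trivIset setT B &
        Q = counts B S].

Lemma measurable_rectangle A Q : A `<=` D -> cylinder A Q -> measurable Q.
Proof.
move=> AD [k [B [S [mB BA _ ->]]]]; apply: fin_bigcap_measurable => // i _.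
by apply: measurable_count_in => //; exact: subset_trans AD.
Qed.

(** The two families concatenate into one family of disjoint regions, to which the product formula
    applies as a whole. *)
Lemma cylinderI A A1 A2 Q1 Q2 : A1 `<=` A -> A2 `<=` A -> A1 `&` A2 = set0 ->
  cylinder A1 Q1 -> cylinder A2 Q2 ->
  cylinder A (Q1 `&` Q2) /\ (A `<=` D -> pr (Q1 `&` Q2) = pr Q1 * pr Q2).
Proof.
move=> A1A A2A A12 [k1 [B1 [S1 [mB1 BA1 tB1 ->]]]] [k2 [B2 [S2 [mB2 BA2 tB2 ->]]]].
pose B (i : 'I_(k1 + k2)) := match fintype.split i with inl j => B1 j | inr j => B2 j end.
pose S (i : 'I_(k1 + k2)) := match fintype.split i with inl j => S1 j | inr j => S2 j end.
have cE : counts B1 S1 `&` counts B2 S2 = counts B S.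
  apply/seteqP; split=> [w [h1 h2] i _|w h].
    by rewrite /B /S; case: splitP => j _; [exact: h1|exact: h2].
  split=> i _.
    by have := h (lshift k2 i) I; rewrite /B /S /= (unsplitK (inl i)).
  by have := h (rshift k1 i) I; rewrite /B /S /= (unsplitK (inr i)).
have mB i : measurable (B i) by rewrite /B; case: fintype.split.
have BA i : B i `<=` A.
  rewrite /B; case: fintype.split => j.
    exact: subset_trans A1A.
  exact: subset_trans A2A.
have tB : trivIset setT B.
  move=> i j _ _; rewrite /B -{2}(splitK i) -{2}(splitK j).
  case: (fintype.split i) (fintype.split j) => a [] b [x []] /= xa xb.
  - by congr lshift; apply: tB1 => //; exists x.
  - suff : (A1 `&` A2) x by rewrite A12.
    by split; [exact: BA1 xa|exact: BA2 xb].
  - suff : (A1 `&` A2) x by rewrite A12.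
    by split; [exact: BA1 xb|exact: BA2 xa].
  - by congr rshift; apply: tB2 => //; exists x.
split; first by exists (k1 + k2)%N, B, S.
move=> AD; have [_ _ _ ind] := HV; rewrite cE.
have prod k (B' : 'I_k -> set (R * R)) (S' : 'I_k -> set nat) : (forall i, measurable (B' i)) ->
    (forall i, B' i `<=` A) -> trivIset setT B' ->
    pr (counts B' S') = \prod_(i < k) pr (count_in (B' i) (S' i)).
  move=> mB' BA' tB'; apply: EFin_inj; rewrite -prE; last first.
    by apply: (measurable_rectangle AD); exists k, B', S'.
  rewrite [LHS]ind//; last by move=> i; exact: subset_trans AD.
  rewrite -prodEFin; apply: eq_bigr => i _; apply: prE.
  by apply: measurable_count_in => //; exact: subset_trans AD.
rewrite !prod//; last 2 first.
- by move=> i; exact: subset_trans A2A.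
- by move=> i; exact: subset_trans A1A.
rewrite big_split_ord/=; congr (_ * _); apply: eq_bigr => i _.
  by rewrite /B /S (unsplitK (inl i)).
by rewrite /B /S (unsplitK (inr i)).
Qed.

Definition indep_of A H : Prop := forall Q, cylinder A Q -> pr (Q `&` H) = pr Q * pr H.

(* A substitute for measurability with respect to the sigma-algebra of the
   counts inside [A] that still passes independence across disjoint regions. *)
Definition determined A E : Prop := measurable E /\
  forall H, measurable H -> indep_of A H -> pr (E `&` H) = pr E * pr H.

Lemma indep_of_sub A A' H : A `<=` A' -> indep_of A' H -> indep_of A H.
Proof.
move=> AA' h Q [k [B [S [mB BA tB QE]]]]; apply: h; exists k, B, S; split => //.
by move=> i; exact: subset_trans AA'.
Qed.

Lemma determined_sub A A' E : A `<=` A' -> determined A E -> determined A' E.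
Proof.
move=> AA' [mE h]; split => // H mH iH; apply: h => //; exact: indep_of_sub iH.
Qed.

Lemma determined_count A B S : measurable B -> B `<=` A -> A `<=` D ->
  determined A (count_in B S).
Proof.
move=> mB BA AD; split; first exact/measurable_count_in/(subset_trans BA).
move=> H mH; apply; exists 1%N, (fun=> B), (fun=> S); split => //.
  by move=> i j _ _ _; rewrite [i]ord1 [j]ord1.
by apply/seteqP; split=> [w h i _//|w /(_ ord0 I)].
Qed.

Lemma determinedT A : determined A setT.
Proof. by split => // H mH _; rewrite setTI prT mul1r. Qed.

Lemma determinedC A E : determined A E -> determined A (~` E).
Proof.
move=> [mE h]; split; first exact: measurableC.
move=> H mH iH; rewrite prC// mulrBl mul1r -h// (prDI P mE mH).
by rewrite addrC addKr.
Qed.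

(** Let [H] be independent of the cylinders over [A]. For a cylinder [Q1] over [A1], the event [Q1]
    and [H] is independent of the cylinders over [A2], because [Q1] and [Q2] together form a
    cylinder over [A]; so [E2] can be split off. This makes [E2] and [H] independent of the
    cylinders over [A1], and the property of [E1] applies to it. *)
Lemma determinedI A A1 A2 E1 E2 : A `<=` D -> A1 `<=` A -> A2 `<=` A ->
  A1 `&` A2 = set0 -> determined A1 E1 -> determined A2 E2 ->
  determined A (E1 `&` E2) /\ pr (E1 `&` E2) = pr E1 * pr E2.
Proof.
move=> AD A1A A2A A12 [mE1 h1] [mE2 h2].
have key H : measurable H -> indep_of A H ->
    pr (E1 `&` E2 `&` H) = pr E1 * pr E2 * pr H.
  move=> mH iH; have E2H : pr (E2 `&` H) = pr E2 * pr H.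
    by apply: h2 => //; exact: indep_of_sub iH.
  rewrite -setIA h1 ?E2H ?mulrA//; first exact: measurableI.
  move=> Q1 rQ1; rewrite setICA E2H.
  have mQ1 : measurable Q1 by apply: measurable_rectangle rQ1; exact: subset_trans AD.
  have Q1H : pr (Q1 `&` H) = pr Q1 * pr H by apply: (indep_of_sub A1A).
  rewrite h2; last 2 first.
  - exact: measurableI.
  - move=> Q2 rQ2; have [rQ QE] := cylinderI A1A A2A A12 rQ1 rQ2.
    by rewrite setICA setIA iH// QE// Q1H -!mulrA mulrCA.
  by rewrite Q1H mulrCA.
have E12 : pr (E1 `&` E2) = pr E1 * pr E2.
  have := key setT measurableT; rewrite setIT prT mulr1; apply.
  by move=> Q rQ; rewrite setIT prT mulr1.
by split => //; split; [exact: measurableI|move=> H mH iH; rewrite key// E12].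
Qed.

Lemma determinedU A A1 A2 E1 E2 : A `<=` D -> A1 `<=` A -> A2 `<=` A ->
  A1 `&` A2 = set0 -> determined A1 E1 -> determined A2 E2 ->
  determined A (E1 `|` E2) /\
  pr (E1 `|` E2) = 1 - (1 - pr E1) * (1 - pr E2).
Proof.
move=> AD A1A A2A A12 d1 d2.
have [dE pE] := determinedI AD A1A A2A A12 (determinedC d1) (determinedC d2).
rewrite -(setCK (E1 `|` E2)) setCU; split; first exact: determinedC.
by rewrite prC ?pE ?prC//; [exact: d2.1|exact: d1.1|exact: dE.1].
Qed.

Lemma determined_every A m (B : nat -> set (R * R)) (E : nat -> set T) :
  A `<=` D -> (forall k, (k < m)%N -> B k `<=` A) ->
  (forall k l, (k < l)%N -> (l < m)%N -> B k `&` B l = set0) ->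
  (forall k, (k < m)%N -> determined (B k) (E k)) ->
  determined A (every m E) /\ pr (every m E) = \prod_(k < m) pr (E k).
Proof.
move=> AD.
(* The induction carries the exact union of the regions met so far, since [A] itself is not disjoint
   from the next region. *)
suff key : forall n, (n <= m)%N -> (forall k, (k < m)%N -> B k `<=` A) ->
    (forall k l, (k < l)%N -> (l < m)%N -> B k `&` B l = set0) ->
    (forall k, (k < m)%N -> determined (B k) (E k)) ->
    determined (\bigcup_(k < n) B k) (every n E) /\
    pr (every n E) = \prod_(k < n) pr (E k).
  move=> BA tB dE; have [dn pn] := key _ (leqnn m) BA tB dE; split => //.
  apply: determined_sub dn => x [k km]; exact: BA km x.
elim=> [|n IH] nm BA tB dE.
  by rewrite every0 prT big_ord0; split => //; exact: determinedT.
have [dn pn] := IH (ltnW nm) BA tB dE.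
have [] := @determinedI (\bigcup_(k < n.+1) B k) (\bigcup_(k < n) B k) (B n) (every n E) (E n).
- move=> x [k kn Bx]; apply: AD; apply: BA Bx; exact: leq_ltn_trans nm.
- by move=> x [k kn Bx]; exists k => //; exact: ltnW.
- by move=> x Bx; exists n => //=.
- apply/seteqP; split => // x [[k kn Bk] Bn]; suff : (B k `&` B n) x by rewrite tB.
  by [].
- by [].
- exact: dE.
by rewrite everyS big_ord_recr/= pn.
Qed.

Definition empty B : set T := count_in B [set 0%N].
Definition hit B : set T := ~` empty B.

Lemma pr_empty B : measurable B -> B `<=` D -> 0 <= intensity_measure g B ->
  pr (empty B) = expR (- intensity_measure g B).
Proof.
move=> mB BD g0; have [_ _ /(_ B mB BD) pB _] := HV.
by rewrite /pr [P _]pB poisson_prob0.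
Qed.

Lemma pr_hit B : measurable B -> B `<=` D -> 0 <= intensity_measure g B ->
  pr (hit B) = 1 - expR (- intensity_measure g B).
Proof.
by move=> mB BD g0; rewrite prC ?pr_empty//; exact: measurable_count_in.
Qed.

Lemma pr_count_ge B (x : nat) : measurable B -> B `<=` D -> 0 <= intensity_measure g B ->
  pr (count_in B [set k | (x <= k)%N]) <= expR (intensity_measure g B) / 2 ^+ x.
Proof.
move=> mB BD g0; have [_ _ /(_ B mB BD) pB _] := HV.
rewrite -lee_fin -prE; last exact: measurable_count_in.
by rewrite [P _]pB; exact: poisson_tail.
Qed.

Lemma emptyP B w : empty B w <-> (forall x, x \in V w -> ~ B x).
Proof.
rewrite /empty /count_in/= /npoints; split.
  move=> /eqP; rewrite cardfs_eq0 => /eqP e x xV Bx.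
  have : x \in [fset x in V w | x \in B]%fset.
    by rewrite !inE/= xV/=; exact/mem_set.
  by rewrite e inE.
move=> h; apply/eqP; rewrite cardfs_eq0; apply/eqP/fsetP => x; rewrite !inE/=.
by apply/negP => /andP[/h nB /set_mem].
Qed.

Lemma hitP B w : hit B w <-> (exists2 x, x \in V w & B x).
Proof.
rewrite /hit/=; split=> [/emptyP h|[x xV Bx] /emptyP/(_ _ xV)//].
by apply: contrapT => h'; apply: h => x xV Bx; apply: h'; exists x.
Qed.

End Process.

(** * Measurability of the second component size *)

Section MeasurableL2.
Context {R : realType}.
Implicit Types (p q : R * R) (c : nat * nat) (m : nat) (N : R).

Lemma cosh_distC p q : cosh_dist p q = cosh_dist q p.
Proof.
by rewrite /cosh_dist -[cos (q.2 - p.2)]cosN opprB; congr (_ - _ * _); rewrite mulrC.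
Qed.

Lemma hyp_distC p q : hyp_dist p q = hyp_dist q p.
Proof. by rewrite /hyp_dist cosh_distC. Qed.

Lemma hyp_adj_sym (nu : R) n (F : {fset (R * R)}) : symmetric (hyp_adj nu n F).
Proof. by move=> u v; rewrite /hyp_adj eq_sym hyp_distC. Qed.

Definition cell m p : nat * nat :=
  (Num.truncn (m.+1%:R * p.1), Num.truncn (m.+1%:R * p.2)).

Definition cell_box m c : set (R * R) :=
  rect (c.1%:R / m.+1%:R) (c.1.+1%:R / m.+1%:R) (c.2%:R / m.+1%:R) (c.2.+1%:R / m.+1%:R).

Lemma cellP m c p : 0 <= p.1 -> 0 <= p.2 -> cell_box m c p <-> cell m p = c.
Proof.
move=> p1 p2; have m0 : 0 < m.+1%:R :> R by rewrite ltr0n.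
rewrite /cell_box /rect/= !in_itv/= !ler_pdivrMr// !ltr_pdivlMr//.
rewrite -![_ * m.+1%:R]mulrC /cell; case: c => a b /=.
have e1 := @truncn_eq R (m.+1%:R * p.1) a; have e2 := @truncn_eq R (m.+1%:R * p.2) b.
rewrite !(mulrC _ p.1) !(mulrC _ p.2) in e1 e2 *.
rewrite -e1 ?mulr_ge0// -e2 ?mulr_ge0//.
by split=> [[/eqP-> /eqP->]//|[-> ->]].
Qed.

Lemma cell_close m p q : 0 <= p.1 -> 0 <= p.2 -> 0 <= q.1 -> 0 <= q.2 ->
  cell m p = cell m q -> `|p.1 - q.1| < m.+1%:R^-1 /\ `|p.2 - q.2| < m.+1%:R^-1.
Proof.
move=> p1 p2 q1 q2 [e1 e2]; have m0 : 0 < m.+1%:R :> R by rewrite ltr0n.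
have key (x y : R) : 0 <= x -> 0 <= y ->
    Num.truncn (m.+1%:R * x) = Num.truncn (m.+1%:R * y) -> `|x - y| < m.+1%:R^-1.
  move: m.+1%:R m0 => M m0 x0 y0 e; have := truncn_itv (mulr_ge0 (ltW m0) x0).
  have := truncn_itv (mulr_ge0 (ltW m0) y0); rewrite e -natr1.
  move: (Num.truncn _)%:R => t /andP[ty yt] /andP[tx xt].
  rewrite -[ltRHS]mul1r ltr_pdivlMr// -[X in _ * X]ger0_norm ?ltW// -normrM.
  by rewrite ltr_norml; apply/andP; split; lra.
by split; exact: key.
Qed.

(* Cells stand for their points; two cells are linked when they contain an
   adjacent pair. As the grid is refined this stabilises to the true graph. *)
Definition cell_adj N m (O : {fset nat * nat}) : rel O := fun a b => (a != b) &&
  `[< exists p q, [/\ 0 <= p.1 /\ 0 <= p.2, 0 <= q.1 /\ 0 <= q.2, cell m p = val a,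
       cell m q = val b & hyp_dist p q <= 2 * ln N] >].

Lemma cell_adj_sym N m O : symmetric (@cell_adj N m O).
Proof.
move=> a b; rewrite /cell_adj eq_sym; congr (_ && _).
by apply/asboolP/asboolP => -[p [q [h1 h2 h3 h4 h5]]]; exists q, p; rewrite hyp_distC.
Qed.

Definition cells m (F : {fset (R * R)}) : {fset nat * nat} := [fset cell m p | p in F]%fset.

Lemma continuous_cosh_dist : continuous (fun z : (R * R) * (R * R) => cosh_dist z.1 z.2).
Proof.
have cc : continuous (@cosh R).
  move=> x; apply/differentiable_continuous/derivable1_diffP.
  by have ? := is_derive_cosh x; exact: ex_derive.
have c1 : continuous (fun z : (R * R) * (R * R) => z.1.1).
  by move=> z; apply: (@continuous_comp _ _ _ fst fst); exact: cvg_fst.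
have c2 : continuous (fun z : (R * R) * (R * R) => z.1.2).
  by move=> z; apply: (@continuous_comp _ _ _ fst snd); [exact: cvg_fst|exact: cvg_snd].
have c3 : continuous (fun z : (R * R) * (R * R) => z.2.1).
  by move=> z; apply: (@continuous_comp _ _ _ snd fst); [exact: cvg_snd|exact: cvg_fst].
have c4 : continuous (fun z : (R * R) * (R * R) => z.2.2).
  by move=> z; apply: (@continuous_comp _ _ _ snd snd); exact: cvg_snd.
have comp (f : R -> R) (h : (R * R) * (R * R) -> R) : continuous f -> continuous h ->
    continuous (fun z => f (h z)).
  by move=> cf ch z; apply: (@continuous_comp _ _ _ h f); [exact: ch|exact: cf].
move=> z; apply: cvgB.
  by apply: cvgM; apply: comp.
apply: cvgM; first by apply: cvgM; apply: comp => //; exact: continuous_sinh.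
apply: (comp cos (fun z => z.1.2 - z.2.2)); first exact: continuous_cos.
by move=> t; apply: cvgB; [exact: c2|exact: c4].
Qed.

(** Adjacency is a closed condition, so its failure persists under small moves. A pair at distance
    exactly [R] may lose adjacency, which is why cells are linked by the existence of an adjacent
    pair. *)
Lemma nonadj_near N p q : 1 <= N -> 0 <= p.1 -> 0 <= q.1 -> ~~ (hyp_dist p q <= 2 * ln N) ->
  exists2 e : R, 0 < e & forall p' q', 0 <= p'.1 -> 0 <= q'.1 ->
    `|p.1 - p'.1| < e -> `|p.2 - p'.2| < e -> `|q.1 - q'.1| < e -> `|q.2 - q'.2| < e ->
    ~~ (hyp_dist p' q' <= 2 * ln N).
Proof.
move=> N1 p0 q0; rewrite hyp_dist_le// -ltNge => h.
have := @continuous_cosh_dist (p, q) => /(@cvgr_gt _ _ _ _ _)/(_ _ h)/nbhs_ballP[e e0 he].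
exists e => // p' q' p'0 q'0 h1 h2 h3 h4; rewrite hyp_dist_le// -ltNge.
by apply: (he (p', q')).
Qed.

(** Fine cells separate the finitely many points and, by [nonadj_near], do not link nonadjacent
    ones, while adjacent points link their cells at every resolution. So [cell m] is a graph
    isomorphism for all large [m]. *)
Lemma L2_cells (nu : R) n (F : {fset (R * R)}) (N := n%:R / nu) : 1 <= N ->
  (forall p, p \in F -> 0 <= p.1 /\ 0 <= p.2) ->
  \forall m \near \oo, L2 (@cell_adj N m (cells m F)) = L2 (hyp_adj nu n F).
Proof.
move=> N1 F0.
have sep (u v : F) : \forall m \near \oo, u != v -> cell m (val u) != cell m (val v).
  have [u1 u2] := F0 _ (valP u); have [v1 v2] := F0 _ (valP v).
  have [->|uv] := eqVneq u v; first by near=> m; rewrite eqxx.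
  have [e e0 he] : exists2 e : R, 0 < e &
      e <= `|(val u).1 - (val v).1| \/ e <= `|(val u).2 - (val v).2|.
    have [h1|h1] := eqVneq (val u).1 (val v).1; last first.
      by exists `|(val u).1 - (val v).1|; [rewrite normr_gt0 subr_eq0|left].
    have [h2|h2] := eqVneq (val u).2 (val v).2; last first.
      by exists `|(val u).2 - (val v).2|; [rewrite normr_gt0 subr_eq0|right].
    by case/eqP: uv; apply: val_inj; move: h1 h2; case: (val u) (val v) => ? ? [? ?] /= -> ->.
  have := near_infty_natSinv_lt (PosNum e0) => ne; near=> m => _.
  have me : m.+1%:R^-1 < e by near: m.
  apply/eqP => /cell_close[]// c1 c2; case: he; rewrite leNgt => /negP; apply.
    exact: lt_trans me.
  exact: lt_trans me.
have far (u v : F) : \forall m \near \oo, ~~ (hyp_dist (val u) (val v) <= 2 * ln N) ->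
   forall p q, 0 <= p.1 /\ 0 <= p.2 -> 0 <= q.1 /\ 0 <= q.2 ->
     cell m p = cell m (val u) -> cell m q = cell m (val v) -> ~~ (hyp_dist p q <= 2 * ln N).
  have [u1 u2] := F0 _ (valP u); have [v1 v2] := F0 _ (valP v).
  have [uv|uv] := boolP (hyp_dist (val u) (val v) <= 2 * ln N); first by near=> m.
  have [e e0 he] := nonadj_near N1 u1 v1 uv.
  have := near_infty_natSinv_lt (PosNum e0) => ne; near=> m => _ p q [p1 p2] [q1 q2] pu qv.
  have me : m.+1%:R^-1 < e by near: m.
  have [a1 a2] := cell_close u1 u2 p1 p2 (esym pu).
  have [b1 b2] := cell_close v1 v2 q1 q2 (esym qv).
  by apply: he => //; apply: lt_trans me.
near=> m.
have sep' : forall u v : F, u != v -> cell m (val u) != cell m (val v).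
  by near: m; apply: filter_forall => u; apply: filter_forall => v; exact: sep.
have far' : forall u v : F, ~~ (hyp_dist (val u) (val v) <= 2 * ln N) ->
   forall p q, 0 <= p.1 /\ 0 <= p.2 -> 0 <= q.1 /\ 0 <= q.2 ->
     cell m p = cell m (val u) -> cell m q = cell m (val v) -> ~~ (hyp_dist p q <= 2 * ln N).
  by near: m; apply: filter_forall => u; apply: filter_forall => v; exact: far.
have fP (u : F) : cell m (val u) \in cells m F by apply: in_imfset; exact: valP.
pose f (u : F) : cells m F := [` fP u]%fset.
have finj : injective f.
  by move=> u v /(congr1 val)/= e; apply/eqP; apply: contraT => /sep'; rewrite e eqxx.
have gP (c : cells m F) : exists u : F, f u == c.
  have /imfsetP[p /= pF cp] := valP c.
  by exists [` pF]%fset; apply/eqP/val_inj.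
apply/esym/(@L2_iso _ _ _ _ f); [exact: hyp_adj_sym|exact: cell_adj_sym| |].
  exists (fun c : cells m F => xchoose (gP c)) => x; last by apply/eqP; exact: (xchooseP (gP x)).
  by apply: finj; apply/eqP; exact: (xchooseP (gP (f x))).
move=> u v; rewrite /cell_adj /hyp_adj (inj_eq finj) /radius -/N.
congr (_ && _); apply/asboolP/idP => [[p [q [p0 q0 pu qv pq]]]|uv].
  by apply: contraT => /far'/(_ p q p0 q0 pu qv); rewrite pq.
by exists (val u), (val v); split => //; apply: F0; exact: valP.
Unshelve. all: by end_near.
Qed.

Context d (T : measurableType d) (P : probability T R) (nu : R) (n : nat).
Variable V : T -> {fset (R * R)}.
Hypothesis HV : Poi P 2^-1 nu n V.

Lemma measurable_disk : measurable (disk nu n).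
Proof.
rewrite (_ : disk nu n = rect 0 (radius nu n) 0 (2 * pi)); first exact: measurable_rect.
by apply/seteqP; split=> [p []|p []]; rewrite /rect/= !in_itv/=.
Qed.

Lemma Poi_ge0 w p : p \in V w -> 0 <= p.1 /\ 0 <= p.2.
Proof. by have [h _ _ _] := HV; move=> /h[/andP[? ?] /andP[? ?]]. Qed.

Lemma measurable_cells m (O : {fset nat * nat}) : measurable [set w | cells m (V w) = O].
Proof.
have -> : [set w | cells m (V w) = O] =
    \bigcap_(c : nat * nat) (if c \in O then hit V (cell_box m c `&` disk nu n)
                    else empty V (cell_box m c `&` disk nu n)).
  have hE w c : hit V (cell_box m c `&` disk nu n) w <-> c \in cells m (V w).
    split=> [/hitP[p pV [pc pD]]|/imfsetP[p /= pV ->]].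
      have [p1 p2] := Poi_ge0 pV; apply/imfsetP; exists p => //.
      by apply/esym/cellP.
    have [p1 p2] := Poi_ge0 pV; apply/hitP; exists p => //; split.
      exact/cellP.
    by have [h _ _ _] := HV; exact: h pV.
  apply/seteqP; split=> [w <- c _|w h].
    case: ifPn => [/hE//|/negP cn]; apply: contrapT => /hE; exact: cn.
  apply/fsetP => c; have := h c I; case: ifPn => cO; first by move=> /hE.
  by move=> e; apply/negP => /hE; apply.
have mB c : measurable (cell_box m c `&` disk nu n).
  by apply: measurableI; [exact: measurable_rect|exact: measurable_disk].
rewrite -[X in measurable X]setCK setC_bigcap; apply: measurableC.
apply: countable_bigcupT_measurable => // c; apply: measurableC.
by case: ifP => _; [apply: measurableC|]; apply: (measurable_count_in HV).
Qed.

(** The event is the lower limit over [m] of its discretised versions, and each of these is a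
    countable union over the possible finite sets of occupied cells. *)
Lemma measurable_L2 (S : set nat) : 1 <= n%:R / nu ->
  measurable [set w | S (L2 (hyp_adj nu n (V w)))].
Proof.
move=> N1.
pose A m := [set w | S (L2 (@cell_adj (n%:R / nu) m (cells m (V w))))].
have -> : [set w | S (L2 (hyp_adj nu n (V w)))] =
    \bigcup_(k in setT) \bigcap_(m in [set m | (k <= m)%N]) A m.
  apply/seteqP; split=> w.
    have [k _ hk] := L2_cells N1 (fun p => @Poi_ge0 w p) => Sw.
    by exists k => // m km; rewrite /A/= hk.
  move=> [k _ hk]; have [k' _ hk'] := L2_cells N1 (fun p => @Poi_ge0 w p).
  have := hk (maxn k k') (leq_maxl _ _); rewrite /A/= hk'//.
  exact: leq_maxr.
apply: bigcupT_measurable => k; apply: bigcap_measurableType => m _.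
have -> : A m = \bigcup_(O : {fset nat * nat})
    ([set w | cells m (V w) = O] `&` [set w | S (L2 (@cell_adj (n%:R / nu) m O))]).
  apply/seteqP; split=> w; last by move=> [C _ []] /= <-.
  by exists (cells m (V w)).
apply: countable_bigcupT_measurable; first exact: countableP.
move=> O; apply: measurableI; first exact: measurable_cells.
have [h|h] := pselect (S (L2 (@cell_adj (n%:R / nu) m O))).
  rewrite [X in measurable X](_ : _ = setT); first exact: measurableT.
  by apply/seteqP; split.
rewrite [X in measurable X](_ : _ = set0); first exact: measurable0.
by apply/seteqP; split.
Qed.

End MeasurableL2.

(** * Cutting a cycle at gaps *)

Section Pieces.
Local Open Scope nat_scope.
Variables (Gb l : nat) (g : nat -> nat).
Let G := Gb * l.
Hypothesis G0 : 0 < G.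
Hypothesis gP : forall b, b < Gb -> g b < l.

(* Cutting a cycle of [Gb * l] arcs at the arcs [b * l + g b] leaves pieces; the
   piece of arc [i] is named after the block in which it ends. *)
Definition piece i : nat := if i %% l <= g (i %/ l) then i %/ l else (i %/ l).+1 %% Gb.

Let l0 : 0 < l.
Proof. by move: G0; rewrite /G; case: l => //; rewrite muln0. Qed.

Let Gb0 : 0 < Gb.
Proof. by move: G0; rewrite /G; case: Gb. Qed.

Lemma block_lt i : i < G -> i %/ l < Gb.
Proof. by rewrite ltn_divLR. Qed.

Lemma pieceS i : i.+1 < G -> i %% l != g (i %/ l) -> i.+1 %% l != g (i.+1 %/ l) ->
  piece i = piece i.+1.
Proof.
move=> iG; have g1 := gP (block_lt (ltnW iG)); rewrite /piece.
have := ltn_pmod i l0; rewrite leq_eqVlt => /orP[/eqP il|il].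
  (* The last arc of a block lies past the gap of that block, and the first arc of the next block
     lies before its own gap, so both are named after the next block. *)
  have e : i.+1 = (i %/ l).+1 * l by rewrite mulSn -[X in X + _]il addSn addnC -divn_eq.
  rewrite e modnMl mulnK//= => ne _; rewrite leqNgt ltn_neqAle eq_sym ne /=.
  have -> /= : g (i %/ l) <= i %% l by rewrite -ltnS il.
  rewrite modn_small//; move: iG; rewrite e /G ltn_mul2r => /andP[_ h].
  exact: h.
have e : i.+1 = i %/ l * l + (i %% l).+1 by rewrite addnS -divn_eq.
have -> : i.+1 %/ l = i %/ l by rewrite {1}e divnMDl// (divn_small il) addn0.
have -> : i.+1 %% l = (i %% l).+1 by rewrite {1}e modnMDl modn_small.
by move=> n1 _; rewrite [in LHS]leq_eqVlt (negbTE n1).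
Qed.

Lemma piece_wrap i : i.+1 = G -> i %% l != g (i %/ l) -> piece 0 = piece i.
Proof.
move=> iG ne; have iG' : i < G by rewrite -iG.
have g1 := gP (block_lt iG').
have e : i = Gb.-1 * l + l.-1.
  apply: succn_inj; rewrite iG /G -addnS prednK// -{1}(prednK Gb0) mulSn addnC.
  by [].
have ll : l.-1 < l by rewrite prednK.
have d1 : i %/ l = Gb.-1 by rewrite e divnMDl// divn_small// addn0.
have d2 : i %% l = l.-1 by rewrite e modnMDl modn_small.
rewrite /piece div0n mod0n leq0n; rewrite d1 d2 in ne g1 *.
have -> /= : (l.-1 <= g Gb.-1) = false.
  apply/negbTE; by rewrite -ltnNge ltn_neqAle eq_sym ne /= -ltnS prednK.
by rewrite prednK// modnn.
Qed.

(** A piece runs from the gap of one block to the gap of the next one on the cycle, so it meets at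
    most two blocks; this is the factor 2 in [L2_le_cap]. *)
Lemma piece_blocks i : i < G -> piece i < Gb /\
  (i %/ l = piece i \/ i %/ l = if piece i == 0 then Gb.-1 else (piece i).-1).
Proof.
move=> /block_lt bG; rewrite /piece; case: ifP => _; first by split; [|left].
split; first by rewrite ltn_mod.
right; move: bG; rewrite leq_eqVlt => /orP[/eqP e|bG]; first by rewrite e modnn -e.
by rewrite modn_small.
Qed.

End Pieces.

(** * Isolated paths along a tree of arcs *)

Section Boxes.
Context {R : realType} d (T : measurableType d) (P : probability T R).
Variables (nu : R) (n : nat) (V : T -> {fset (R * R)}).
Hypothesis HV : Poi P 2^-1 nu n V.
Hypothesis nu0 : 0 < nu.
Let N : R := n%:R / nu.
Hypothesis N4 : 4 <= N.
Local Notation pr := (pr P).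
Local Notation determined := (determined P V).

Lemma measurable_box (a b t u : R) : measurable (box a b t u).
Proof. exact: measurable_rect. Qed.

Lemma box_sub (a b t u a' b' t' u' : R) : 0 < a' -> a' <= a -> 0 < b -> b <= b' ->
  t' <= t -> u <= u' -> box a b t u `<=` box a' b' t' u'.
Proof.
move=> a0 aa b0 bb tt uu p; have a1 : 0 < a by exact: lt_le_trans aa.
have b1 : 0 < b' by exact: lt_le_trans bb.
move=> /(boxE t u p a1 b0)[h1 h2 h3 h4]; apply/boxE => //.
by split; [exact: le_trans h1|exact: lt_le_trans bb|exact: le_trans h3|exact: lt_le_trans uu].
Qed.

Lemma box_disjoint_angle (a b t u a' b' t' u' : R) : u <= t' ->
  box a b t u `&` box a' b' t' u' = set0.
Proof.
move=> ut; apply/seteqP; split => // p [[_]]; rewrite /= in_itv/= => /andP[_ pu].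
move=> [_]; rewrite /= in_itv/= => /andP[tp _].
by have := lt_le_trans pu (le_trans ut tp); rewrite ltxx.
Qed.

Lemma box_disjoint_radius (a b t u a' b' t' u' : R) : 0 < b -> b <= a' ->
  box a b t u `&` box a' b' t' u' = set0.
Proof.
move=> b0 ba; apply/seteqP; split => // p [[]]; rewrite /= in_itv/= => /andP[_ pb] _.
move=> [+ _]; rewrite /= in_itv/= => /andP[ap _].
have a0 := lt_le_trans b0 ba.
have : ln b <= ln a' by rewrite ler_ln.
by rewrite leNgt -(ltr_pM2l (ltr0n R 2)) (le_lt_trans ap pb).
Qed.

Lemma box_disk (a b t u : R) : 1 <= a -> 0 < b -> b <= N -> 0 <= t -> u <= 2 * pi ->
  box a b t u `<=` disk nu n.
Proof.
move=> a1 b0 bN t0 u2 p [/=]; rewrite !in_itv/= => /andP[ap pb] /andP[tp pu]; split.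
  rewrite (le_trans _ ap) ?mulr_ge0 ?ln_ge0//= (lt_le_trans pb)// /radius ler_pM2l//.
  by rewrite ler_ln// posrE -/N; lra.
by rewrite (le_trans t0 tp) (lt_le_trans pu u2).
Qed.

Lemma Poi_box w p : p \in V w -> box 1 N 0 (2 * pi) p.
Proof.
have [h _ _ _] := HV => /h[r t]; split; rewrite /= in_itv/=.
  by rewrite ln1 mulr0.
by [].
Qed.

Section OneBox.
Variables (a b t u : R).
Hypotheses (a1 : 1 <= a) (ab : a <= b) (bN : b <= N) (t0 : 0 <= t) (tu : t <= u)
  (u2 : u <= 2 * pi).

Let b0 : 0 < b. Proof. exact: lt_le_trans (lt_le_trans ltr01 a1) ab. Qed.
Let bD : box a b t u `<=` disk nu n. Proof. exact: box_disk. Qed.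

Lemma intensity_box_ge0 : 0 <= intensity_measure (intensity 2^-1 nu n) (box a b t u).
Proof. by have /andP[] := intensity_box_le nu0 a1 ab bN tu N4. Qed.

Lemma pr_empty_box : expR (- (nu * ((u - t) * (b - a)))) <= pr (empty V (box a b t u)).
Proof.
rewrite (pr_empty HV)//; [|exact: measurable_box|exact: intensity_box_ge0].
by rewrite ler_expR lerN2; have /andP[] := intensity_box_le nu0 a1 ab bN tu N4.
Qed.

Lemma pr_empty_box_le : 2 <= a * b ->
  pr (empty V (box a b t u)) <= expR (- (nu / 16 * ((u - t) * (b - a)))).
Proof.
move=> ab2; rewrite (pr_empty HV)//; [|exact: measurable_box|exact: intensity_box_ge0].
by rewrite ler_expR lerN2; exact: intensity_box_ge.
Qed.

Lemma pr_hit_box : 2 <= a * b ->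
  1 - expR (- (nu / 16 * ((u - t) * (b - a)))) <= pr (hit V (box a b t u)).
Proof.
move=> ab2; rewrite (pr_hit HV)//; [|exact: measurable_box|exact: intensity_box_ge0].
rewrite lerD2l lerN2 ler_expR lerN2; exact: intensity_box_ge.
Qed.

Lemma pr_count_box (x : nat) :
  pr (count_in V (box a b t u) [set k | (x <= k)%N]) <=
  expR (nu * ((u - t) * (b - a))) / 2 ^+ x.
Proof.
apply: le_trans (pr_count_ge HV _ _ _ _) _ => //.
- exact: measurable_box.
- exact: intensity_box_ge0.
rewrite ler_pM2r ?invr_gt0 ?exprn_gt0// ler_expR.
by have /andP[] := intensity_box_le nu0 a1 ab bN tu N4.
Qed.

Lemma determined_empty_box : determined (box a b t u) (empty V (box a b t u)).
Proof. apply: (determined_count HV) => //; exact: measurable_box. Qed.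

Lemma determined_hit_box : determined (box a b t u) (hit V (box a b t u)).
Proof. exact/determinedC/determined_empty_box. Qed.

End OneBox.
End Boxes.

(** * Linear inequalities between the subarcs of an arc, with [s] in place of [12 / X] *)

Section LeafGeometry.
Variables (R : realFieldType) (th s t N X : R).

Lemma leaf_arcs : 0 <= th -> 0 < s -> th + 4 * s <= t ->
  [/\ [/\ th <= th + s, th + s <= th + 3 * s & th + 3 * s <= th + 4 * s],
      [/\ th <= th + 3 * s, th + s <= th + 4 * s & 0 <= th + s] &
      [/\ 0 <= th + 3 * s, th + s <= t & th + 3 * s <= t]].
Proof. by move=> *; do !split; lra. Qed.

Lemma branch_arcs : 0 <= th -> 0 < s -> th + 4 * s <= t ->
  [/\ [/\ th <= th + s, th <= th + 2 * s & th <= th + 4 * s],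
      [/\ th + 2 * s <= th + 4 * s, th + s + s <= th + 2 * s,
          th + 2 * s + s <= th + 4 * s & th + s + s <= th + 4 * s] &
      [/\ 0 <= th + s, 0 <= th + 2 * s, th + s + s <= t & th + 2 * s + s <= t]].
Proof. by move=> *; do !split; lra. Qed.

Lemma leaf_areas : 0 <= s -> 0 <= X ->
  [/\ (th + s - th) * (N - X) <= s * N,
      (th + 4 * s - (th + 3 * s)) * (N - X) <= s * N &
      (th + 3 * s - (th + s)) * (N / 2 - X) <= s * N].
Proof. by move=> s0 X0; have := mulr_ge0 s0 X0; split; lra. Qed.

End LeafGeometry.

(** * Leaves and the branching construction *)

Section Tree.
Context {R : realType} d (T : measurableType d) (P : probability T R).
Variables (nu : R) (n : nat) (V : T -> {fset (R * R)}).
Hypothesis HV : Poi P 2^-1 nu n V.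
Hypothesis nu0 : 0 < nu.
Let N : R := n%:R / nu.
Hypothesis N4 : 4 <= N.
Local Notation pr := (pr P).
Local Notation determined := (determined P V).
Variable m : nat.
Hypothesis m0 : (0 < m)%N.
Implicit Types (X th : R).

(** The middle half of the arc is cut into [m] slots. For [m] between [48 N / X] and [96 N / X],
    points of consecutive slots are within angle [1 / N] of each other, yet each slot box has mean
    at least [nu / 128]. *)
Definition slot X th (i : nat) : R := th + 12 / X + i%:R * (24 / (X * m%:R)).
Definition slot_box X th (i : nat) : set (R * R) :=
  box (N / 2) N (slot X th i) (slot X th i.+1).

(* A point at height at least [X] reaches at most [12 / X] in angle among the
   outermost points [N / 2 <= x]; hence the margins of width [12 / X] cut out of
   arcs of width [48 / X]. *)
Definition leaf X th : set T :=
  empty V (box X N th (th + 12 / X)) `&`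
  (empty V (box X N (th + 36 / X) (th + 48 / X)) `&`
  (empty V (box X (N / 2) (th + 12 / X) (th + 36 / X)) `&`
   every m (fun i => hit V (slot_box X th i)))).

(** The children have width [48 / (4 X) = 12 / X]: they are the two middle quarters of their parent,
    and the outer quarters serve as margins. *)
Fixpoint tree j X th : set T :=
  if j is j'.+1 then
    empty V (box X (4 * X) th (th + 48 / X)) `&`
    (tree j' (4 * X) (th + 12 / X) `|` tree j' (4 * X) (th + 24 / X))
  else leaf X th.

Let m0' : 0 < m%:R :> R. Proof. by rewrite ltr0n. Qed.

Lemma slotS X th i : slot X th i.+1 = slot X th i + 24 / (X * m%:R).
Proof. by rewrite /slot -natr1; ring. Qed.

Lemma slot0 X th : slot X th 0 = th + 12 / X.
Proof. by rewrite /slot mul0r addr0. Qed.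

Lemma slotm X th : 0 < X -> slot X th m = th + 36 / X.
Proof. by move=> X0; rewrite /slot; field; rewrite !gt_eqF. Qed.

Lemma le_slot X th i j : 0 < X -> (i <= j)%N -> slot X th i <= slot X th j.
Proof.
move=> X0 ij; rewrite lerD2l ler_pM2r ?ler_nat//.
by rewrite divr_gt0// mulr_gt0.
Qed.

(** The events concern disjoint boxes. The three empty boxes have area at most [12 N / X] each,
    whence the 36, and each slot is hit with probability at least [1 - exp (- nu / 128)]. *)
Lemma leaf_pr X th : 1 <= X -> X <= N / 2 -> 0 <= th -> th + 48 / X <= 2 * pi ->
  m%:R <= 96 * (N / X) ->
  determined (box X N th (th + 48 / X)) (leaf X th) /\
  expR (- (nu * (36 * (N / X)))) * (1 - expR (- (nu / 128))) ^+ m <= pr (leaf X th).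
Proof.
move=> X1 XN th0 th2 mN; have X0 : 0 < X by lra.
have N20 : 1 <= N / 2 by lra.
have hit0 : 0 <= 1 - expR (- (nu / 128)).
  by apply: one_sub_expRN_ge0; rewrite divr_ge0// ltW.
have dX (c : R) : 0 < c -> 0 < c / X by move=> c0; rewrite divr_gt0.
have d12 := dX 12 (ltr0n _ _).
have e24 : 24 / X = 2 * (12 / X) by field; rewrite gt_eqF.
have e36 : 36 / X = 3 * (12 / X) by field; rewrite gt_eqF.
have e48 : 48 / X = 4 * (12 / X) by field; rewrite gt_eqF.
rewrite /leaf e36 e48 in th2 *.
set s := 12 / X in d12 e24 e36 e48 th2 *.
set E1 := empty V _; set E2 := empty V _; set E3 := empty V _; set E4 := every _ _.
have sub1 : box X N th (th + 4 * s) `<=` disk nu n by apply: box_disk => //; rewrite -/N; lra.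
have sm := slotm th X0; rewrite e36 in sm.
have s0 := slot0 X th; rewrite -/s in s0.
have c0 : 0 < N / 2 by lra.
have c1 : N / 2 <= N by lra.
have c2 : X <= N by lra.
have c3 : 0 < N by lra.
have c4 : 2 <= N / 2 * N.
  by apply: le_trans (ler_pM _ _ N20 N4) => //; rewrite mul1r ler_nat.
have [[a01 a13 a34] [a03 a14 z1] [z3 y1 y3]] := leaf_arcs th0 d12 th2.
have [r1 r2 r3] := leaf_areas th N (ltW d12) (ltW X0).
have slotge i : th + s <= slot X th i by rewrite -s0; exact: le_slot.
have slotle i : (i <= m)%N -> slot X th i <= th + 3 * s by rewrite -sm; exact: le_slot.
have [d4 p4] : determined (box (N / 2) N (th + s) (th + 3 * s)) E4 /\
    pr E4 = \prod_(i < m) pr (hit V (slot_box X th i)).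
  apply: (determined_every HV) (slot_box X th) _ _ _ _ _ => [|i im|i j ij jm|i im].
  - exact: box_disk.
  - by apply: box_sub; rewrite ?slotge ?slotle//; lra.
  - by apply: box_disjoint_angle; exact: le_slot.
  - apply: (determined_hit_box HV) => //; rewrite -/N.
    + exact: le_trans z1 (slotge i).
    + exact: le_trans (slotle i.+1 im) y3.
have [d3 p3] : determined (box X N (th + s) (th + 3 * s)) (E3 `&` E4) /\
    pr (E3 `&` E4) = pr E3 * pr E4.
  apply: (determinedI HV) _ _ _ _ _ d4; last 1 first.
  - exact: (determined_empty_box HV).
  - exact: box_disk.
  - exact: box_sub.
  - exact: box_sub.
  - exact: box_disjoint_radius.
have [d2 p2] : determined (box X N (th + s) (th + 4 * s)) (E2 `&` (E3 `&` E4)) /\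
    pr (E2 `&` (E3 `&` E4)) = pr E2 * pr (E3 `&` E4).
  apply: (determinedI HV) _ _ _ _ _ d3; last 1 first.
  - exact: (determined_empty_box HV).
  - exact: box_disk.
  - exact: box_sub.
  - exact: box_sub.
  - by rewrite setIC; exact: box_disjoint_angle.
have [d1 p1] : determined (box X N th (th + 4 * s)) (E1 `&` (E2 `&` (E3 `&` E4))) /\
    pr (E1 `&` (E2 `&` (E3 `&` E4))) = pr E1 * pr (E2 `&` (E3 `&` E4)).
  apply: (determinedI HV) _ _ _ _ _ d2; last 1 first.
  - exact: (determined_empty_box HV).
  - exact: box_disk.
  - exact: box_sub.
  - exact: box_sub.
  - exact: box_disjoint_angle.
split => //; rewrite p1 p2 p3 p4.
have sN : s * N = 12 * (N / X) by rewrite /s; field; rewrite gt_eqF.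
have NX0 : 0 < N / X by rewrite divr_gt0//; lra.
have q (p : R) : p <= 12 * (N / X) -> expR (- (nu * (12 * (N / X)))) <= expR (- (nu * p)).
  by move=> pN; rewrite ler_expR lerN2 ler_pM2l.
have q1 : expR (- (nu * (12 * (N / X)))) <= pr E1.
  apply: le_trans (pr_empty_box HV _ _ _ _ _ _ _ _) => //.
  by apply: q; rewrite -sN.
have q2 : expR (- (nu * (12 * (N / X)))) <= pr E2.
  apply: le_trans (pr_empty_box HV _ _ _ _ _ _ _ _) => //.
  by apply: q; rewrite -sN.
have q3 : expR (- (nu * (12 * (N / X)))) <= pr E3.
  apply: le_trans (pr_empty_box HV _ _ _ _ _ _ _ _) => //.
  by apply: q; rewrite -sN.
have q4 : (1 - expR (- (nu / 128))) ^+ m <= \prod_(i < m) pr (hit V (slot_box X th i)).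
  rewrite -[X in _ ^+ X]card_ord -prodr_const; apply: ler_prod => i _.
  have i1 := slotge i; have i2 := slotle i.+1 (ltn_ord i).
  have i3 := le_slot th X0 (leqnSn i).
  apply/andP; split.
    exact: hit0.
  apply: le_trans (pr_hit_box HV _ _ _ _ _ _ _ _ _) => //; last 2 first.
  - exact: le_trans z1 i1.
  - exact: le_trans i2 y3.
  rewrite lerD2l lerN2 ler_expR lerN2 slotS addrAC subrr add0r.
  have -> : nu / 128 = nu / 16 * 8^-1 by field.
  rewrite ler_pM2l ?divr_gt0//.
  have -> : 24 / (X * m%:R) * (N - N / 2) = 12 * (N / X) / m%:R.
    by field; rewrite !gt_eqF.
  by rewrite ler_pdivlMr//; lra.
have -> : expR (- (nu * (36 * (N / X)))) = expR (- (nu * (12 * (N / X)))) *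
  (expR (- (nu * (12 * (N / X)))) * expR (- (nu * (12 * (N / X))))).
  by rewrite -!expRD; congr expR; ring.
have e0 := expR_ge0 (- (nu * (12 * (N / X)))).
have Q0 : 0 <= (1 - expR (- (nu / 128))) ^+ m by exact: exprn_ge0.
move: (expR (- (nu * (12 * _)))) e0 q1 q2 q3 => e e0 q1 q2 q3.
rewrite -!mulrA; apply: ler_pM => //; first by rewrite !mulr_ge0.
by apply: ler_pM => //; [rewrite mulr_ge0|exact: ler_pM].
Qed.

End Tree.

Section TreeProbability.
Context {R : realType} d (T : measurableType d) (P : probability T R).
Variables (nu : R) (n : nat) (V : T -> {fset (R * R)}).
Hypothesis HV : Poi P 2^-1 nu n V.
Hypothesis nu0 : 0 < nu.
Let N : R := n%:R / nu.
Hypothesis N4 : 4 <= N.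
Hypothesis nu_small : nu <= 1000^-1.
Local Notation pr := (pr P).
Local Notation determined := (determined P V).
Variable m : nat.
Local Notation tree := (tree nu n V m).
Local Notation leaf := (leaf nu n V m).

(** 144 is the area of the box of an arc at heights [[X, 4 X)]. *)
Lemma survival_base (x : R) : x <= 1000^-1 -> 3 / 4 <= 1 + - (x * 144).
Proof. by lra. Qed.

Lemma third_le : 3^-1 <= 5 / 4 / 3 :> R.
Proof. by lra. Qed.

(** [3/4 (1 - (1 - t)^2) = 3/4 t (2 - t)], and [2 - t >= 5/3] as long as [t <= 1/3]. *)
Lemma survival_step (e a b t : R) : 3 / 4 <= e -> 0 <= t <= 3^-1 ->
  t <= a <= 1 -> t <= b <= 1 -> 5 / 4 * t <= e * (1 - (1 - a) * (1 - b)).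
Proof.
move=> e34 /andP[t0 t3] /andP[ta a1] /andP[tb b1].
have ab : (1 - a) * (1 - b) <= (1 - t) * (1 - t) by apply: ler_pM; lra.
apply: (@le_trans _ _ (3 / 4 * (1 - (1 - t) * (1 - t)))); first by nra.
by apply: ler_pM; nra.
Qed.

(* A surviving arc has two chances to survive one scale further down, so the
   survival probability [s] obeys [s' >= 3/4 (1 - (1 - s)^2)], which exceeds
   [5/4 s] as long as [s <= 1/3]. *)
Lemma tree_pr j (X th q : R) (Y := X * 4 ^+ j) : 1 <= X -> Y <= N / 2 -> 0 <= q ->
  (forall t, 0 <= t -> t + 48 / Y <= 2 * pi ->
    determined (box Y N t (t + 48 / Y)) (leaf Y t) /\ q <= pr (leaf Y t)) ->
  0 <= th -> th + 48 / X <= 2 * pi ->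
  determined (box X N th (th + 48 / X)) (tree j X th) /\
  Num.min 3^-1 ((5 / 4) ^+ j * q) <= pr (tree j X th).
Proof.
move=> + + q0; rewrite {}/Y; elim: j X th => [|j IH] X th X1 YN lf th0 th2.
  rewrite expr0 mulr1 in lf; have [dl ql] := lf _ th0 th2.
  by split => //; rewrite /= expr0 mul1r ge_min ql orbT.
have X0 : 0 < X by lra.
have YE : 4 * X * 4 ^+ j = X * 4 ^+ j.+1 by rewrite exprS; ring.
have X4N : 4 * X <= N / 2.
  apply: le_trans YN; rewrite -YE ler_peMr ?exprn_ege1//; lra.
set s := 12 / X.
have s0 : 0 < s by rewrite divr_gt0.
have e24 : 24 / X = 2 * s by rewrite /s; field; rewrite gt_eqF.
have e48 : 48 / X = 4 * s by rewrite /s; field; rewrite gt_eqF.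
have c48 : 48 / (4 * X) = s by rewrite /s; field; rewrite gt_eqF.
rewrite -YE in YN lf; rewrite e48 in th2 *.
have c1 : 1 <= 4 * X by lra.
have c0 : 0 < 4 * X by lra.
have c2 : X <= 4 * X by lra.
have c3 : 4 * X <= N by lra.
have c4 : X <= N by lra.
have c5 : 0 < N by lra.
have [[a01 a02 a04] [a12 a13 a24 a14] [z1 z2 y1 y2]] := branch_arcs th0 s0 th2.
have [|||d1 p1] := IH (4 * X) (th + s) _ YN lf; rewrite ?c48 //.
have [|||d2 p2] := IH (4 * X) (th + 2 * s) _ YN lf; rewrite ?c48 //.
rewrite c48 in d1 d2.
have [dU pU] : determined (box (4 * X) N th (th + 4 * s))
      (tree j (4 * X) (th + s) `|` tree j (4 * X) (th + 2 * s)) /\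
    pr (tree j (4 * X) (th + s) `|` tree j (4 * X) (th + 2 * s)) =
    1 - (1 - pr (tree j (4 * X) (th + s))) * (1 - pr (tree j (4 * X) (th + 2 * s))).
  apply: (determinedU HV) _ _ _ _ d1 d2.
  - exact: box_disk.
  - exact: box_sub.
  - exact: box_sub.
  - exact: box_disjoint_angle.
have [dI pI] : determined (box X N th (th + 4 * s))
      (empty V (box X (4 * X) th (th + 4 * s)) `&`
      (tree j (4 * X) (th + s) `|` tree j (4 * X) (th + 2 * s))) /\
    pr (empty V (box X (4 * X) th (th + 4 * s)) `&`
      (tree j (4 * X) (th + s) `|` tree j (4 * X) (th + 2 * s))) =
    pr (empty V (box X (4 * X) th (th + 4 * s))) *
    pr (tree j (4 * X) (th + s) `|` tree j (4 * X) (th + 2 * s)).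
  apply: (determinedI HV) _ _ _ _ _ dU; last 1 first.
  - exact: (determined_empty_box HV).
  - exact: box_disk.
  - exact: box_sub.
  - exact: box_sub.
  - exact: box_disjoint_radius.
rewrite /= e24 e48 -/s; split => //; rewrite pI pU.
have pe : 3 / 4 <= pr (empty V (box X (4 * X) th (th + 4 * s))).
  apply: le_trans (pr_empty_box HV _ _ _ _ _ _ _ _) => //.
  apply: le_trans (expR_ge1Dx _).
  have -> : (th + 4 * s - th) * (4 * X - X) = 144 by rewrite /s; field; rewrite gt_eqF.
  exact: survival_base.
set t := Num.min _ _ in p1 p2.
have t0 : 0 <= t by rewrite le_min invr_ge0 ler0n/= mulr_ge0// exprn_ge0.
have t3 : t <= 3^-1 by rewrite ge_min lexx.
have a1 : pr (tree j (4 * X) (th + s)) <= 1 by apply: pr_le1; case: d1.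
have b1 : pr (tree j (4 * X) (th + 2 * s)) <= 1 by apply: pr_le1; case: d2.
(* Capping at 1/3 before multiplying by 5/4 loses nothing, because a capped value exceeds 1/3 after
   the multiplication. *)
have min_le : Num.min 3^-1 ((5 / 4) ^+ j.+1 * q) <= Num.min 3^-1 (5 / 4 * t).
  rewrite le_min !ge_min lexx/= /t; case: (leP 3^-1 ((5 / 4) ^+ j * q)) => h.
    by apply/orP; left; exact: third_le.
  by apply/orP; right; rewrite exprS [leRHS]mulrA.
apply: (le_trans min_le); rewrite ge_min; apply/orP; right.
by apply: survival_step; rewrite ?pe ?t0 ?t3 ?p1 ?a1 ?p2 ?b1.
Qed.

End TreeProbability.

(** * Surviving leaves are closed under adjacency *)

Section Clusters.
Context {R : realType} d (T : measurableType d) (P : probability T R).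
Variables (nu : R) (n : nat) (V : T -> {fset (R * R)}).
Hypothesis HV : Poi P 2^-1 nu n V.
Let N : R := n%:R / nu.
Hypothesis N4 : 4 <= N.
Variable m : nat.
Hypothesis m0 : (0 < m)%N.
Local Notation tree := (tree nu n V m).
Local Notation leaf := (leaf nu n V m).
Implicit Types (w : T) (X Y th : R) (u v p : R * R).

Definition leaf_band Y th : set (R * R) := box (N / 2) N (th + 12 / Y) (th + 36 / Y).

Lemma Poi_coord w p : p \in V w ->
  [/\ 0 <= p.1, 1 <= expR (p.1 / 2), expR (p.1 / 2) < N, 0 <= p.2 & p.2 < 2 * pi].
Proof.
have N4' := N4; move=> /(Poi_box HV) pb; have [||h1 h2 h3 h4] := box_coords _ _ pb; rewrite -?/N; try lra.
split => //.
by move: h1; rewrite -expR0 ler_expR pmulr_lge0 ?invr_gt0.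
Qed.

(** The product [N / 2 * Y * (12 / Y)] is exactly the threshold [6 N] of [adj_nec]. As [u] has its
    angle in [[1, 3]], the way round through angle 0 is longer than [12 / Y] as well. *)
Lemma band_separated w u v Y : u \in V w -> v \in V w -> 48 <= Y -> N / 2 <= expR (u.1 / 2) ->
  Y <= expR (v.1 / 2) -> 1 <= u.2 -> u.2 <= 3 -> 12 / Y <= `|u.2 - v.2| ->
  ~ (hyp_dist u v <= 2 * ln N).
Proof.
move=> /Poi_coord[u0 u1 uN u2 u2'] /Poi_coord[v0 v1 vN v2 v2'] Y48 Nu Yv ul ur uv a.
have N4' := N4; have p2 := pi_ge2 R; have Y0 : 0 < Y by lra.
have d0 : 0 < 12 / Y by rewrite divr_gt0.
have d4 : 12 / Y <= 4^-1 by rewrite ler_pdivrMr//; lra.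
have dup : `|u.2 - v.2| <= 2 * pi - 12 / Y.
  by rewrite ler_norml; apply/andP; split; lra.
have : expR (u.1 / 2) * expR (v.1 / 2) * (12 / Y) < 6 * N.
  apply: (@adj_nec _ u v) => //; [lra|nra|nra|by apply/andP; split; lra].
apply/negP; rewrite -leNgt.
have -> : 6 * N = N / 2 * Y * (12 / Y) by field; rewrite gt_eqF.
rewrite ler_pM2r//; apply: ler_pM => //; lra.
Qed.

Lemma band_confined w u v Y a b : u \in V w -> v \in V w -> 48 <= Y ->
  N / 2 <= expR (u.1 / 2) -> Y <= expR (v.1 / 2) -> 1 <= a -> b <= 3 ->
  a + 12 / Y <= u.2 -> u.2 + 12 / Y <= b -> hyp_dist u v <= 2 * ln N -> a <= v.2 < b.
Proof.
move=> uV vV Y48 Nu Yv a1 b3 au ub uv.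
have d0 : 0 < 12 / Y by rewrite divr_gt0// (lt_le_trans _ Y48).
have sep : ~ (12 / Y <= `|u.2 - v.2|).
  move=> h; apply: (band_separated uV vV Y48 Nu Yv _ _ h uv).
    by apply: le_trans (le_trans a1 _) au; rewrite lerDl ltW.
  by apply: le_trans (le_trans ub b3); rewrite lerDl ltW.
apply/andP; split; [rewrite leNgt|rewrite ltNge]; apply/negP => h; apply: sep.
  apply: le_trans (ler_norm _); rewrite lerBrDl; apply: le_trans au.
  by rewrite lerD2r ltW.
rewrite distrC; apply: le_trans (ler_norm _); rewrite lerBrDl.
exact: le_trans ub h.
Qed.

Lemma empty_box_out w v (a b t s : R) : empty V (box a b t s) w -> v \in V w ->
  0 < a -> 0 < b -> a <= expR (v.1 / 2) -> expR (v.1 / 2) < b -> t <= v.2 -> v.2 < s -> False.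
Proof. by move=> /emptyP e vV a0 b0 *; apply: (e _ vV); exact/boxE. Qed.

Lemma band_adj u v : 0 <= u.1 -> 0 <= v.1 ->
  N / 2 <= expR (u.1 / 2) -> expR (u.1 / 2) < N ->
  N / 2 <= expR (v.1 / 2) -> expR (v.1 / 2) < N -> `|u.2 - v.2| <= N^-1 ->
  hyp_dist u v <= 2 * ln N.
Proof.
move=> u0 v0 u1 u2 v1 v2 uv; have N0 : 0 < N by apply: lt_le_trans N4.
have c := one_sub_cos_le (u.2 - v.2).
have uv2 : (u.2 - v.2) ^+ 2 <= (N^-1) ^+ 2.
  by rewrite -[leLHS]real_normK ?num_real// ler_sqr ?nnegrE// invr_ge0 ltW.
(* 4 bounds the squared ratio of two heights in [[N / 2, N)]; the angular part is at most
   [N^2 / 8]. *)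
apply: (@adj_suff _ u v N 4) => //.
- by rewrite (le_trans _ N4)// ler1n.
- by move: N (expR _) (expR _) N0 u1 u2 v1 v2 {c uv2 uv} => M x y; nra.
- by move: N (expR _) (expR _) N0 u1 u2 v1 v2 {c uv2 uv} => M x y; nra.
have ab : expR (u.1 / 2) ^+ 2 * expR (v.1 / 2) ^+ 2 / 4 * (1 - cos (u.2 - v.2)) <=
    N ^+ 2 * N ^+ 2 / 4 * (N^-1 ^+ 2 / 2).
  apply: ler_pM.
  - by rewrite divr_ge0// mulr_ge0// sqr_ge0.
  - by rewrite subr_ge0 cos_le1.
  - rewrite ler_pM2r ?invr_gt0//; apply: ler_pM; rewrite ?sqr_ge0//;
      by rewrite ler_sqr ?nnegrE ?expR_ge0 ?ltW.
  - by apply: le_trans c _; rewrite ler_pM2r ?invr_gt0.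
have NN : N ^+ 2 * N ^+ 2 / 4 * (N^-1 ^+ 2 / 2) = N ^+ 2 / 8 by field; rewrite gt_eqF.
rewrite NN in ab; have N16 : 4 ^+ 2 <= N ^+ 2 by rewrite ler_sqr// nnegrE ltW.
by move: (_ * (1 - _)) (N ^+ 2) ab N16 => A B; clear -HV N4 m0 => *; lra.
Qed.

(** A neighbour [v] of the band avoids the empty box, hence has height at least [4 X], and the
    margin then confines it to the arc of the surviving child. At the leaf, the empty boxes leave
    only the band. The bounds on [th'] carry the margin around the band through all scales. *)
Lemma tree_cluster j X th w (Y := X * 4 ^+ j) : tree j X th w -> 48 <= X -> Y <= N / 2 ->
  1 <= th -> th + 48 / X <= 3 ->
  exists th', [/\ leaf Y th' w, th + 12 / X <= th' + 12 / Y, th' + 36 / Y <= th + 36 / X &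
    forall u v, u \in V w -> v \in V w -> leaf_band Y th' u -> X <= expR (v.1 / 2) ->
      th <= v.2 -> v.2 < th + 48 / X -> hyp_dist u v <= 2 * ln N -> leaf_band Y th' v].
Proof.
rewrite {}/Y; have N4' := N4; elim: j X th => [|j IH] X th.
  rewrite expr0 mulr1 => lw X48 XN th1 th3; exists th; split => // u v uV vV _ Xv tv vt _.
  have [v0 v1 vN _ _] := Poi_coord vV.
  case: lw => e1 [e2 [e3 _]].
  have X0 : 0 < X by apply: lt_le_trans X48.
  have N0 : 0 < N by apply: lt_le_trans N4.
  have N20 : 0 < N / 2 by rewrite divr_gt0.
  have h1 : th + 12 / X <= v.2.
    by rewrite leNgt; apply/negP; exact: (empty_box_out e1 vV).
  have h2 : v.2 < th + 36 / X.
    by rewrite ltNge; apply/negP => h; exact: (empty_box_out e2 vV).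
  apply/boxE => //; split => //.
  by rewrite leNgt; apply/negP => h; exact: (empty_box_out e3 vV).
move=> tw X48 YN th1 th3.
have X0 : 0 < X by lra.
have YE : 4 * X * 4 ^+ j = X * 4 ^+ j.+1 by rewrite exprS; ring.
have e24 : 24 / X = 2 * (12 / X) by field; rewrite gt_eqF.
have e36 : 36 / X = 3 * (12 / X) by field; rewrite gt_eqF.
have e48 : 48 / X = 4 * (12 / X) by field; rewrite gt_eqF.
have c48 : 48 / (4 * X) = 12 / X by field; rewrite gt_eqF.
have c12 : 12 / (4 * X) = 4^-1 * (12 / X) by field; rewrite gt_eqF.
have c36 : 36 / (4 * X) = 3 / 4 * (12 / X) by field; rewrite gt_eqF.
have s0 : 0 < 12 / X by rewrite divr_gt0.
move: tw => [/= ew tU].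
have [th1' [tw [l1 l2]]] : exists th1', [/\ tree j (4 * X) th1' w,
    th + 12 / X <= th1' & th1' + 12 / X <= th + 36 / X].
  case: tU => tw; [exists (th + 12 / X)|exists (th + 24 / X)]; split => //; lra.
rewrite -YE in YN *.
have [|||th' [lw h1 h2 cl]] := IH _ _ tw _ YN.
- by move: X48; clear -HV N4 m0 => *; lra.
- by move: l1 s0 th1; move: (12 / X); clear -HV N4 m0 => *; lra.
- by move: l2 th3 s0; rewrite c48 e36 e48; move: (12 / X); clear -HV N4 m0 => *; lra.
rewrite c12 in h1; rewrite c36 in h2.
exists th'; split => //.
- by move: h1 l1 s0; move: (12 / X) (12 / _); clear -HV N4 m0 => *; lra.
- by move: h2 l2 s0; rewrite e36; move: (12 / X) (36 / _); clear -HV N4 m0 => *; lra.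
move=> u v uV vV cu Xv tv vt uv.
have [v0 v1 vN _ _] := Poi_coord vV.
have N0 : 0 < N by apply: lt_le_trans N4.
have X40 : 0 < 4 * X by rewrite mulr_gt0.
have X4v : 4 * X <= expR (v.1 / 2).
  by rewrite leNgt; apply/negP => vX; exact: (empty_box_out ew vV).
have [||u1 u2 u3 u4] := box_coords _ _ cu => //; first by rewrite divr_gt0.
have /andP[in1 in2] : th1' <= v.2 < th1' + 48 / (4 * X).
  apply: (band_confined uV vV _ u1 X4v _ _ _ _ uv); rewrite ?c12 ?c48.
  - by move: X48; clear -HV N4 m0 => *; lra.
  - by move: l1 s0 th1; move: (12 / X); clear -HV N4 m0 => *; lra.
  - by move: l2 th3 s0; rewrite e36 e48; move: (12 / X); clear -HV N4 m0 => *; lra.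
  - exact: le_trans h1 u3.
  - by move: u4 h2; move: (36 / _) (12 / X); clear -HV N4 m0 => *; lra.
by apply: (cl u).
Qed.

(** At scale 48 an arc has width 1 and no point lies lower, so nothing has to be assumed on the
    height or the angle of the neighbour. *)
Lemma root_cluster j th w (Y := 48 * 4 ^+ j) : empty V (box 1 48 0 (2 * pi)) w ->
  tree j 48 th w -> Y <= N / 2 -> 1 <= th -> th + 1 <= 3 ->
  exists th', [/\ leaf Y th' w, th <= th' + 12 / Y, th' + 36 / Y <= th + 1 &
    forall u v, u \in V w -> v \in V w -> leaf_band Y th' u ->
      hyp_dist u v <= 2 * ln N -> leaf_band Y th' v].
Proof.
have N4' := N4; move=> ew tw YN th1 th3; have [||||th' [lw h1 h2 cl]] := tree_cluster tw; rewrite -?/Y; try lra.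
exists th'; split => //; try (rewrite /Y; lra).
move=> u v uV vV cu uv.
have [v0 v1 vN v2 v2'] := Poi_coord vV.
have N0 : 0 < N by apply: lt_le_trans N4.
have v48 : 48 <= expR (v.1 / 2).
  by rewrite leNgt; apply/negP => vX; exact: (empty_box_out ew vV).
rewrite -/Y in h1 h2.
have [||u1 u2 u3 u4] := box_coords _ _ cu => //; first by rewrite divr_gt0.
have e48 : 48 / 48 = 1 :> R by rewrite divff.
have /andP[in1 in2] : th <= v.2 < th + 1.
  apply: (band_confined uV vV (lexx _) u1 v48 th1 th3 _ _ uv).
  - by move: h1 u3; move: (12 / _); clear -HV N4 m0 => *; lra.
  - by move: h2 u4; move: (36 / _); clear -HV N4 m0 => *; lra.
by apply: (cl u) => //; rewrite e48.
Qed.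

Local Notation slot := (slot m).

(** The points chosen one per slot form a path: the slot width is at most [1 / (2 N)], so
    consecutive points satisfy [band_adj]. *)
Lemma leaf_component Y th w : 0 < Y -> leaf Y th w -> 48 * (N / Y) <= m%:R ->
  exists2 x : V w, leaf_band Y th (val x) & (m <= #|component (hyp_adj nu n (V w)) x|)%N.
Proof.
have N4' := N4; move=> Y0 [_ [_ [_ ev]]] mN; have N0 : 0 < N by lra.
have m0' : 0 < m%:R :> R by rewrite ltr0n.
have /fin_all_exists[p pP] : forall i : 'I_m, exists p : V w,
    slot_box nu n m Y th i (val p).
  by move=> i; have /hitP[p pV pb] := ev i (ltn_ord i); exists [` pV]%fset.
have pE (i : 'I_m) : [/\ N / 2 <= expR ((val (p i)).1 / 2), expR ((val (p i)).1 / 2) < N,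
    slot Y th i <= (val (p i)).2 & (val (p i)).2 < slot Y th i.+1].
  by have [||? ? ? ?] := box_coords _ _ (pP i); rewrite -?/N; try lra; split.
have wid : 24 / (Y * m%:R) <= (2 * N)^-1.
  have Ym : 0 < Y * m%:R by exact: mulr_gt0.
  have N2 : 0 < 2 * N by lra.
  rewrite ler_pdivrMr// mulrC ler_pdivlMr//.
  have : 48 * (N / Y) * Y <= m%:R * Y by rewrite ler_pM2r.
  by rewrite mulrA mulfVK ?gt_eqF//; lra.
have adj (i j : 'I_m) : j = i.+1 :> nat -> hyp_dist (val (p i)) (val (p j)) <= 2 * ln N.
  move=> ij; have [i1 i2 i3 i4] := pE i; have [j1 j2 j3 j4] := pE j.
  rewrite ij !slotS in i4 j3 j4.
  have [pi0 _ _ _ _] := Poi_coord (valP (p i)); have [pj0 _ _ _ _] := Poi_coord (valP (p j)).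
  apply: band_adj => //.
  have NN : N^-1 = 2 * (2 * N)^-1 by field; rewrite gt_eqF.
  rewrite NN ler_norml; move: (2 * N)^-1 (24 / _) wid i3 i4 j3 j4 => A B.
  by clear -HV N4 m0; move=> *; apply/andP; split; lra.
pose e := hyp_adj nu n (V w).
have con (k : nat) (km : (k < m)%N) : connect e (p (Ordinal m0)) (p (Ordinal km)).
  elim: k km => [|k IH] km; first by rewrite (_ : Ordinal km = Ordinal m0)//; exact: val_inj.
  have [->|ne] := eqVneq (p (Ordinal km)) (p (Ordinal (ltnW km))); first exact: IH.
  apply: connect_trans (IH (ltnW km)) _; apply: connect1.
  by rewrite /e /hyp_adj eq_sym ne /radius -/N adj.
exists (p (Ordinal m0)).
  apply: box_sub (pP (Ordinal m0)); rewrite -?/N; try lra.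
    by rewrite /= slot0.
  by rewrite -(slotm m0 th Y0); exact: le_slot.
have pinj : injective p.
  move=> i j pij; apply/val_inj/eqP; rewrite eqn_leq.
  have key (a b : 'I_m) : p a = p b -> (a <= b)%N.
    move=> ab; rewrite leqNgt; apply/negP => ba.
    have [_ _ b3 _] := pE a; have [_ _ _ b4] := pE b; rewrite ab in b3.
    by have := le_slot m0 th Y0 ba; rewrite leNgt (le_lt_trans b3).
  by rewrite !key.
rewrite -[leqLHS]card_ord -(card_imset _ pinj); apply: subset_leq_card.
by apply/fintype.subsetP => _ /imsetP[i _ ->]; rewrite inE; case: i => k km; exact: con.
Qed.

(** The band found in the arc [[1, 2)] is closed under adjacency, and the angle 2 separates it from
    the band found in [[2, 3)]. *)
Lemma L2_ge_clusters j w (Y := 48 * 4 ^+ j) : empty V (box 1 48 0 (2 * pi)) w ->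
  tree j 48 1 w -> tree j 48 2 w -> Y <= N / 2 -> 48 * (N / Y) <= m%:R ->
  (m <= L2 (hyp_adj nu n (V w)))%N.
Proof.
have N4' := N4; move=> ew t1 t2 YN mN; have Y0 : 0 < Y by rewrite mulr_gt0 ?exprn_gt0.
have [|||a [la a1 a2 ca]] := root_cluster ew t1; rewrite -?/Y; try lra.
have [|||b [lb b1 b2 _]] := root_cluster ew t2; rewrite -?/Y; try lra.
have [x xa sx] := leaf_component Y0 la mN.
have [y yb sy] := leaf_component Y0 lb mN.
apply/L2_geP => //; first exact: hyp_adj_sym.
exists x, y; split => //; apply/negP => xy.
have /(_ _ _ _ xy) : forall x y : V w, `[< leaf_band Y a (val x) >] ->
    connect (hyp_adj nu n (V w)) x y -> `[< leaf_band Y a (val y) >].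
  apply: connect_closed => u v /asboolP cu /andP[_ uv]; apply/asboolP.
  by apply: ca cu uv; exact: valP.
move=> /(_ (asboolT xa))/asboolP ya.
have [||_ _ _ y4] := box_coords _ _ ya; rewrite -?/N; try lra.
have [||_ _ y3 _] := box_coords _ _ yb; rewrite -?/N; try lra.
rewrite -/Y in a2 b1; lra.
Qed.

End Clusters.

(** * The giant component *)

Lemma adjacency_budget (R : realType) (a b c x : R) :
  a <= 8 * c * b -> b * (1 + 2 * c) <= x -> b + a / 4 <= x.
Proof. by lra. Qed.

Section Giant.
Context {R : realType} d (T : measurableType d) (P : probability T R).
Variables (nu : R) (n : nat) (V : T -> {fset (R * R)}).
Hypothesis HV : Poi P 2^-1 nu n V.
Hypothesis nu0 : 0 < nu.
Let N : R := n%:R / nu.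
Hypothesis N4 : 4 <= N.
Local Notation pr := (pr P).
Local Notation determined := (determined P V).
Variables (beta tau : R) (J Gb l cap : nat).
Let G := (Gb * l)%N.
Hypothesis G0 : (0 < G)%N.
(* [nu * beta = 32] makes each of the [J] hub boxes of an arc nonempty with
   probability at least [1 - 1 / 64], against at most [N <= 64 beta^2 16^J] arcs;
   [tau] is such that points with [x <= N / tau] are adjacent to those hubs. *)
Hypotheses (beta2 : 2 <= beta) (nubeta : nu * beta = 32) (tauE : tau = 2 * beta + 2).
Hypotheses (J4 : (4 <= J)%N) (JN : 4 * beta ^+ 2 * 16 ^+ J <= N).
Hypotheses (GN : G%:R <= N / (2 * tau ^+ 2)) (NG : N / (4 * tau ^+ 2) <= G%:R).

Definition step : R := 2 * pi / G%:R.
(** The interval of length [4^-k] from here contains arc [i] and stays inside [[0, 2 pi]]: it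
    extends to the right of arcs that start at 2 or earlier and to the left of the others, so no hub
    box crosses angle 0. *)
Definition arc_start i k : R :=
  if i%:R * step <= 2 then i%:R * step else i.+1%:R * step - 4 ^- k.
(** The area is [3 beta] at every level [k]. *)
Definition hub_box i k : set (R * R) :=
  box (beta * 4 ^+ k) (beta * 4 ^+ k.+1) (arc_start i k) (arc_start i k + 4 ^- k).
Definition arc_box i : set (R * R) := box (N / tau) N (i%:R * step) (i.+1%:R * step).
Definition block_box b : set (R * R) :=
  box (N / tau) N ((b * l)%:R * step) ((b.+1 * l)%:R * step).

Definition hub_event : set T :=
  every G (fun i => ~` every J (fun k => empty V (hub_box i k))).
Definition gap_event : set T :=
  every Gb (fun b => ~` every l (fun a => hit V (arc_box (b * l + a)))).
Definition count_event : set T :=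
  every Gb (fun b => ~` count_in V (block_box b) [set k | (cap < k)%N]).

Lemma tau_beta : 6 <= tau <= 3 * beta.
Proof. by have := beta2; have := tauE; lra. Qed.

Lemma step_gt0 : 0 < step.
Proof. by rewrite divr_gt0 ?mulr_gt0 ?pi_gt0 ?ltr0n. Qed.

Lemma stepG : G%:R * step = 2 * pi.
Proof. by rewrite /step; field; rewrite pnatr_eq0 -lt0n. Qed.

(** Points above [N / tau] at angular distance [step] then have [x y t >= 8 N], beyond the [6 N] of
    [adj_nec]. *)
Lemma step_ge : 8 * tau ^+ 2 <= N * step.
Proof.
have p2 := pi_ge2 R; have := GN; have s0 := step_gt0; have sG := stepG.
have t0 : 0 < 2 * tau ^+ 2 by rewrite mulr_gt0// exprn_gt0//; have := tau_beta; lra.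
rewrite ler_pdivlMr// => h.
have : G%:R * (2 * tau ^+ 2) * step <= N * step by rewrite ler_pM2r.
by rewrite [G%:R * _ * step]mulrAC sG; nra.
Qed.

(** Bounds the area of an arc box, and so its mean number of points by a constant. *)
Lemma step_le : N * step <= 32 * tau ^+ 2.
Proof.
have p4 := pihalf_lt2 R; have p2 := pi_ge2 R.
have := NG; have s0 := step_gt0; have sG := stepG.
have t0 : 0 < 4 * tau ^+ 2 by rewrite mulr_gt0// exprn_gt0//; have := tau_beta; lra.
rewrite ler_pdivrMr// => h.
have : N * step <= G%:R * (4 * tau ^+ 2) * step by rewrite ler_pM2r.
by rewrite [G%:R * _ * step]mulrAC sG; nra.
Qed.

Lemma le_4X k : (k < J)%N -> 1 <= 4 ^+ k :> R /\ 4 * 4 ^+ k <= 4 ^+ J :> R.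
Proof.
by move=> kJ; rewrite exprn_ege1 ?ler1n// -exprS ler_weXn2l// ler1n.
Qed.

(** Even the shortest hub interval is longer than an arc: [N step] is at most [288 beta^2], against
    [N >= 4 beta^2 16^J], and [4 <= J] absorbs the constant. *)
Lemma step_level k : (k < J)%N -> step <= 4 ^- k.
Proof.
move=> kJ; have [k1 kB] := le_4X kJ.
have B256 : 256 <= 4 ^+ J :> R.
  have -> : 256 = 4 ^+ 4 :> R by ring.
  by rewrite ler_weXn2l// ler1n.
have k0 : 0 < 4 ^+ k :> R by lra.
rewrite -[4 ^- k]mul1r ler_pdivlMr//.
have /andP[tau6 tau3] := tau_beta; have b2 := beta2.
have NB : 4 * beta ^+ 2 * (4 ^+ J * 4 ^+ J) <= N.
  by rewrite -exprMn (_ : 4 * 4 = 16 :> R)//; ring.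
have s0 := step_gt0; have sl := step_le.
have t9 : tau ^+ 2 <= 9 * beta ^+ 2 by nra.
have b20 : 0 < beta ^+ 2 by nra.
have : 4 * beta ^+ 2 * (256 * 4 ^+ J) * step <= 288 * beta ^+ 2.
  apply: le_trans (le_trans sl _); last by lra.
  rewrite ler_pM2r//; apply: le_trans NB; rewrite ler_pM2l; last by lra.
  by rewrite ler_pM2r//; lra.
have -> : 4 * beta ^+ 2 * (256 * 4 ^+ J) * step = beta ^+ 2 * (1024 * (4 ^+ J * step)) by ring.
have -> : 288 * beta ^+ 2 = beta ^+ 2 * 288 by ring.
rewrite ler_pM2l// => h.
have : 4 ^+ k * step <= 4 ^+ J * step by rewrite ler_pM2r//; lra.
rewrite mulrC; lra.
Qed.

Lemma arc_start_bounds i k : (i < G)%N -> (k < J)%N ->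
  [/\ 0 <= arc_start i k, arc_start i k + 4 ^- k <= 2 * pi,
      arc_start i k <= i%:R * step & i.+1%:R * step <= arc_start i k + 4 ^- k].
Proof.
move=> iG kJ; have p2 := pi_ge2 R; have s0 := step_gt0; have sk := step_level kJ.
have [k1 _] := le_4X kJ.
have k2 : 4 ^- k <= 1 :> R by rewrite invf_le1//; lra.
have i0 : 0 <= i%:R * step by rewrite mulr_ge0// ltW.
have iG' : i.+1%:R * step <= 2 * pi by rewrite -stepG ler_pM2r// ler_nat.
rewrite /arc_start; rewrite -natr1 mulrDl mul1r in iG' *.
by case: (leP (i%:R * step) 2) => h; split; lra.
Qed.

Lemma arc_bounds i : (i < G)%N -> 0 <= i%:R * step /\ i.+1%:R * step <= 2 * pi.
Proof.
move=> iG; have s0 := step_gt0; split; first by rewrite mulr_ge0// ltW.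
by rewrite -stepG ler_pM2r// ler_nat.
Qed.

Lemma pr_every_ge m (E : nat -> set T) p : (forall k, (k < m)%N -> measurable (E k)) ->
  (forall k, (k < m)%N -> pr (E k) <= p) ->
  1 - m%:R * p <= pr (every m (fun k => ~` E k)).
Proof.
move=> mE Ep.
have -> : every m (fun k => ~` E k) = ~` some m E.
  apply/seteqP; split=> [w h [k km Ek]|w h k km Ek]; first exact: h Ek.
  by apply: h; exists k.
by rewrite prC ?lerD2l ?lerN2; [exact: pr_some_le|exact: measurable_some].
Qed.

Lemma expRN6 : expR (- 6) <= 64^-1 :> R.
Proof.
rewrite expRN lef_pV2 ?posrE ?expR_gt0//.
have -> : 64 = 2 ^+ 6 :> R by ring.
have -> : 6 = 6%:R * 1 :> R by rewrite mulr1.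
rewrite expRM_natl lerXn2r ?nnegrE ?expR_ge0//.
by apply: le_trans (expR_ge1Dx 1).
Qed.

Lemma hub_box_in i k : (i < G)%N -> (k < J)%N ->
  [/\ 1 <= beta * 4 ^+ k, beta * 4 ^+ k <= beta * 4 ^+ k.+1, beta * 4 ^+ k.+1 <= N,
   2 * (2 * (beta * 4 ^+ k.+1)) ^+ 2 <= 2 * N & hub_box i k `<=` disk nu n].
Proof.
move=> iG kJ; have [k1 kJ'] := le_4X kJ; have b2 := beta2.
have [a0 a2 _ _] := arc_start_bounds iG kJ.
have NB : 4 * beta ^+ 2 * (4 ^+ J * 4 ^+ J) <= N.
  by rewrite -exprMn (_ : 4 * 4 = 16 :> R)//; ring.
have bk : 1 <= beta * 4 ^+ k by nra.
have bk4 : beta * 4 ^+ k <= beta * 4 ^+ k.+1.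
  by rewrite ler_pM2l ?exprS; lra.
have sq : (2 * (beta * 4 ^+ k.+1)) ^+ 2 <= N.
  apply: le_trans NB; have -> : 4 * beta ^+ 2 * (4 ^+ J * 4 ^+ J) = (2 * (beta * 4 ^+ J)) ^+ 2 by ring.
  have le : beta * 4 ^+ k.+1 <= beta * 4 ^+ J by rewrite exprS ler_pM2l; lra.
  by rewrite ler_sqr ?nnegrE; lra.
have bN : beta * 4 ^+ k.+1 <= N.
  by apply: le_trans sq; move: bk bk4; move: (beta * _) (beta * _) => x y; nra.
split => //; first by lra.
apply: box_disk => //; by rewrite -?/N; lra.
Qed.

Lemma measurable_hub_event : measurable hub_event.
Proof.
apply: measurable_every => i iG; apply/measurableC/measurable_every => k kJ.
have [_ _ _ _ sub] := hub_box_in iG kJ.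
by apply: (measurable_count_in HV) => //; exact: measurable_box.
Qed.

(** The boxes of one arc are disjoint by height and have mean at least [nu beta 3/16 = 6], so all
    are empty with probability at most [64^-J]. *)
Lemma hub_event_ge : 1 - G%:R * 64^-1 ^+ J <= pr hub_event.
Proof.
have b2 := beta2; apply: pr_every_ge => i iG.
  apply: measurable_every => k kJ; have [_ _ _ _ sub] := hub_box_in iG kJ.
  by apply: (measurable_count_in HV) => //; exact: measurable_box.
have [_ ->] : determined (disk nu n) (every J (fun k => empty V (hub_box i k))) /\
    pr (every J (fun k => empty V (hub_box i k))) = \prod_(k < J) pr (empty V (hub_box i k)).
  apply: (determined_every HV) (hub_box i) _ _ _ _ _ => // [k kJ|k k' kk' k'J|k kJ].
  - by have [] := hub_box_in iG kJ.
  - apply: box_disjoint_radius; first by rewrite mulr_gt0 ?exprn_gt0//; lra.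
    by rewrite ler_pM2l ?ler_weXn2l ?ler1n//; lra.
  - have [h1 h2 h3 _ _] := hub_box_in iG kJ; have [a0 a2 _ _] := arc_start_bounds iG kJ.
    by apply: (determined_empty_box HV) => //; rewrite -/N.
rewrite -[X in _ ^+ X]card_ord -prodr_const; apply: ler_prod => k _; rewrite pr_ge0/=.
have [h1 h2 h3 _ _] := hub_box_in iG (ltn_ord k).
have [a0 a2 _ _] := arc_start_bounds iG (ltn_ord k).
have k40 : 0 < 4 ^- k :> R by rewrite invr_gt0 exprn_gt0.
apply: le_trans (pr_empty_box_le HV _ _ _ _ _ _ _ _ _) _ => //; rewrite -?/N//.
- by rewrite lerDl ltW.
- have -> : beta * 4 ^+ k.+1 = 4 * (beta * 4 ^+ k) by rewrite exprS; ring.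
  have h (z : R) : 1 <= z -> 2 <= z * (4 * z) by move=> z1; nra.
  exact: h.
apply: le_trans expRN6; rewrite ler_expR lerN2 addrAC subrr add0r exprS.
have -> : nu / 16 * (4 ^- k * (beta * (4 * 4 ^+ k) - beta * 4 ^+ k)) = nu * beta * (3 / 16).
  by field; rewrite expf_neq0.
by rewrite nubeta; lra.
Qed.

Lemma arc_box_in i : (i < G)%N ->
  [/\ 1 <= N / tau, N / tau <= N, 0 <= i%:R * step, i%:R * step <= i.+1%:R * step &
      i.+1%:R * step <= 2 * pi].
Proof.
move=> iG; have [a0 a2] := arc_bounds iG; have /andP[t6 t3] := tau_beta.
have t0 : 0 < tau by lra.
have b2 := beta2; have N4' := N4; have s0 := step_gt0.
have J1 : 1 <= 16 ^+ J :> R by rewrite exprn_ege1// ler1n.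
have JN' := JN.
split => //; [|by rewrite ler_pdivrMr//; nra|by rewrite ler_pM2r// ler_nat].
rewrite ler_pdivlMr// mul1r; apply: le_trans JN'; nra.
Qed.

Lemma N_ratio_le i : (i < G)%N -> N - N / tau <= N.
Proof. by move=> /arc_box_in[h _ _ _ _]; lra. Qed.

Lemma block_index b a : (b < Gb)%N -> (a < l)%N -> (b * l + a < G)%N.
Proof.
move=> bG al; rewrite /G; apply: (@leq_trans (b.+1 * l)); first by rewrite mulSn addnC ltn_add2r.
by rewrite leq_mul2r bG orbT.
Qed.

Let M := nu * (32 * tau ^+ 2).

Lemma measurable_arc i : (i < G)%N -> measurable (hit V (arc_box i)).
Proof.
move=> iG; have [h1 h2 h3 h4 h5] := arc_box_in iG.
apply/measurableC/(measurable_count_in HV); first exact: measurable_box.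
by have N4' := N4; apply: box_disk => //; rewrite -?/N; lra.
Qed.

Lemma measurable_gap_event : measurable gap_event.
Proof.
apply: measurable_every => b bG; apply/measurableC/measurable_every => a al.
exact/measurable_arc/block_index.
Qed.

Lemma gap_event_ge : 1 - Gb%:R * (1 - expR (- M)) ^+ l <= pr gap_event.
Proof.
have N4' := N4; apply: pr_every_ge => b bG.
  by apply: measurable_every => a al; exact/measurable_arc/block_index.
have [_ ->] : determined (disk nu n) (every l (fun a => hit V (arc_box (b * l + a)))) /\
    pr (every l (fun a => hit V (arc_box (b * l + a)))) =
    \prod_(a < l) pr (hit V (arc_box (b * l + a))).
  apply: (determined_every HV) (fun a => arc_box (b * l + a)) _ _ _ _ _ => // [a al|a a' aa' a'l|a al].
  - have [h1 h2 h3 h4 h5] := arc_box_in (block_index bG al).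
    by apply: box_disk => //; rewrite -?/N; lra.
  - apply: box_disjoint_angle; rewrite ler_pM2r ?step_gt0// ler_nat.
    by rewrite -addnS leq_add2l.
  - have [h1 h2 h3 h4 h5] := arc_box_in (block_index bG al).
    by apply: (determined_hit_box HV) => //; rewrite -?/N.
rewrite -[X in _ ^+ X]card_ord -prodr_const; apply: ler_prod => a _; rewrite pr_ge0/=.
have iG := block_index bG (ltn_ord a); have [h1 h2 h3 h4 h5] := arc_box_in iG.
rewrite prC; last first.
  apply: (measurable_count_in HV); first exact: measurable_box.
  by apply: box_disk => //; rewrite -?/N; lra.
rewrite lerD2l lerN2; apply: le_trans (pr_empty_box HV _ _ _ _ _ _ _ _) => //; rewrite -?/N//.
rewrite ler_expR lerN2 ler_pM2l// -mulrBl -natr1 addrAC subrr add0r mul1r mulrC.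
apply: le_trans step_le; rewrite ler_pM2r ?step_gt0//; exact: N_ratio_le iG.
Qed.

Lemma block_box_in b : (b < Gb)%N ->
  [/\ 1 <= N / tau, N / tau <= N, 0 <= (b * l)%:R * step,
      (b * l)%:R * step <= (b.+1 * l)%:R * step & (b.+1 * l)%:R * step <= 2 * pi].
Proof.
move=> bG; have s0 := step_gt0; have [h1 h2 _ _ _] := arc_box_in G0; split => //.
- by rewrite mulr_ge0// ltW.
- by rewrite ler_pM2r// ler_nat leq_mul2r leqnSn orbT.
- by rewrite -stepG ler_pM2r// ler_nat /G leq_mul2r bG orbT.
Qed.

Lemma block_box_disk b : (b < Gb)%N -> block_box b `<=` disk nu n.
Proof.
move=> /block_box_in[h1 h2 h3 h4 h5]; have N4' := N4.
by apply: box_disk => //; rewrite -?/N; lra.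
Qed.

Lemma measurable_count_event : measurable count_event.
Proof.
apply: measurable_every => b bG; apply/measurableC/(measurable_count_in HV).
  exact: measurable_box.
exact: block_box_disk.
Qed.

Lemma count_event_ge : 1 - Gb%:R * (expR (M * l%:R) / 2 ^+ cap.+1) <= pr count_event.
Proof.
apply: pr_every_ge => b bG.
  by apply: (measurable_count_in HV); [exact: measurable_box|exact: block_box_disk].
have [h1 h2 h3 h4 h5] := block_box_in bG.
apply: le_trans (pr_count_box HV _ _ _ _ _ _ _ _ _) _ => //; rewrite -?/N//.
rewrite ler_pM2r ?invr_gt0 ?exprn_gt0// ler_expR /M -mulrA ler_pM2l//.
have -> : (b.+1 * l)%:R * step - (b * l)%:R * step = l%:R * step.
  by rewrite -mulrBl mulSn natrD addrK.
have -> : l%:R * step * (N - N / tau) = (N - N / tau) * step * l%:R by ring.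
apply: ler_wpM2r => //; apply: le_trans step_le.
by rewrite ler_pM2r ?step_gt0//; exact: N_ratio_le G0.
Qed.

(** * Structure of the graph for a fixed sample *)

Section Deterministic.
Variable w : T.
Local Notation e := (hyp_adj nu n (V w)).
Local Notation xc p := (expR (p.1 / 2)).
Implicit Types (p q : R * R).

Definition arc_index p : nat := Num.truncn (p.2 / step).

Lemma arc_indexP p : p \in V w -> [/\ (arc_index p < G)%N,
  (arc_index p)%:R * step <= p.2 & p.2 < (arc_index p).+1%:R * step].
Proof.
move=> /(Poi_coord HV N4)[_ _ _ p2 p2']; have s0 := step_gt0.
have /andP[h1 h2] := truncn_itv (divr_ge0 p2 (ltW s0)).
rewrite -ler_pdivlMr// -ltr_pdivrMr//; split => //.
by rewrite /arc_index (truncn_lt_nat _ (divr_ge0 p2 (ltW s0))) ltr_pdivrMr// stepG.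
Qed.

(** The angle between [p] and [v] is at most [4^-k], so its product with the height of [p] is at
    most [4 beta] whatever the level. The condition that remains is [2 + 4 beta^2 <= tau^2], which
    [tau = 2 beta + 2] satisfies. *)
Lemma hub_adj p v i k : (i < G)%N -> (k < J)%N -> p \in V w -> v \in V w ->
  hub_box i k p -> arc_index v = i -> xc v <= N / tau -> hyp_dist p v <= 2 * ln N.
Proof.
move=> iG kJ pV vV hp vi vt.
have [p0 p1 pN _ _] := Poi_coord HV N4 pV; have [v0 v1 vN _ _] := Poi_coord HV N4 vV.
have [h1 h2 h3 h4 _] := hub_box_in iG kJ; have [_ i1 i2] := arc_indexP vV.
have [_ _ a1 a2] := arc_start_bounds iG kJ.
have [||x1 x2 t1 t2] := box_coords _ _ hp.
- exact: lt_le_trans h1.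
- exact: lt_le_trans (le_trans h1 h2).
rewrite vi in i1 i2.
have /andP[t6 t3] := tau_beta; have b2 := beta2.
have D : `|p.2 - v.2| <= 4 ^- k.
  have j1 := le_trans a1 i1; have j2 := lt_le_trans i2 a2.
  by rewrite ler_norml; apply/andP; split; lra.
have xD : xc p * `|p.2 - v.2| <= 4 * beta.
  apply: (@le_trans _ _ (beta * 4 ^+ k.+1 * 4 ^- k)).
    by apply: ler_pM => //; rewrite ?expR_ge0// ltW.
  by rewrite exprS mulrA mulfK ?expf_neq0// mulrC.
have xN : 4 * xc p ^+ 2 <= N.
  have xx : xc p ^+ 2 <= (beta * 4 ^+ k.+1) ^+ 2.
    by rewrite ler_sqr ?nnegrE ?expR_ge0 ?(le_trans ler01 (le_trans h1 h2))// ltW.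
  by move: h4 xx; rewrite exprMn; lra.
have c := one_sub_cos_le (p.2 - v.2).
have N0 : 0 < N by exact: lt_le_trans N4.
have t0 : 0 < tau by lra.
have tN : tau ^+ 2 <= N.
  have J1 : 16 <= 16 ^+ J :> R by rewrite -{1}[16]expr1 ler_weXn2l ?ler1n// (leq_trans _ J4).
  by apply: le_trans JN; rewrite tauE; move: b2 J1; move: beta (16 ^+ J) => y z; nra.
have tx : tau * xc v <= N by rewrite mulrC -ler_pdivlMr.
have tx2 : tau ^+ 2 * xc v ^+ 2 <= N ^+ 2.
  have tx0 : 0 <= tau * xc v by apply: mulr_ge0; [exact: ltW|exact: expR_ge0].
  by rewrite -exprMn ler_sqr ?nnegrE//; exact: ltW.
have t20 : 0 < tau ^+ 2 by rewrite exprn_gt0.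
apply: (@adj_suff _ p v N (N ^+ 2 / tau ^+ 2)) => //.
- by rewrite (le_trans _ N4)// ler1n.
- apply: (@le_trans _ _ N); first by have := sqr_ge0 (xc p); lra.
  have y1 : 1 <= xc v ^+ 2 by rewrite exprn_ege1.
  apply: (@le_trans _ _ (N ^+ 2 / tau ^+ 2)); last by rewrite ler_peMr// divr_ge0// sqr_ge0.
  by rewrite ler_pdivlMr// [N ^+ 2]expr2 ler_pM2l.
- apply: (@le_trans _ _ (N ^+ 2 / tau ^+ 2)); first by rewrite ler_pdivlMr// mulrC.
  by rewrite ler_peMr ?exprn_ege1// divr_ge0// sqr_ge0.
have xD2 : xc p ^+ 2 * (p.2 - v.2) ^+ 2 <= (4 * beta) ^+ 2.
  rewrite -[(p.2 - v.2) ^+ 2]real_normK ?num_real// -exprMn ler_sqr// nnegrE.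
    by rewrite mulr_ge0// expR_ge0.
  by lra.
have c1 : xc p ^+ 2 * (1 - cos (p.2 - v.2)) <= 8 * beta ^+ 2.
  apply: (@le_trans _ _ (xc p ^+ 2 * ((p.2 - v.2) ^+ 2 / 2))).
    by rewrite ler_wpM2l// sqr_ge0.
  by rewrite mulrA; lra.
have v2 : xc v ^+ 2 <= N ^+ 2 / tau ^+ 2 by rewrite ler_pdivlMr// mulrC.
have v20 := sqr_ge0 (xc v).
have -> : xc p ^+ 2 * xc v ^+ 2 / 4 * (1 - cos (p.2 - v.2)) =
  (xc p ^+ 2 * (1 - cos (p.2 - v.2))) * xc v ^+ 2 / 4 by ring.
have : xc p ^+ 2 * (1 - cos (p.2 - v.2)) * xc v ^+ 2 <= 8 * beta ^+ 2 * (N ^+ 2 / tau ^+ 2).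
  apply: ler_pM => //; rewrite mulr_ge0 ?sqr_ge0// subr_ge0; exact: cos_le1.
have : N ^+ 2 / tau ^+ 2 * (1 + 2 * beta ^+ 2) <= N ^+ 2 / 2.
  have -> : N ^+ 2 / tau ^+ 2 * (1 + 2 * beta ^+ 2) =
      N ^+ 2 / 2 * ((2 + 4 * beta ^+ 2) / tau ^+ 2) by field; rewrite gt_eqF.
  rewrite ler_piMr ?divr_ge0 ?sqr_ge0// ler_pdivrMr// mul1r.
  by rewrite tauE; move: b2; move: beta => y; nra.
by move=> le1 le2; exact: adjacency_budget le2 le1.
Qed.

(** Hub heights satisfy [x^2 <= N / 4], which suffices at any angle, even when [1 - cos] is 2. *)
Lemma hub_clique p q i k i' k' : (i < G)%N -> (k < J)%N -> (i' < G)%N -> (k' < J)%N ->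
  p \in V w -> q \in V w -> hub_box i k p -> hub_box i' k' q -> hyp_dist p q <= 2 * ln N.
Proof.
move=> iG kJ iG' kJ' pV qV hp hq.
have [p0 p1 _ _ _] := Poi_coord HV N4 pV; have [q0 q1 _ _ _] := Poi_coord HV N4 qV.
have sq j l' r : (j < G)%N -> (l' < J)%N -> hub_box j l' r -> 4 * xc r ^+ 2 <= N.
  move=> jG lJ hr; have [h1 h2 h3 h4 _] := hub_box_in jG lJ.
  have [||x1 x2 _ _] := box_coords _ _ hr.
  - exact: lt_le_trans h1.
  - exact: lt_le_trans (le_trans h1 h2).
  have xx : xc r ^+ 2 <= (beta * 4 ^+ l'.+1) ^+ 2.
    by rewrite ler_sqr ?nnegrE ?expR_ge0 ?(le_trans ler01 (le_trans h1 h2))// ltW.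
  by move: h4 xx; rewrite exprMn; lra.
have pN := sq _ _ _ iG kJ hp; have qN := sq _ _ _ iG' kJ' hq.
have N0 : 0 < N by exact: lt_le_trans N4.
have p21 : 1 <= xc p ^+ 2 by rewrite exprn_ege1.
have q21 : 1 <= xc q ^+ 2 by rewrite exprn_ege1.
have c2 : 1 - cos (p.2 - q.2) <= 2 by have := cos_geN1 (p.2 - q.2); lra.
have c0 : 0 <= 1 - cos (p.2 - q.2) by rewrite subr_ge0 cos_le1.
apply: (@adj_suff _ p q N (N / 4)) => //.
- by rewrite (le_trans _ N4)// ler1n.
- by apply: (@le_trans _ _ (N / 4)); [lra|rewrite ler_peMr// divr_ge0// ltW].
- by apply: (@le_trans _ _ (N / 4)); [lra|rewrite ler_peMr// divr_ge0// ltW].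
have N4' := N4.
have : xc p ^+ 2 * xc q ^+ 2 <= N / 4 * (N / 4) by apply: ler_pM; lra.
move: (xc p ^+ 2 * xc q ^+ 2) => A A1.
have : A / 4 * (1 - cos (p.2 - q.2)) <= N / 4 * (N / 4) / 4 * 2.
  have [A0|A0] := leP 0 A; first by apply: ler_pM => //; lra.
  by apply: (@le_trans _ _ 0); nra.
by rewrite expr2; nra.
Qed.

Lemma hub_connected : hub_event w ->
  exists c : V w, forall v : V w, xc (val v) <= N / tau -> connect e c v.
Proof.
move=> hub.
have hubP i : (i < G)%N -> exists k p, [/\ (k < J)%N, p \in V w & hub_box i k p].
  move=> iG; apply: contrapT => h; apply: (hub i iG) => k kJ.
  by apply/emptyP => p pV hp; apply: h; exists k, p.
have link p q (pV : p \in V w) (qV : q \in V w) :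
    hyp_dist p q <= 2 * ln N -> connect e [` pV]%fset [` qV]%fset.
  move=> pq; have [->|pq'] := eqVneq [` pV]%fset [` qV]%fset; first exact: connect0.
  by apply: connect1; rewrite /hyp_adj pq'.
have [k0 [p0 [k0J p0V hp0]]] := hubP 0%N G0.
exists [` p0V]%fset => v vt.
have [vG _ _] := arc_indexP (valP v).
have [k [p [kJ pV hp]]] := hubP _ vG.
apply: (@connect_trans _ _ [` pV]%fset).
  apply: link; exact: hub_clique hp0 hp.
have -> : v = [` valP v]%fset by exact: val_inj.
by apply: link; apply: hub_adj hp _ _ => //; exact: valP.
Qed.

Lemma arc_neighbours p q : p \in V w -> q \in V w -> N / tau < xc p -> N / tau < xc q ->
  hyp_dist p q <= 2 * ln N -> (arc_index p <= arc_index q)%N ->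
  (arc_index q <= (arc_index p).+1)%N \/ (arc_index p = 0 /\ (arc_index q).+1 = G)%N.
Proof.
move=> pV qV pt qt pq ij.
have [iG i1 i2] := arc_indexP pV; have [jG j1 j2] := arc_indexP qV.
have [p0 p1 _ _ _] := Poi_coord HV N4 pV; have [q0 q1 _ _ _] := Poi_coord HV N4 qV.
move: (arc_index p) (arc_index q) iG i1 i2 jG j1 j2 ij => i j iG i1 i2 jG j1 j2 ij.
have [|ij2] := leqP j i.+1; [by left|right].
apply: contrapT => nwrap.
(* Once both alternatives are excluded, a full arc separates the two points on either side of the
   circle. *)
have jiG : (j.+2 <= G + i)%N.
  rewrite leqNgt; apply/negP => h; apply: nwrap.
  have i0 : i = 0%N by apply/eqP; rewrite -leqn0; move: h jG; clear; lia.
  by move: h jG; rewrite i0; clear; lia.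
have s0 := step_gt0; have N4' := N4; have N0 : 0 < N by lra.
have /andP[t6 t3] := tau_beta; have t0 : 0 < tau by lra.
have Nt : 6 <= N / tau.
  rewrite ler_pdivlMr//; apply: le_trans JN.
  have J1 : 16 <= 16 ^+ J :> R by rewrite -{1}[16]expr1 ler_weXn2l ?ler1n// (leq_trans _ J4).
  by have := beta2; nra.
have lo : step <= q.2 - p.2.
  have : i.+2%:R * step <= j%:R * step by rewrite ler_pM2r// ler_nat.
  by rewrite -natr1 mulrDl mul1r; lra.
have hi : q.2 - p.2 <= 2 * pi - step.
  have : j.+2%:R * step <= (G + i)%:R * step by rewrite ler_pM2r// ler_nat.
  by rewrite -natr1 natrD !mulrDl mul1r stepG; lra.
have J0 : (0 < J)%N by exact: leq_trans J4.
have st1 : step <= 1 by have := step_level J0; rewrite expr0 invr1.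
have d1 : step <= `|q.2 - p.2| by rewrite (le_trans lo)// ler_norm.
have d2 : `|q.2 - p.2| <= 2 * pi - step by rewrite ger0_norm//; lra.
have : xc q * xc p * step < 6 * N.
  apply: (@adj_nec _ q p N step) => //; [lra|nra|nra| |by rewrite hyp_distC].
  by rewrite (ltW s0).
apply/negP; rewrite -leNgt.
have xx : (N / tau) * (N / tau) <= xc q * xc p by apply: ler_pM; rewrite ?ltW//; lra.
have : (N / tau) * (N / tau) * step <= xc q * xc p * step by rewrite ler_pM2r.
apply: le_trans.
have -> : N / tau * (N / tau) * step = N / tau ^+ 2 * (N * step) by field; rewrite gt_eqF.
apply: (@le_trans _ _ (N / tau ^+ 2 * (8 * tau ^+ 2))).
  have -> : N / tau ^+ 2 * (8 * tau ^+ 2) = 8 * N by field; rewrite gt_eqF.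
  by lra.
by rewrite ler_pM2l ?step_ge// divr_gt0 ?exprn_gt0.
Qed.

Variable g : nat -> nat.
Hypothesis gP : forall b, (b < Gb)%N -> (g b < l)%N /\ empty V (arc_box (b * l + g b)) w.

Local Notation piece := (piece Gb l g).

Let gl b : (b < Gb)%N -> (g b < l)%N.
Proof. by move=> /gP[]. Qed.

Lemma not_gap p : p \in V w -> N / tau < xc p ->
  (arc_index p %% l != g (arc_index p %/ l))%N.
Proof.
move=> pV pt; have [iG i1 i2] := arc_indexP pV; apply/eqP => h.
have [_ eg] := gP (block_lt G0 iG).
have [_ _ xN _ _] := Poi_coord HV N4 pV.
have [h1 _ _ _ _] := arc_box_in iG.
apply: (empty_box_out eg pV) => //; rewrite -?h -?divn_eq//.
- exact: lt_le_trans h1.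
- exact: lt_le_trans N4.
- exact: ltW.
Qed.

Lemma piece_adj p q : p \in V w -> q \in V w -> N / tau < xc p -> N / tau < xc q ->
  hyp_dist p q <= 2 * ln N -> piece (arc_index p) = piece (arc_index q).
Proof.
move=> pV qV pt qt pq; wlog ij : p q pV qV pt qt pq / (arc_index p <= arc_index q)%N.
  move=> h; have [/h->//|/ltnW/h h'] := leqP (arc_index p) (arc_index q).
  by rewrite h'// hyp_distC.
have np := not_gap pV pt; have nq := not_gap qV qt; have [iG _ _] := arc_indexP qV.
have [] := arc_neighbours pV qV pt qt pq ij.
  move: ij; rewrite leq_eqVlt => /orP[/eqP->//|ij] ji.
  have e : arc_index q = (arc_index p).+1 by apply/eqP; rewrite eqn_leq ji.
  by rewrite e in nq iG *; exact: (pieceS G0 gl).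
by move=> [i0 jG]; rewrite i0; exact: (piece_wrap G0 gl).
Qed.

Lemma in_block p : p \in V w -> N / tau < xc p -> block_box (arc_index p %/ l) p.
Proof.
move=> pV pt; have [iG i1 i2] := arc_indexP pV.
have [_ _ xN _ _] := Poi_coord HV N4 pV; have [h1 _ _ _ _] := arc_box_in iG.
have s0 := step_gt0; apply/boxE; [exact: lt_le_trans h1|exact: lt_le_trans N4|].
split => //; first exact: ltW.
  by apply: le_trans i1; rewrite ler_pM2r// ler_nat leq_divM.
apply: (lt_le_trans i2); rewrite ler_pM2r// ler_nat.
by apply: ltn_ceil; move: G0; rewrite /G muln_gt0 => /andP[].
Qed.

Lemma card_le_npoints (C : {set V w}) (A B : set (R * R)) :
  (forall z, z \in C -> A (val z) \/ B (val z)) ->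
  (#|C| <= npoints V A w + npoints V B w)%N.
Proof.
move=> CAB; rewrite cardE -(size_map val).
rewrite /npoints; set a := [fset x in V w | x \in A]%fset; set b := [fset x in V w | x \in B]%fset.
apply: (@leq_trans #|` (a `|` b)%fset|); last by rewrite cardfsU leq_subr.
apply: uniq_leq_size; first by rewrite map_inj_uniq ?enum_uniq//; exact: val_inj.
move=> _ /mapP[z + ->]; rewrite mem_enum => zC.
rewrite !inE /= (valP z)/=; case: (CAB z zC) => h; apply/orP; [left|right]; exact/mem_set.
Qed.

(** Adjacency inside the band preserves the piece, so the component lies in the at most two blocks
    that one piece meets. *)
Lemma component_le (y : V w) : count_event w ->
  (forall z, connect e y z -> N / tau < xc (val z)) -> (#|component e y| <= 2 * cap)%N.
Proof.
move=> cnt band.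
set kk := piece (arc_index (val y)).
have same z : connect e y z -> piece (arc_index (val z)) = kk.
  move=> yz; have /(_ _ _ _ yz) : forall u v : V w,
      connect e y u && (piece (arc_index (val u)) == kk) -> connect e u v ->
      connect e y v && (piece (arc_index (val v)) == kk).
    apply: connect_closed => u v /andP[yu /eqP uk] uv.
    have yv : connect e y v := connect_trans yu (connect1 uv).
    rewrite yv -uk; apply/eqP/esym; apply: piece_adj; [exact: valP|exact: valP|exact: band|exact: band|].
    by case/andP: uv.
  by rewrite connect0 eqxx => /(_ isT)/andP[_ /eqP].
have [kG _] : (kk < Gb)%N /\ True.
  by have [yG _ _] := arc_indexP (valP y); have [] := piece_blocks g G0 yG.
pose k' := (if kk == 0 then Gb.-1 else kk.-1)%N.
have kG' : (k' < Gb)%N.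
  have Gb0 : (0 < Gb)%N by exact: leq_ltn_trans kG.
  rewrite /k'; case: ifP => _; first by rewrite prednK.
  exact: leq_ltn_trans (leq_pred _) kG.
have cb b : (b < Gb)%N -> (npoints V (block_box b) w <= cap)%N.
  by move=> bG; rewrite leqNgt; apply/negP; exact: cnt.
rewrite mul2n -addnn; apply: leq_trans (leq_add (cb _ kG) (cb _ kG')).
apply: card_le_npoints => z; rewrite inE => yz.
have [zG _ _] := arc_indexP (valP z); have [_] := piece_blocks g G0 zG.
by rewrite (same _ yz) -/k' => -[] <-; [left|right]; apply: in_block; [exact: valP|exact: band|exact: valP|exact: band].
Qed.

End Deterministic.

(** All vertices of height at most [N / tau] are connected to the same hub, so any other component
    lies entirely in the band. *)
Lemma L2_le_cap w : hub_event w -> gap_event w -> count_event w ->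
  (L2 (hyp_adj nu n (V w)) <= 2 * cap)%N.
Proof.
move=> /hub_connected[c hc] gap cnt.
have [g gP] : exists g : nat -> nat, forall b, (b < Gb)%N ->
    (g b < l)%N /\ empty V (arc_box (b * l + g b)) w.
  have h b : exists a, (b < Gb)%N -> (a < l)%N /\ empty V (arc_box (b * l + a)) w.
    have [bG|bG] := ltnP b Gb; last by exists 0%N.
    apply: contrapT => h; apply: (gap b bG) => a al ea; apply: h.
    by exists a.
  by have [g gP] := choice h; exists g.
have es : symmetric (hyp_adj nu n (V w)) by exact: hyp_adj_sym.
apply: (L2_le es (x := c)) => y cy; apply: (component_le gP cnt) => z yz.
rewrite ltNge; apply/negP => /hc cz; move/negP: cy; apply.
by apply: connect_trans cz _; rewrite (sym_connect_sym es).
Qed.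

End Giant.

(** * Choice of the parameters *)

Section Intersection.
Context d (T : measurableType d) (R : realType) (P : probability T R).

Lemma prI_ge (A B : set T) : measurable A -> measurable B ->
  pr P A + pr P B - 1 <= pr P (A `&` B).
Proof.
move=> mA mB; have mC := measurableC mA; have h := prDI P mA mB.
have : pr P (~` A `&` B) <= pr P (~` A) by apply: pr_le => //; exact: measurableI.
by rewrite prC//; lra.
Qed.

End Intersection.

Section Asymptotics.
Context {R : realType}.
Implicit Types (nu : R).

Lemma bound_gt (x : R) : x < (Num.bound x)%:R.
Proof.
have := archi_boundP (normr_ge0 x); rewrite /Num.bound normr_id.
exact/le_lt_trans/ler_norm.
Qed.

Lemma natr_le_expn (b k : nat) : (1 < b)%N -> k%:R <= b%:R ^+ k :> R.
Proof. by move=> b1; rewrite -natrX ler_nat ltnW// ltn_expl. Qed.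

Lemma pow_scale (A N : R) (J0 : nat) : 0 < A -> A * 16 ^+ J0 <= N ->
  exists J, [/\ (J0 <= J)%N, A * 16 ^+ J <= N & N <= A * 16 ^+ J.+1].
Proof.
move=> A0 AN; have ex : exists k, N < A * 16 ^+ k.
  exists (Num.bound (N / A)); rewrite -ltr_pdivrMl// mulrC.
  exact: lt_le_trans (bound_gt _) (natr_le_expn _ _).
case: (ex_minnP ex) => -[|k] Nk kmin.
  have : A * 16 ^+ 0 <= A * 16 ^+ J0 by rewrite ler_pM2l// ler_weXn2l// ler1n.
  lra.
have kN : A * 16 ^+ k <= N by rewrite leNgt; apply/negP => /kmin; rewrite ltnn.
exists k; split => //; last exact: ltW.
rewrite -ltnS ltnNge; apply/negP => kJ; have : A * 16 ^+ k.+1 <= A * 16 ^+ J0.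
  by rewrite ler_pM2l// ler_weXn2l// ler1n.
by lra.
Qed.

Lemma truncn_half (x : R) : 1 <= x -> x / 2 <= (Num.truncn x)%:R <= x.
Proof.
move=> x1; have x0 : 0 <= x by lra.
have /andP[h1 h2] := truncn_itv x0; rewrite h1 andbT.
have : 1 <= (Num.truncn x)%:R :> R by rewrite ler1n truncn_gt0.
by move: h2; rewrite -natr1; lra.
Qed.

Lemma ln_ratio nu n : 0 < nu <= 1 -> nu^-1 <= n%:R ->
  ln n%:R <= ln (n%:R / nu) <= 2 * ln n%:R.
Proof.
move=> /andP[nu0 nu1] nn; have n0 : 0 < n%:R :> R by apply: lt_le_trans nn; rewrite invr_gt0.
have nu1' : 1 <= nu^-1 by rewrite invf_ge1.
have p1 : n%:R / nu \is Num.pos by rewrite posrE divr_gt0.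
apply/andP; split; first by rewrite ler_ln ?posrE// ler_peMr// ltW.
have -> : 2 * ln n%:R = ln (n%:R ^+ 2) :> R by rewrite lnXn// mulr_natl.
by rewrite ler_ln// ?posrE ?exprn_gt0// expr2 ler_pM2l.
Qed.

(** [(1 - e^-M)^K <= exp (- K e^-M)], and [K >= 6 e^M] brings this below [e^-6]. *)
Lemma small_power (M : R) : 0 <= M ->
  exists2 K : nat, (0 < K)%N & (1 - expR (- M)) ^+ K <= 64^-1.
Proof.
move=> M0; pose K := Num.bound (6 * expR M); exists K.
  by rewrite -(ltr0n R); apply: lt_trans (bound_gt _); rewrite mulr_gt0 ?expR_gt0.
apply: le_trans (@expRN6 R).
have h : 1 - expR (- M) <= expR (- expR (- M)) by exact: expR_ge1Dx.
apply: (@le_trans _ _ (expR (- expR (- M)) ^+ K)).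
  by rewrite lerXn2r ?nnegrE ?expR_ge0 ?one_sub_expRN_ge0.
rewrite -expRM_natl ler_expR mulrN lerN2 expRN ler_pdivlMr ?expR_gt0//.
exact/ltW/bound_gt.
Qed.

Lemma three_failures (p1 p2 p3 p23 p a1 a2 a3 x eps : R) :
  1 - a1 <= p1 -> 1 - a2 <= p2 -> 1 - a3 <= p3 -> a1 <= x -> a2 <= x -> a3 <= x ->
  3 * x <= eps -> p2 + p3 - 1 <= p23 -> p1 + p23 - 1 <= p -> 1 - eps <= p.
Proof. by lra. Qed.

(** [c2] is fixed before [eps]: only [n0] depends on the tolerated failure. Each of the three
    failure probabilities is at most [N / 4 * 64^-J], which is of order [4^-J] because [N] is of
    order [16^J]. *)
Lemma upper_bound nu : 0 < nu <= 1 -> exists2 c2 : R, 0 < c2 &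
  forall eps : R, 0 < eps -> exists n0 : nat, forall n, (n0 <= n)%N ->
  forall d (T : measurableType d) (P : probability T R) (V : T -> {fset (R * R)}),
  Poi P 2^-1 nu n V -> exists U : set T, [/\ measurable U, 1 - eps <= pr P U &
    forall w, U w -> (L2 (hyp_adj nu n (V w)))%:R <= c2 * ln n%:R].
Proof.
move=> /andP[nu0 nu1]; pose beta := 32 / nu; pose tau := 2 * beta + 2.
have nubeta : nu * beta = 32 by rewrite /beta mulrCA divff ?mulr1 ?gt_eqF.
have nu1' : 1 <= nu^-1 by rewrite invf_ge1.
have beta32 : 32 <= beta by rewrite /beta ler_pdivlMr//; lra.
have beta2 : 2 <= beta by lra.
have tx : tau != 0 by rewrite /tau gt_eqF//; lra.
pose A := 4 * beta ^+ 2.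
have A4 : 4 <= A by rewrite /A; nra.
have A0 : 0 < A by lra.
have t20 : 4 <= 2 * tau ^+ 2 by rewrite /tau; nra.
have tA : 2 * tau ^+ 2 <= 5 * A by rewrite /tau /A; nra.
pose M := nu * (32 * tau ^+ 2).
have M0 : 0 <= M by rewrite /M mulr_ge0 ?(ltW nu0)// mulr_ge0// sqr_ge0.
have [K K0 hK] := small_power M0.
(* A block of [K J] arcs has mean at most [M K J]; with the cap [C J] its tail bound is at most the
   [J]-th power of a number not exceeding 1/64. *)
pose C := Num.bound (64 * expR (M * K%:R)).
have hC : expR (M * K%:R) / 2 ^+ C <= 64^-1.
  have h : 64 * expR (M * K%:R) <= 2 ^+ C.
    exact: le_trans (ltW (bound_gt _)) (natr_le_expn _ _).
  by rewrite ler_pdivrMr ?exprn_gt0// ler_pdivlMl.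
have ln16 : 0 < ln 16 :> R by rewrite ln_gt0// ltr1n.
(* The cap gives [2 C J], and [J <= 2 ln n / ln 16]; the successor makes the constant positive. *)
exists (4 * (C.+1)%:R / ln 16); first by rewrite divr_gt0// mulr_gt0// ltr0n.
move=> eps eps0.
(* The 4 is required by the hubs, [5 K] makes a block of [K J] arcs fit on the circle, and the last
   term yields [48 A 4^-J <= eps]. *)
pose J0 := (4 + 5 * K + Num.bound (48 * A / eps))%N.
exists (Num.bound (A * 16 ^+ J0) + Num.bound (nu^-1))%N => n nn d T P V HV.
have nb : A * 16 ^+ J0 <= n%:R.
  apply: le_trans (ltW (bound_gt _)) _; rewrite ler_nat; apply: leq_trans nn; exact: leq_addr.
have ninv : nu^-1 <= n%:R.
  apply: le_trans (ltW (bound_gt _)) _; rewrite ler_nat; apply: leq_trans nn; exact: leq_addl.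
pose N := n%:R / nu.
have nN : n%:R <= N by rewrite /N ler_peMr.
have N0 : 0 < N by rewrite divr_gt0// (lt_le_trans _ ninv)// invr_gt0.
have [J [J0J JN NJ]] := pow_scale A0 (le_trans nb nN).
have J4 : (4 <= J)%N by apply: leq_trans J0J; rewrite /J0 -addnA leq_addr.
have J5 : (5 * K <= J)%N by apply: leq_trans J0J; rewrite /J0 -addnA addnCA leq_addr.
have JE : 48 * A / eps <= J%:R.
  by apply: le_trans (ltW (bound_gt _)) _; rewrite ler_nat (leq_trans _ J0J)// leq_addl.
have p1 : 1 <= 16 ^+ J :> R by rewrite exprn_ege1// ler1n.
have N4 : 4 <= N by apply: le_trans JN; rewrite -[4]mulr1 ler_pM.
pose l := (K * J)%N; pose Gb := Num.truncn (N / (2 * tau ^+ 2 * l%:R)).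
have l0 : 0 < l%:R :> R by rewrite ltr0n muln_gt0 K0 (leq_trans _ J4).
have t0 : 0 < 2 * tau ^+ 2 by exact: lt_le_trans t20.
have ge1 : 1 <= N / (2 * tau ^+ 2 * l%:R).
  have D0 : 0 < 2 * tau ^+ 2 * l%:R by exact: mulr_gt0.
  rewrite ler_pdivlMr// mul1r; apply: le_trans JN.
  apply: (@le_trans _ _ (5 * A * l%:R)); first by rewrite ler_pM2r.
  rewrite -mulrA mulrCA ler_pM2l// /l natrM mulrA -natrM.
  apply: (@le_trans _ _ (4 ^+ J * 4 ^+ J)); last by rewrite -exprMn -natrM.
  apply: ler_pM => //; last exact: natr_le_expn.
  by apply: le_trans (natr_le_expn _ _); rewrite ?ler_nat.
have lx : l%:R != 0 :> R by rewrite gt_eqF.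
have /andP[Gb1 Gb2] := truncn_half ge1; rewrite -/Gb in Gb1 Gb2.
have Gl : (Gb * l)%:R <= N / (2 * tau ^+ 2).
  have -> : N / (2 * tau ^+ 2) = N / (2 * tau ^+ 2 * l%:R) * l%:R.
    by field; rewrite lx tx.
  by rewrite natrM ler_pM2r.
have Gg : N / (4 * tau ^+ 2) <= (Gb * l)%:R.
  have -> : N / (4 * tau ^+ 2) = N / (2 * tau ^+ 2 * l%:R) / 2 * l%:R.
    by field; rewrite lx tx.
  by rewrite natrM ler_pM2r.
have G0 : (0 < Gb * l)%N.
  by rewrite -(ltr0n R) natrM mulr_gt0//; apply: lt_le_trans Gb1; rewrite divr_gt0// (lt_le_trans ltr01 ge1).
pose cap := (C * J)%N.
pose U1 := hub_event V beta J Gb l.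
pose U2 := gap_event nu n V tau Gb l.
pose U3 := count_event nu n V tau Gb l cap.
have m1 : measurable U1 := measurable_hub_event HV G0 beta2 (erefl tau) J4 JN Gg.
have m2 : measurable U2 := measurable_gap_event HV N4 G0 beta2 (erefl tau) JN.
have m3 : measurable U3 := measurable_count_event HV N4 cap G0 beta2 (erefl tau) JN.
exists (U1 `&` (U2 `&` U3)); split; first by do 2 apply: measurableI => //.
- have h1 : 1 - (Gb * l)%:R * 64^-1 ^+ J <= pr P U1.
    exact: (hub_event_ge HV nu0 N4 G0 beta2 nubeta (erefl tau) J4 JN Gg).
  have h2 : 1 - Gb%:R * (1 - expR (- M)) ^+ l <= pr P U2.
    exact: (gap_event_ge HV nu0 N4 G0 beta2 (erefl tau) JN Gg).
  have h3 : 1 - Gb%:R * (expR (M * l%:R) / 2 ^+ cap.+1) <= pr P U3.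
    exact: (count_event_ge HV nu0 N4 cap G0 beta2 (erefl tau) JN Gg).
  have i1 := prI_ge P m2 m3; have i2 := prI_ge P m1 (measurableI _ _ m2 m3).
  set F := 64^-1 ^+ J in h1.
  have F0 : 0 < F by rewrite exprn_gt0// invr_gt0.
  have q2 : (1 - expR (- M)) ^+ l <= F.
    by rewrite /l exprM lerXn2r ?nnegrE ?exprn_ge0 ?invr_ge0 ?one_sub_expRN_ge0.
  have q3 : expR (M * l%:R) / 2 ^+ cap.+1 <= F.
    apply: (@le_trans _ _ ((expR (M * K%:R) / 2 ^+ C) ^+ J)).
      rewrite expr_div_n -exprM -expRM_natr -mulrA -natrM ler_pM2l ?expR_gt0//.
      by rewrite lef_pV2 ?posrE ?exprn_gt0// ler_weXn2l// ler1n.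
    by rewrite lerXn2r ?nnegrE ?invr_ge0// divr_ge0 ?expR_ge0// exprn_ge0.
  have GbG : Gb%:R <= (Gb * l)%:R :> R.
    by rewrite ler_nat leq_pmulr// -(ltr0n R).
  have GN4 : (Gb * l)%:R <= N / 4.
    by apply: (le_trans Gl); rewrite ler_pM2l// lef_pV2 ?posrE.
  have f4 : 16 ^+ J * F = 4^-1 ^+ J by rewrite -exprMn; congr (_ ^+ J); field.
  have Jf : J%:R * 4^-1 ^+ J <= 1 :> R.
    by rewrite exprVn ler_pdivrMr ?exprn_gt0// mul1r natr_le_expn.
  have NF : N * F <= 16 * A * 4^-1 ^+ J.
    apply: (@le_trans _ _ (A * 16 ^+ J.+1 * F)); first by rewrite ler_pM2r.
    by rewrite exprS -f4 (_ : A * _ * F = 16 * A * (16 ^+ J * F))//; ring.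
  have AE : 48 * A * 4^-1 ^+ J <= eps.
    have : 48 * A <= J%:R * eps by rewrite -ler_pdivrMr.
    have g0 : 0 < 4^-1 ^+ J :> R by rewrite exprn_gt0// invr_gt0.
    rewrite -(ler_pM2r g0) => /le_trans; apply; rewrite mulrAC.
    by rewrite ler_piMl// ltW.
  have b1 : (Gb * l)%:R * F <= N / 4 * F by rewrite ler_pM2r.
  have b2 : Gb%:R * (1 - expR (- M)) ^+ l <= N / 4 * F.
    apply: (@le_trans _ _ (Gb%:R * F)); first by rewrite ler_wpM2l.
    by rewrite ler_pM2r// (le_trans GbG).
  have b3 : Gb%:R * (expR (M * l%:R) / 2 ^+ cap.+1) <= N / 4 * F.
    apply: (@le_trans _ _ (Gb%:R * F)); first by rewrite ler_wpM2l.
    by rewrite ler_pM2r// (le_trans GbG).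
  apply: (three_failures h1 h2 h3 b1 b2 b3 _ i1 i2).
  have -> : 3 * (N / 4 * F) = 3 / 4 * (N * F) by ring.
  apply: le_trans AE; have -> : 48 * A * 4^-1 ^+ J = 3 * (16 * A * 4^-1 ^+ J) by ring.
  apply: ler_pM => //; first by rewrite mulr_ge0 ?ltW.
  by rewrite ler_pdivrMr// ler_peMr// ler1n.
- move=> w [u1 [u2 u3]].
  have LL : (L2 (hyp_adj nu n (V w)) <= 2 * cap)%N.
    by apply: (L2_le_cap HV N4 G0 beta2 (erefl tau) J4 JN Gl Gg u1 u2 u3).
  have nunu : 0 < nu <= 1 by rewrite nu0.
  have /andP[_ lnN] := ln_ratio nunu ninv.
  have JlnN : J%:R * ln 16 <= ln N.
    rewrite mulr_natl -lnXn// ler_ln ?posrE ?exprn_gt0//.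
    by apply: le_trans JN; rewrite ler_peMl ?exprn_ge0// (le_trans _ A4)// ler1n.
  have L2R : (L2 (hyp_adj nu n (V w)))%:R <= (2 * cap)%:R :> R by rewrite ler_nat.
  apply: (le_trans L2R); rewrite /cap !natrM.
  have C1 : C%:R <= C.+1%:R :> R by rewrite ler_nat.
  have JR : J%:R <= 2 * ln n%:R / ln 16 :> R by rewrite ler_pdivlMr// (le_trans JlnN).
  have -> : 4 * C.+1%:R / ln 16 * ln n%:R = 2 * (C.+1%:R * (2 * ln n%:R / ln 16)) :> R by ring.
  by rewrite ler_pM2l// ler_pM.
Qed.

End Asymptotics.

(** * Depth of the tree and constants of the lower bound *)

Section Lower.
Context {R : realType}.
Implicit Types (nu : R).

(** [j] is the least depth with [N <= eta j 48 4^j]. By minimality [N] exceeds the value at [j - 1],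
    which is smaller by a factor of at most 8: 4 from the power, and 2 from [j <= 2 (j - 1)]. *)
Lemma depth_scale (eta N : R) (j0 : nat) : 0 < eta -> (1 < j0)%N ->
  eta * j0%:R * (48 * 4 ^+ j0) < N ->
  exists j, [/\ (j0 <= j)%N, N / (48 * 4 ^+ j) <= eta * j%:R &
    eta / 8 * j%:R <= N / (48 * 4 ^+ j)].
Proof.
move=> eta0 j01 Nj0; pose f (j : nat) := eta * j%:R * (48 * 4 ^+ j).
have f_mono i j : (i <= j)%N -> f i <= f j.
  move=> ij; rewrite /f; apply: ler_pM.
  - by rewrite mulr_ge0// ltW.
  - by rewrite mulr_ge0// exprn_ge0.
  - by rewrite ler_pM2l// ler_nat.
  - by rewrite ler_pM2l// ler_weXn2l// ler1n.
have ex : exists j, N <= f j.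
  exists (Num.bound (N / eta)).
  have h := ltW (bound_gt (N / eta)); rewrite ler_pdivrMr// mulrC in h.
  apply: (le_trans h); rewrite /f ler_peMr//; first by rewrite mulr_ge0// ltW.
  by rewrite mulr_ege1 ?exprn_ege1 ?ler1n.
case: (ex_minnP ex) => j Nj jmin.
have j0j : (j0 < j)%N.
  by rewrite ltnNge; apply/negP => /f_mono h; have := lt_le_trans Nj0 (le_trans Nj h); rewrite ltxx.
have p4 : 0 < 48 * 4 ^+ j :> R by rewrite mulr_gt0// exprn_gt0.
exists j; split; [exact: ltnW|by rewrite ler_pdivrMr|].
rewrite ler_pdivlMr//; case: j Nj jmin j0j p4 => // j Nj jmin j0j p4.
have Nj' : f j < N by rewrite ltNge; apply/negP => /jmin; rewrite ltnn.
apply: le_trans (ltW Nj'); rewrite /f exprS.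
have -> : eta / 8 * j.+1%:R * (48 * (4 * 4 ^+ j)) = eta * (j.+1%:R / 2) * (48 * 4 ^+ j) by field.
rewrite ler_pM2r ?mulr_gt0 ?exprn_gt0// ler_pM2l// ler_pdivrMr// -natrM ler_nat muln2 -addnn.
by rewrite -addn1 leq_add2l; apply: leq_trans (ltnW j01) _; rewrite -ltnS.
Qed.

(** The box below height 48 and the boxes over the two unit arcs are disjoint, so probabilities
    multiply: 400 bounds the area [94 pi] of the former, and 9 is 3 times 3. *)
Lemma two_halves nu n (N := n%:R / nu) d (T : measurableType d) (P : probability T R)
    (V : T -> {fset (R * R)}) (E1 E2 : set T) : Poi P 2^-1 nu n V -> 0 < nu -> 48 <= N ->
  determined P V (box 48 N 1 (1 + 1)) E1 -> 3^-1 <= pr P E1 ->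
  determined P V (box 48 N 2 (2 + 1)) E2 -> 3^-1 <= pr P E2 ->
  measurable (empty V (box 1 48 0 (2 * pi)) `&` (E1 `&` E2)) /\
  expR (- (nu * 400)) / 9 <= pr P (empty V (box 1 48 0 (2 * pi)) `&` (E1 `&` E2)).
Proof.
move=> HV nu0 N48 d1 t1 d2 t2; have p2 := pi_ge2 R; have p4 := pihalf_lt2 R.
have N4 : 4 <= N by lra.
have [||||dE pE] := determinedI HV (A := box 48 N 0 (2 * pi)) _ _ _ _ d1 d2.
- by apply: box_disk; rewrite -?/N; lra.
- by apply: box_sub; lra.
- by apply: box_sub; lra.
- by apply: box_disjoint_angle; lra.
have dZ : determined P V (box 1 48 0 (2 * pi)) (empty V (box 1 48 0 (2 * pi))).
  by apply: (determined_empty_box HV) => //; rewrite -?/N; lra.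
have [||||[mL _] pL] := determinedI HV (A := box 1 N 0 (2 * pi)) _ _ _ _ dZ dE.
- by apply: box_disk; rewrite -?/N; lra.
- by apply: box_sub; lra.
- by apply: box_sub; lra.
- by apply: box_disjoint_radius; lra.
split; first exact: mL.
rewrite pL pE; apply: ler_pM; rewrite ?expR_ge0//.
  apply: le_trans (pr_empty_box HV nu0 N4 _ _ _ _ _ _); rewrite -?/N; try lra.
  by rewrite ler_expR lerN2 ler_pM2l//; lra.
have -> : 9^-1 = 3^-1 * 3^-1 :> R by rewrite -invfM -natrM.
by apply: ler_pM.
Qed.

Lemma ln_le_expn (x c : R) (j : nat) : 0 < x -> 0 < c -> x <= c ^+ j -> ln x <= j%:R * ln c.
Proof.
by move=> x0 c0 xc; rewrite mulr_natl -lnXn// ler_ln ?posrE// exprn_gt0.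
Qed.

Lemma exponent_ge0 (a b c e : R) : b <= c -> a - b <= e -> 0 <= e + (- a + c).
Proof. by lra. Qed.

Lemma lower_event nu n m j (N := n%:R / nu) (Y := 48 * 4 ^+ j) :
  0 < nu <= 1000^-1 -> 4 <= N -> (0 < m)%N -> Y <= N / 2 ->
  48 * (N / Y) <= m%:R -> m%:R <= 96 * (N / Y) ->
  3^-1 <= (5 / 4) ^+ j * (expR (- (nu * (36 * (N / Y)))) * (1 - expR (- (nu / 128))) ^+ m) ->
  forall d (T : measurableType d) (P : probability T R) (V : T -> {fset (R * R)}),
  Poi P 2^-1 nu n V -> exists L : set T,
    [/\ measurable L, expR (- (nu * 400)) / 9 <= pr P L &
        forall w, L w -> (m <= L2 (hyp_adj nu n (V w)))%N].
Proof.
move=> /andP[nu0 nus] N4 m0 YN mN1 mN2 q3 d T P V HV.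
have p2 := pi_ge2 R; have p4 := pihalf_lt2 R.
set q := expR _ * _ ^+ _ in q3.
have q0 : 0 <= q.
  rewrite mulr_ge0 ?expR_ge0// exprn_ge0// one_sub_expRN_ge0//.
  by rewrite divr_ge0// ltW.
have Y1 : 1 <= Y.
  by rewrite mulr_ege1 ?exprn_ege1 ?ler1n.
have lf t : 0 <= t -> t + 48 / Y <= 2 * pi ->
    determined P V (box Y N t (t + 48 / Y)) (leaf nu n V m Y t) /\ q <= pr P (leaf nu n V m Y t).
  by move=> t0 t2; exact: (leaf_pr HV nu0 N4 m0 Y1 YN t0 t2 mN2).
have e48 : 48 / 48 = 1 :> R by rewrite divff.
have tr th : 0 <= th -> th + 1 <= 2 * pi ->
    determined P V (box 48 N th (th + 1)) (tree nu n V m j 48 th) /\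
    3^-1 <= pr P (tree nu n V m j 48 th).
  move=> th0 th2; have c48 : 1 <= 48 :> R by rewrite ler1n.
  have := @tree_pr R d T P nu n V HV nu0 N4 nus m j 48 th q c48 YN q0 lf th0.
  rewrite e48 => /(_ th2)[dt pt]; split => //; apply: le_trans pt.
  by rewrite le_min lexx.
have [|d1 t1] := tr 1 ler01; first by lra.
have [|d2 t2] := tr 2 (ler0n _ _); first by lra.
have N48 : 48 <= N.
  have : 48 <= Y by rewrite /Y ler_peMr// exprn_ege1// ler1n.
  by lra.
have [mL pL] := two_halves HV nu0 N48 d1 t1 d2 t2.
exists (empty V (box 1 48 0 (2 * pi)) `&` (tree nu n V m j 48 1 `&` tree nu n V m j 48 2)).
split => //.
by move=> w [wz [w1 w2]]; exact: (L2_ge_clusters HV N4 m0 wz w1 w2 YN mN1).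
Qed.

Lemma lower_bound nu : 0 < nu <= 1000^-1 -> exists (c1 p : R) (n0 : nat),
  [/\ 0 < c1, 0 < p & forall n, (n0 <= n)%N ->
  forall d (T : measurableType d) (P : probability T R) (V : T -> {fset (R * R)}),
  Poi P 2^-1 nu n V -> exists L : set T, [/\ measurable L, p <= pr P L &
    forall w, L w -> c1 * ln n%:R <= (L2 (hyp_adj nu n (V w)))%:R]].
Proof.
move=> nus; have /andP[nu0 nu1000] := nus.
have nu1 : nu <= 1 by lra.
have e2 : 16 / 8 = 2 :> R by field.
have e54 : 0 < 5 / 4 :> R by rewrite divr_gt0.
have e31 : 3^-1 <= 1 :> R by lra.
pose b := 1 - expR (- (nu / 128)).
have b0 : 0 < b by rewrite subr_gt0 -expR0 ltr_expR oppr_lt0 divr_gt0.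
have b1 : b < 1 by rewrite gtrBl expR_gt0.
(* The exponent paid by a leaf per unit of [N / Y]: 36 for the empty boxes, and at most 96 slots,
   each hit with probability at least [b]. *)
pose D := nu * 36 - 96 * ln b.
have D0 : 0 < D by rewrite subr_gt0 (@lt_trans _ _ 0) ?mulr_gt0// pmulr_rlt0// ln_lt0// b0.
pose s := ln (5 / 4) : R.
have s0 : 0 < s by rewrite ln_gt0//; lra.
(* [s] is the exponent gained per scale, so [N / Y <= eta j] keeps the cost of a leaf below the gain
   of [j] scales. *)
pose eta := s / D.
have eta0 : 0 < eta by rewrite divr_gt0.
have l256 : 0 < ln 256 :> R by rewrite ln_gt0// ltr1n.
(* The 2 is for [depth_scale], [16 / eta] gives [N / Y >= 2], and [48 * eta] gives [N <= 256^j],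
   which compares [j] with [ln n]. *)
pose j0 := (2 + Num.bound (16 / eta) + Num.bound (48 * eta))%N.
(* [m >= 48 N / Y >= 6 eta j], and [j >= ln n / ln 256]. *)
exists (6 * eta / ln 256), (expR (- (nu * 400)) / 9).
exists (Num.bound (eta * j0%:R * (48 * 4 ^+ j0)) + Num.bound nu^-1 + 4)%N.
split; [by rewrite divr_gt0// mulr_gt0|by rewrite divr_gt0 ?expR_gt0|].
move=> n nn; pose N : R := n%:R / nu.
have ninv : nu^-1 <= n%:R.
  apply: le_trans (ltW (bound_gt _)) _; rewrite ler_nat; apply: leq_trans nn.
  by rewrite addnAC leq_addl.
have nu1' : 1 <= nu^-1 by rewrite invf_ge1.
have nN : n%:R <= N by rewrite /N ler_peMr.
have N4 : 4 <= N by apply: le_trans nN; rewrite ler_nat (leq_trans _ nn)// leq_addl.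
have fN : eta * j0%:R * (48 * 4 ^+ j0) < N.
  apply: lt_le_trans nN; apply: lt_le_trans (bound_gt _) _; rewrite ler_nat.
  by apply: leq_trans nn; rewrite -addnA leq_addr.
have [|j [j0j Nj jN]] := depth_scale eta0 _ fN; first by rewrite /j0.
pose Y : R := 48 * 4 ^+ j; rewrite -/Y in Nj jN.
have Y0 : 0 < Y by rewrite mulr_gt0// exprn_gt0.
have j16 : 16 <= eta * j%:R.
  have : 16 / eta <= j%:R.
    apply: le_trans (ltW (bound_gt _)) _; rewrite ler_nat (leq_trans _ j0j)//.
    by rewrite /j0 addnAC leq_addl.
  by rewrite ler_pdivrMr// mulrC.
have NY2 : 2 <= N / Y.
  by apply: le_trans jN; rewrite mulrAC -e2 ler_pM2r// invr_gt0.
have YN : Y <= N / 2 by rewrite ler_pdivlMr// mulrC -ler_pdivlMr.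
pose m := (Num.truncn (48 * (N / Y))).+1.
have NY1 : 1 <= 48 * (N / Y) by rewrite mulr_ege1 ?ler1n// (le_trans _ NY2)// ler1n.
have NY0 : 0 <= 48 * (N / Y) by exact: le_trans NY1.
have /andP[m1 m2] := truncn_itv NY0.
have mN1 : 48 * (N / Y) <= m%:R by exact: ltW.
have mN2 : m%:R <= 96 * (N / Y).
  have -> : 96 * (N / Y) = 48 * (N / Y) + 48 * (N / Y) by ring.
  by rewrite /m -natr1 lerD.
have q3 : 3^-1 <= (5 / 4) ^+ j * (expR (- (nu * (36 * (N / Y)))) * b ^+ m).
  have -> : b ^+ m = expR (m%:R * ln b) by rewrite expRM_natl lnK.
  have -> : (5 / 4 : R) ^+ j = expR (j%:R * s) by rewrite expRM_natl lnK.
  rewrite -!expRD; apply: (le_trans e31).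
  rewrite -[leLHS]expR0 ler_expR.
  have lb : 96 * (N / Y) * ln b <= m%:R * ln b.
    by rewrite ler_wnM2r// ltW// ln_lt0// b0.
  have DN : D * (N / Y) <= j%:R * s.
    rewrite -ler_pdivlMl//; apply: (le_trans Nj).
    by rewrite /eta mulrAC [D^-1 * _]mulrC [s * _]mulrC.
  have DE : D * (N / Y) = nu * (36 * (N / Y)) - 96 * (N / Y) * ln b by rewrite /D; ring.
  by rewrite DE in DN; exact: exponent_ge0 lb DN.
move=> d T P V HV.
have [L [mL pL LL]] := lower_event nus N4 (ltn0Sn _) YN mN1 mN2 q3 HV.
exists L; split => // w /LL mw.
have mL2 : m%:R <= (L2 (hyp_adj nu n (V w)))%:R :> R by rewrite ler_nat.
apply: le_trans mL2; apply: le_trans mN1.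
have nunu : 0 < nu <= 1 by rewrite nu0.
have /andP[lnN _] := ln_ratio nunu ninv.
have N256 : N <= 256 ^+ j.
  have Nj' : N <= eta * j%:R * Y by rewrite -ler_pdivrMr.
  apply: (le_trans Nj').
  have e48 : 48 * eta <= 4 ^+ j.
    apply: le_trans (ltW (bound_gt _)) _; apply: (@le_trans _ _ j%:R); last exact: natr_le_expn.
    by rewrite ler_nat (leq_trans _ j0j)// leq_addl.
  have -> : eta * j%:R * Y = 48 * eta * (j%:R * 4 ^+ j) by rewrite /Y; ring.
  have -> : 256 ^+ j = 4 ^+ j * (16 ^+ j * 4 ^+ j) :> R.
    by rewrite -!exprMn; congr (_ ^+ j); ring.
  apply: ler_pM => //; first by rewrite mulr_ge0// ltW.
  by rewrite ler_pM2r ?exprn_gt0// natr_le_expn.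
have lnj : ln N <= j%:R * ln 256.
  by apply: ln_le_expn N256; rewrite ?ltr0n// (lt_le_trans _ N4).
have jl : ln n%:R / ln 256 <= j%:R :> R by rewrite ler_pdivrMr// (le_trans lnN).
have -> : 6 * eta / ln 256 * ln n%:R = 48 * (eta / 8 * (ln n%:R / ln 256)) by field; rewrite gt_eqF.
rewrite ler_pM2l//; apply: le_trans jN.
by rewrite ler_pM2l// divr_gt0.
Qed.

End Lower.

Theorem proposition2 (R : realType) :
  exists nu0 : R, 0 < nu0 /\
  forall nu : R, 0 < nu <= nu0 ->
  exists (p c1 c2 : R) (n0 : nat),
    [/\ 0 < p, 0 < c1, c1 <= c2 &
     forall n : nat, (n0 <= n)%N ->
     forall (d : measure_display) (T : measurableType d) (P : probability T R)
            (V : T -> {fset (R * R)}),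
       Poi P (2^-1) nu n V ->
       let E := [set w | c1 * ln n%:R <= (L2 (hyp_adj nu n (V w)))%:R
                                      <= c2 * ln n%:R] in
       measurable E /\ (p%:E <= P E)%E].
Proof.
exists 1000^-1; split; first by rewrite invr_gt0 ltr0n.
move=> nu nus; have /andP[nu0 nu1000] := nus.
have nu1 : 0 < nu <= 1 by rewrite nu0/=; lra.
have [c1 [p [n1 [c10 p0 low]]]] := lower_bound nus.
have [c2 c20 upp] := upper_bound nu1.
have p20 : 0 < p / 2 by rewrite divr_gt0.
(* An upper bound that fails with probability at most [p / 2] leaves [p / 2] for both bounds
   together. *)
have [n2 up] := upp _ p20.
exists (p / 2), c1, (Num.max c1 c2), (n1 + n2 + Num.bound nu^-1 + 1)%N; split => //.
  by rewrite le_max lexx.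
move=> n nn d T P V HV E.
have nn1 : (n1 <= n)%N by apply: leq_trans nn; rewrite -!addnA leq_addr.
have nn2 : (n2 <= n)%N by apply: leq_trans nn; rewrite -!addnA addnCA leq_addr.
have n0 : (0 < n)%N by apply: leq_trans nn; rewrite addn1.
have ninv : nu^-1 <= n%:R.
  apply: le_trans (ltW (bound_gt _)) _; rewrite ler_nat; apply: leq_trans nn.
  by rewrite -addnA addnCA leq_addr.
have N1 : 1 <= n%:R / nu by rewrite ler_pdivlMr// mul1r (le_trans _ (_ : 1 <= n%:R)) ?ler1n//; lra.
have mE : measurable E.
  exact: (measurable_L2 HV [set k | c1 * ln n%:R <= k%:R <= Num.max c1 c2 * ln n%:R] N1).
have [L [mL pL Lw]] := low n nn1 d T P V HV.
have [U [mU pU Uw]] := up n nn2 d T P V HV.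
have mLU : measurable (L `&` U) by exact: measurableI.
split => //; rewrite (prE P mE) lee_fin.
have LUE : L `&` U `<=` E.
  move=> w [/Lw lw /Uw uw]; rewrite /E/= lw/= (le_trans uw)//.
  by rewrite ler_wpM2r ?ln_ge0 ?ler1n// le_max lexx orbT.
apply: le_trans (pr_le P mLU mE LUE).
by have := prI_ge P mL mU; lra.
Qed.
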